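(* Let $C\subset\mathbb{C}^2$ be an irreducible curve, viewed as a smooth projective curve, and consider the escape-rate function $G^+$ restricted to $C\setminus S^+$. Then: (i) $G^+$ extends to a continuous subharmonic function on $C\setminus S_0^+$, and this extension satisfies $G^+(t_0)=0$ at every $t_0\in S^+\setminus S_0^+$; (ii) for any $t_0\in S_0^+$ and any uniformizer $u$ at $t_0$, the function $G^++\frac{\gamma_n}{3^n}\log|u|$ extends to a harmonic function in a neighbourhood of $t_0$ for every sufficiently large $n$.
   Context: $f_{a,b}(z)=z^3-3a^2z+b$. We also denote by $C$ the normalization of the Zariski closure of $C$ in $\mathbb{P}^2$; $a,b$ are rational functions on it, and $c_n:=f^n_{a,b}(a)$ ($n$-th iterate). For $t_0\in C$: $\gamma_a=-\mathrm{ord}_{t_0}a$, $\gamma_b=-\mathrm{ord}_{t_0}b$, $\gamma_{\max}=\max\{3\gamma_a,\gamma_b\}$, $\gamma_n=-\mathrm{ord}_{t_0}c_n$. $S^+=\{t_0\in C:\gamma_{\max}>0\}$ (the poles of $a$ or $b$), $S_0^+=\{t_0\in C:\lim_n\gamma_n=\infty\}\subset S^+$. $G^+(a,b)=\lim_{n\to\infty}3^{-n}\log^+|f^n_{a,b}(a)|$, defined on $C\setminus S^+$. A uniformizer at $t_0$ is a rational function $u$ on $C$ with $\mathrm{ord}_{t_0}u=1$. *)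

(* Defs.v *)
From HB Require Import structures.
From mathcomp Require Import all_boot all_order all_algebra.
From mathcomp Require Import complex.
From mathcomp Require Import all_classical all_reals all_analysis.
Set Implicit Arguments.
Unset Strict Implicit.
Unset Printing Implicit Defensive.
Import Order.TTheory GRing.Theory Num.Theory.
Import numFieldNormedType.Exports.
Local Open Scope classical_set_scope.
Local Open Scope ring_scope.

(* A polynomial in two variables is an element of {poly {poly A}}: the inner
   variable is the first coordinate x, the outer one the second coordinate y. *)
Definition eval2 (A : comNzRingType) (P : {poly {poly A}}) (x y : A) : A :=
  P.[y%:P].[x].

Definition irreducible_elt (A : unitRingType) (p : A) : Prop :=
  [/\ p != 0, p \isn't a GRing.unit &
      forall q r : A, p = q * r -> q \is a GRing.unit \/ r \is a GRing.unit].

Definition irreducible_curve (R : realType) (C : set (R[i] * R[i])) : Prop :=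
  exists P : {poly {poly R[i]}},
    irreducible_elt P /\ C = [set p | eval2 P p.1 p.2 = 0].

(* The field of rational functions on the curve C: the fraction field of the
   ring of polynomial functions on C.  The fields ff_a and ff_b are the two
   coordinate functions; ff_eq0 and ff_gen determine the structure up to a
   unique isomorphism. *)
Record functionField (R : realType) (C : set (R[i] * R[i])) := FunctionField {
  ff_field :> fieldType;
  ff_const : {rmorphism R[i] -> ff_field};
  ff_a : ff_field;
  ff_b : ff_field;
  ff_eval := fun P : {poly {poly R[i]}} =>
    eval2 (map_poly (map_poly ff_const) P) ff_a ff_b;
  ff_eq0 : forall P : {poly {poly R[i]}},
    ff_eval P = 0 <-> (forall p, C p -> eval2 P p.1 p.2 = 0);
  ff_gen : forall g : ff_field, exists P Q : {poly {poly R[i]}},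
    ff_eval Q != 0 /\ g = ff_eval P / ff_eval Q
}.

(* The points of the normalization of the closure of C in P^2, i.e. of the
   smooth projective curve with function field F.  A point is given by its
   local ring, a discrete valuation ring of F containing the constants (all of
   them occur), and this ring is encoded by its normalized valuation ord.
   The value -oo is not taken, since ord g + ord g^-1 = ord 1 = 0. *)
Record place (R : realType) (C : set (R[i] * R[i])) (F : functionField C) :=
Place {
  ord : F -> \bar int;
  ord_eqy : forall g : F, ord g = +oo%E <-> g = 0;
  ordM : forall g h : F, ord (g * h) = (ord g + ord h)%E;
  ordD : forall g h : F, (Order.min (ord g) (ord h) <= ord (g + h))%E;
  ord_const : forall c : R[i], c != 0 -> ord (ff_const F c) = 0%E;
  ord_uniformizer : exists u : F, ord u = 1%E
}.

Section Curve.
Context (R : realType) (C : set (R[i] * R[i])) (F : functionField C).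
Implicit Types (t : place F) (g u : F).

Definition regular_at t g : Prop := (0 <= ord t g)%E.

(* The residue of g at t; meaningful if g is regular at t, in which case there
   is exactly one such c. *)
Definition value_at t g : R[i] :=
  xget 0 [set c | (0 < ord t (g - ff_const F c))%E].

Definition uniformizer t u : Prop := ord t u = 1%E.

HB.instance Definition _ := gen_eqMixin (place F).
HB.instance Definition _ := gen_choiceMixin (place F).

(* The classical topology of the curve: the coarsest one making every rational
   function continuous as a map to the Riemann sphere.  The following sets form
   a subbase of it: the preimages under g of a disc D(c, e) and of the
   neighbourhood |w| > e of infinity are the sets of (g - c) / e and of e / g. *)
Definition place_subbase (g : F) : set (place F) :=
  [set t | regular_at t g /\ Normc.normc (value_at t g) < 1].

HB.instance Definition _ :=
  isSubBaseTopological.Build (place F) (range place_subbase) id.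

End Curve.

Section Plane.
Context (R : realType).
Implicit Types (p : R * R) (h : R * R -> R) (D : set (R * R)).

(* The complex plane as R * R, with p standing for p.1 +i* p.2. *)

Definition disc (r : R) : set (R * R) :=
  [set p | p.1 ^+ 2 + p.2 ^+ 2 < r ^+ 2].

Definition closed_disc p (r : R) : set (R * R) :=
  [set q | (q.1 - p.1) ^+ 2 + (q.2 - p.2) ^+ 2 <= r ^+ 2].

Definition ddx h : R * R -> R := fun p => 'D_(1, 0) h p.
Definition ddy h : R * R -> R := fun p => 'D_(0, 1) h p.

Definition C1_on D h : Prop := forall p, D p ->
  [/\ derivable h p (1, 0), derivable h p (0, 1),
      {for p, continuous (ddx h)} & {for p, continuous (ddy h)}].

Definition C2_on D h : Prop := [/\ C1_on D h, C1_on D (ddx h) & C1_on D (ddy h)].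

Definition planar_harmonic D h : Prop :=
  C2_on D h /\ forall p, D p -> ddx (ddx h) p + ddy (ddy h) p = 0.

(* Upper semicontinuity and the mean value inequality on all closed discs
   contained in D.  The integral is extended real valued, as it may be -oo. *)
Definition planar_subharmonic D h : Prop :=
  (forall p, D p -> forall e : R, 0 < e -> \forall q \near p, h q < h p + e) /\
  (forall p (r : R), 0 < r -> closed_disc p r `<=` D ->
    ((h p)%:E <= ((2 * pi)^-1)%:E *
      \int[lebesgue_measure]_(x in `[0%R, (2 * pi)%R])
        (h (p.1 + r * cos x, p.2 + r * sin x))%:E)%E).

End Plane.

Section RiemannSurface.
Context (R : realType) (C : set (R[i] * R[i])) (F : functionField C).
Implicit Types (t : place F) (u : F) (U : set (place F)) (h : place F -> R).

(* The rational function u restricts to a homeomorphism from a neighbourhood of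
   t onto disc r, with inverse psi and mapping t to 0.  (By definition of the
   topology, u is continuous where it is regular.) *)
Definition coordinate_disc t u (r : R) (psi : R * R -> place F) : Prop :=
  [/\ 0 < r, psi (0, 0) = t,
      forall p, disc r p ->
        regular_at (psi p) u /\ value_at (psi p) u = (p.1 +i* p.2)%C,
      forall p, disc r p -> {for p, continuous psi} &
      open (psi @` disc r)].

(* U is open as soon as one of the following two conditions holds. *)
Definition harmonic_on U h : Prop := forall t, U t -> forall u, uniformizer t u ->
  exists r psi, [/\ coordinate_disc t u r psi, psi @` disc r `<=` U &
                    planar_harmonic (disc r) (h \o psi)].

Definition subharmonic_on U h : Prop := forall t, U t -> forall u, uniformizer t u ->
  exists r psi, [/\ coordinate_disc t u r psi, psi @` disc r `<=` U &
                    planar_subharmonic (disc r) (h \o psi)].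

End RiemannSurface.

(* f_{a,b}, over any commutative ring. *)
Definition cubic (A : comNzRingType) (a b z : A) : A :=
  z ^+ 3 - 3%:R * a ^+ 2 * z + b.

Section MarkedCubic.
Context (R : realType) (C : set (R[i] * R[i])) (F : functionField C).
Implicit Types (t : place F).

Definition c_ (n : nat) : F := iter n (cubic (ff_a F) (ff_b F)) (ff_a F).

(* The extended integers below equal -oo exactly when the corresponding
   rational function is identically 0 on the curve. *)
Definition gamma_a t : \bar int := (- ord t (ff_a F))%E.
Definition gamma_b t : \bar int := (- ord t (ff_b F))%E.
Definition gamma_max t : \bar int := maxe (3%:E * gamma_a t)%E (gamma_b t).
Definition gamma (n : nat) t : \bar int := (- ord t (c_ n))%E.

Definition Splus : set (place F) := [set t | (0 < gamma_max t)%E].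

Definition S0plus : set (place F) :=
  [set t | forall M : int, exists N, forall n, (N <= n)%N -> (M%:E <= gamma n t)%E].

(* Here ln 0 = 0, so that logplus 0 = 0. *)
Definition logplus (x : R) : R := Num.max 0 (ln x).

(* Meaningful outside Splus. *)
Definition Gplus t : R :=
  let a := value_at t (ff_a F) in
  let b := value_at t (ff_b F) in
  limn (fun n => (3 ^+ n)^-1 * logplus (Normc.normc (iter n (cubic a b) a))).

End MarkedCubic.

(* Main.v *)
(* Around a place [t] with uniformizer [u], Puiseux expansion (Hensel reduction to a
   simple root, then the implicit function theorem) makes every rational function analytic in
   [u]; this gives the coordinate discs, in which "analytic" means: uniform limit of polynomials.
   Subharmonicity of [log^+ |q|] for a polynomial [q] comes from averages over roots of unity,
   so a continuous function which is a suitable limit of [3^-n log^+ |q_n|] is subharmonic.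
   With [|a| <= M], [|b| <= M^3], the sequence [3^-n log^+ |c_n|] converges to [G^+] at the rate
   [3^-n log M], and once [|c_n| > 4 M] one has [log |c_n| <= 3^n G^+ + 1].
   At a pole [t] outside [S_0^+], all the [c_n] have poles of order at most [k = - ord a], and
   [(c_n - a)^2 (c_n + 2 a) = c_(n+1) - c_1] forces [c_n] to agree with [- 2 a] or with
   [a + const] to order [k / 2].  The maximum principle applied to the error then shows that a
   bound [m] for [G^+] on a small circle around [t] gives [3 m / 4] on a smaller one; hence
   [G^+] tends to 0 at [t].
   At a point of [S_0^+], [c_(n+1) = c_n^3 (1 + small)] with [small] analytic, and summing the
   logarithms gives the harmonic extension. *)

(* Analytic functions are uniform limits of polynomials so that every estimate is one on
   coefficients: averages over roots of unity replace the Cauchy integral, at the price of a factor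
   1/(1 - x) in the maximum principle, harmless once divided by 3^n. The obstacle is a pole outside
   S_0^+. There the trivial bound G^+ <= k log (1/|z|) + O(1), with k = - ord a, does not even give
   boundedness. Agreement to order k/2 repairs this: the error of c_n is z^j, with j = ceil (k/2),
   times a function analytic on a disc that does not depend on n. If G^+ <= m on a circle, that
   function is O(e^(3^n m)) there, hence inside. At |z| with 3^n m = (k + j) log (1/|z|) this gives
   c_n = O(|z|^-k) uniformly in n, so G^+ <= m k / (k + j) + O(3^-n). The ratio is at most 2/3,
   which leaves room for the 3/4. Places are abstract valuations. A disc around t has to be filled
   with them, as orders of vanishing along the analytic branch, and these must be shown to exhaust a
   neighbourhood of t: otherwise nothing is known to be open. *)
Require Import Defs.
From HB Require Import structures.
From mathcomp Require Import all_boot all_order all_algebra.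
From mathcomp Require Import complex finmap.
From mathcomp Require Import all_classical all_reals all_analysis.
From mathcomp Require Import polyXY ring lra zify.
Set Implicit Arguments.
Unset Strict Implicit.
Unset Printing Implicit Defensive.
Import Order.TTheory GRing.Theory Num.Theory.
Import numFieldNormedType.Exports.
Local Open Scope classical_set_scope.
Local Open Scope ring_scope.
Local Notation nc := Normc.normc.
Local Notation Re := complex.Re.
Local Notation Im := complex.Im.

(** * Moduli and polynomials over the complex numbers *)

Section ComplexModulus.
Context {R : realType}.
Implicit Types (z w : R[i]) (x : R).

Lemma eqRle (x y : R) : x = y -> x <= y.
Proof. by move->. Qed.

Lemma nc_ge0 z : 0 <= nc z.
Proof. by case: z => a b; exact: sqrtr_ge0. Qed.

Lemma nc0 : nc (0 : R[i]) = 0. Proof. exact: Normc.normc0. Qed.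
Lemma nc1 : nc (1 : R[i]) = 1. Proof. exact: Normc.normc1. Qed.
Lemma ncM z w : nc (z * w) = nc z * nc w. Proof. exact: Normc.normcM. Qed.
Lemma ncV z : nc z^-1 = (nc z)^-1. Proof. exact: Normc.normcV. Qed.
Lemma ncN z : nc (- z) = nc z. Proof. exact: normcN. Qed.
Lemma ncD z w : nc (z + w) <= nc z + nc w. Proof. exact: le_normcD. Qed.
Lemma ncB z w : nc (z - w) <= nc z + nc w. Proof. by rewrite -(ncN w) ncD. Qed.
Lemma ncC z w : nc (z - w) = nc (w - z). Proof. by rewrite -ncN opprB. Qed.

Lemma nc_eq0 z : (nc z == 0) = (z == 0).
Proof.
by apply/eqP/eqP => [/Normc.eq0_normc //|->]; exact: nc0.
Qed.

Lemma nc_gt0 z : (0 < nc z) = (z != 0).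
Proof. by rewrite lt_neqAle eq_sym nc_eq0 nc_ge0 andbT. Qed.

Lemma ncX z n : nc (z ^+ n) = nc z ^+ n.
Proof. by elim: n => [|n IH]; rewrite ?expr0 ?nc1 // !exprS ncM IH. Qed.

Lemma nc_real x : nc (x%:C)%C = `|x|.
Proof. by rewrite /= expr0n /= addr0 sqrtr_sqr. Qed.

Lemma nc_nat n : nc (n%:R : R[i]) = n%:R.
Proof.
have -> : (n%:R : R[i]) = (n%:R)%:C%C by rewrite -(rmorph_nat (real_complex R)).
by rewrite nc_real ger0_norm.
Qed.

Lemma nc_sqr z : nc z ^+ 2 = Re z ^+ 2 + Im z ^+ 2.
Proof. by case: z => a b /=; rewrite sqr_sqrtr // addr_ge0 // sqr_ge0. Qed.

Lemma nc_Re z : `|Re z| <= nc z.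
Proof.
rewrite -(@ler_pXn2r _ 2) ?nnegrE ?normr_ge0 ?nc_ge0 // nc_sqr real_normK ?num_real //.
by rewrite lerDl sqr_ge0.
Qed.

Lemma nc_Im z : `|Im z| <= nc z.
Proof.
rewrite -(@ler_pXn2r _ 2) ?nnegrE ?normr_ge0 ?nc_ge0 // nc_sqr real_normK ?num_real //.
by rewrite lerDr sqr_ge0.
Qed.

Lemma nc_le_ReIm z : nc z <= `|Re z| + `|Im z|.
Proof.
rewrite -(@ler_pXn2r _ 2) ?nnegrE ?nc_ge0 ?addr_ge0 // nc_sqr.
rewrite -(real_normK (num_real (Re z))) -(real_normK (num_real (Im z))).
have := normr_ge0 (Re z); have := normr_ge0 (Im z); nra.
Qed.

Lemma nc_triangle z w u : nc (z - w) <= nc (z - u) + nc (u - w).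
Proof. by apply: le_trans (ncD _ _); rewrite addrA subrK. Qed.

Lemma nc_dist_le z w : nc z <= nc w + nc (z - w).
Proof. by apply: le_trans (ncD _ _); rewrite addrC subrK. Qed.

Lemma nc_sum (I : Type) (r : seq I) (P : pred I) (f : I -> R[i]) :
  nc (\sum_(i <- r | P i) f i) <= \sum_(i <- r | P i) nc (f i).
Proof.
elim/big_ind2 : _ => [|x y u v h k|//]; first by rewrite nc0.
by apply: le_trans (ncD _ _) (lerD h k).
Qed.

Lemma nc_prod (I : Type) (r : seq I) (P : pred I) (f : I -> R[i]) :
  nc (\prod_(i <- r | P i) f i) = \prod_(i <- r | P i) nc (f i).
Proof. by apply: (big_morph _ ncM nc1). Qed.

Lemma ReD z w : Re (z + w) = Re z + Re w. Proof. by case: z w => ? ? []. Qed.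
Lemma ImD z w : Im (z + w) = Im z + Im w. Proof. by case: z w => ? ? []. Qed.
Lemma ReN z : Re (- z) = - Re z. Proof. by case: z. Qed.
Lemma ImN z : Im (- z) = - Im z. Proof. by case: z. Qed.
Lemma ReM z w : Re (z * w) = Re z * Re w - Im z * Im w.
Proof. by case: z w => ? ? []. Qed.
Lemma ImM z w : Im (z * w) = Re z * Im w + Im z * Re w.
Proof. by case: z w => ? ? []. Qed.
Lemma ReCM (x : R) z : Re (x%:C%C * z) = x * Re z.
Proof. by case: z => a b /=; ring. Qed.

Definition cis (t : R) : R[i] := (cos t +i* sin t)%C.

Lemma nc_cis t : nc (cis t) = 1.
Proof. by rewrite /= cos2Dsin2 sqrtr1. Qed.

Lemma cisD s t : cis (s + t) = cis s * cis t.
Proof. by rewrite /cis cosD sinD; apply/eqP; rewrite eq_complex /= eqxx /= addrC. Qed.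

Lemma cis0 : cis 0 = 1. Proof. by rewrite /cis cos0 sin0. Qed.

Lemma cisX t n : cis t ^+ n = cis (n%:R * t).
Proof.
elim: n => [|n IH]; first by rewrite mul0r cis0.
by rewrite exprS IH -cisD -nat1r mulrDl mul1r.
Qed.

Lemma cis2pi : cis (2 * pi) = 1.
Proof. by rewrite mulr_natl /cis cos2pi sin2pi. Qed.

(** By the half-angle formula cos t = 1 forces sin (t/2) = 0, while t/2 lies strictly between 0 and
    pi. *)
Lemma cis_neq1 (t : R) : 0 < t < 2 * pi -> cis t != 1.
Proof.
move=> /andP[t0 t1]; apply/negP => /eqP [c _].
have s0 : 0 < sin (t / 2) by apply: sin_gt0_pi; apply/andP; split; lra.
have : cos (t / 2 + t / 2) = 1 by rewrite (_ : t / 2 + t / 2 = t) //; lra.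
rewrite cosD; have := cos2Dsin2 (t / 2); nra.
Qed.

Lemma prim_root_cis n : (0 < n)%N -> n.-primitive_root (cis (2 * pi / n%:R)).
Proof.
move=> n0; have n0' : 0 < n%:R :> R by rewrite ltr0n.
have pi0 := @pi_gt0 R.
apply/andP; split=> //; apply/forallP => i; rewrite unity_rootE cisX.
have [->|ne] := eqVneq i.+1 n.
  by rewrite (_ : _ * _ = 2 * pi) ?cis2pi ?eqxx //; field; rewrite gt_eqF.
rewrite eqbF_neg; apply: cis_neq1; have := ltn_ord i.
rewrite leq_eqVlt (negPf ne) /= => lt.
rewrite mulrA divr_gt0 ?mulr_gt0 //= ltr_pdivrMr // mulrC ltr_pM2l ?ltr_nat //.
by rewrite mulr_gt0.
Qed.

Lemma sum_prim_root (n l : nat) (w : R[i]) : n.-primitive_root w ->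
  \sum_(i < n) w ^+ (i * l) = if (n %| l)%N then n%:R else 0.
Proof.
move=> pw; have n0 := prim_order_gt0 pw.
under eq_bigr do rewrite mulnC exprM.
rewrite (prim_order_dvd pw); case: eqVneq => [->|ne].
  under eq_bigr do rewrite expr1n.
  by rewrite sumr_const card_ord.
apply/eqP; rewrite -(inj_eq (mulfI (_ : w ^+ l - 1 != 0))) ?subr_eq0 // mulr0.
by rewrite -subrX1 exprAC (prim_expr_order pw) expr1n subrr.
Qed.

End ComplexModulus.

Section PolyBounds.
Context {R : realType}.
Implicit Types (q : {poly R[i]}) (z w : R[i]) (d S : R).

(** Orthogonality of the powers of a root of unity: summing against w^(im) keeps exactly the
    frequencies k with k + m = 0 mod n. This is the substitute for the Cauchy integral. *)
Lemma sum_horner_roots q d (n m : nat) w : n.-primitive_root w ->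
  \sum_(i < n) q.[d%:C%C * w ^+ i] * w ^+ (i * m) =
  n%:R * \sum_(k < size q | (n %| k + m)%N) q`_k * d%:C%C ^+ k.
Proof.
move=> pw.
under eq_bigr do rewrite horner_coef mulr_suml.
rewrite exchange_big /= [in RHS]big_mkcond mulr_sumr /=; apply: eq_bigr => k _.
transitivity (q`_k * d%:C%C ^+ k * \sum_(i < n) w ^+ (i * (k + m))).
  rewrite mulr_sumr; apply: eq_bigr => i _.
  by rewrite exprMn mulnDr exprD -exprM !mulrA.
rewrite sum_prim_root //; case: ifP => _; last by rewrite !mulr0.
by rewrite mulrC.
Qed.

Lemma sum_horner_coef q d (n j : nat) w : n.-primitive_root w ->
  (size q + j <= n)%N ->
  \sum_(i < n) q.[d%:C%C * w ^+ i] * w ^+ (i * (n - j)) =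
  n%:R * (q`_j * d%:C%C ^+ j).
Proof.
move=> pw le; rewrite sum_horner_roots //; congr (_ * _).
have n0 := prim_order_gt0 pw.
(* Since k < size q and size q + j <= n, the number k + n - j lies strictly between 0 and 2n. *)
have P (k : 'I_(size q)) : (n %| k + (n - j))%N = (k == j :> nat).
  have kq := ltn_ord k; apply/idP/eqP => [/dvdnP[c ce]|->].
    case: c ce => [|[|c]] ce; [lia|lia|].
    have : (2 * n <= c.+2 * n)%N by rewrite leq_mul2r orbC.
    lia.
  by rewrite subnKC ?dvdnn //; lia.
under eq_bigl do rewrite P.
have [lt|ge] := ltnP j (size q).
  by rewrite (big_pred1 (Ordinal lt)).
rewrite nth_default // mul0r big1 // => k /eqP kj; have := ltn_ord k; lia.
Qed.

(** Discrete Cauchy inequality: the coefficient is an exact average over n-th roots of unity as soon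
    as n >= size q + j. *)
Lemma coef_bound q d S (j : nat) : 0 < d ->
  (forall w, nc w = d -> nc q.[w] <= S) -> nc q`_j * d ^+ j <= S.
Proof.
move=> d0 h; set n := (size q + j).+1.
have n0 : 0 < n%:R :> R by rewrite ltr0n.
have pw := @prim_root_cis R n isT.
have := sum_horner_coef d pw (leqnSn _) => /(congr1 (@Normc.normc R)).
rewrite ncM nc_nat ncM ncX nc_real (gtr0_norm d0) => E.
rewrite -(ler_pM2l n0) -E; apply: le_trans (nc_sum _ _ _) _.
apply: le_trans (_ : _ <= \sum_(i < n) S) _; last by rewrite sumr_const card_ord mulr_natl.
apply: ler_sum => i _; rewrite ncM !ncX nc_cis !expr1n mulr1; apply: h.
by rewrite ncM ncX nc_cis expr1n mulr1 nc_real gtr0_norm.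
Qed.

(** The conjugate values only contribute frequencies k + j with 0 < k + j < n, which average to 0,
    so the average of q equals that of 2 Re q. Positivity of j matters: an imaginary constant is
    invisible to the real part. *)
Lemma coef_bound_Re q d S (j : nat) : 0 < d -> (0 < j)%N ->
  (forall w, nc w = d -> `|Re q.[w]| <= S) -> nc q`_j * d ^+ j <= 2 * S.
Proof.
move=> d0 j0 h; set n := (size q + j)%N.
have nn : (0 < n)%N by rewrite /n; lia.
have n0 : 0 < n%:R :> R by rewrite ltr0n.
have pw := @prim_root_cis R n nn; set w := cis _ in pw.
have wJ i : ((w ^+ i)^*)%C = (w ^+ i)^-1.
  have w0 : w ^+ i != 0 by rewrite expf_neq0 // -nc_gt0 nc_cis.
  apply: (mulfI w0); rewrite mulfV //.
  rewrite rmorphXn /= -exprMn /w /cis; apply/eqP.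
  rewrite (_ : _ * _ = 1) ?expr1n //; apply/eqP; rewrite eq_complex /=.
  by rewrite /= mulrN opprK -!expr2 cos2Dsin2 eqxx /= mulrN addrC mulrC subrr.
have E1 := sum_horner_coef d pw (leqnn _).
have E2 : \sum_(i < n) (q.[d%:C%C * w ^+ i]^*)%C * w ^+ (i * (n - j)) = 0.
  transitivity ((\sum_(i < n) q.[d%:C%C * w ^+ i] * w ^+ (i * j))^*)%C.
    rewrite rmorph_sum /=; apply: eq_bigr => i _; rewrite rmorphM /=; congr (_ * _).
    rewrite wJ; apply: (mulIf (_ : w ^+ (i * j) != 0)).
      by rewrite expf_neq0 // -nc_gt0 nc_cis.
    rewrite -exprD -mulnDr subnK ?mulVf //; last by rewrite /n; lia.
      by rewrite mulnC exprM (prim_expr_order pw) expr1n.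
    by rewrite expf_neq0 // -nc_gt0 nc_cis.
  rewrite sum_horner_roots // big1 ?mulr0 ?conjc0 // => k /dvdnP[c ce].
  have := ltn_ord k; case: c ce => [|c] ce; first by lia.
  have : (n <= c.+1 * n)%N by rewrite leq_pmull.
  by rewrite -ce /n; lia.
have E : \sum_(i < n) (2 * (Re q.[d%:C%C * w ^+ i])%:C%C) * w ^+ (i * (n - j)) =
    n%:R * (q`_j * d%:C%C ^+ j).
  move: (congr2 +%R E1 E2); rewrite addr0 -big_split /= => <-; apply: eq_bigr => i _.
  by rewrite -mulrDl addcJ.
move/(congr1 (@Normc.normc R)): E; rewrite ncM nc_nat ncM ncX nc_real (gtr0_norm d0) => E.
rewrite -(ler_pM2l n0) -E; apply: le_trans (nc_sum _ _ _) _.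
apply: le_trans (_ : _ <= \sum_(i < n) (2 * S)) _.
  apply: ler_sum => i _; rewrite ncM ncX nc_cis expr1n mulr1 ncM nc_nat nc_real.
  rewrite ler_pM2l //; apply: h.
  by rewrite ncM ncX nc_cis expr1n mulr1 nc_real gtr0_norm.
by rewrite sumr_const card_ord -[_ *+ n]mulr_natl.
Qed.

End PolyBounds.

Section PolyTaylor.
Context {R : realType}.
Implicit Types (q p D : {poly R[i]}) (z w t c : R[i]) (d S B e x r : R).

Lemma poly_bounded q r : exists B, 0 <= B /\ forall z, nc z <= r -> nc q.[z] <= B.
Proof.
exists (\sum_(k < size q) nc q`_k * `|r| ^+ k); split.
  by apply: sumr_ge0 => k _; rewrite mulr_ge0 ?nc_ge0 ?exprn_ge0.
move=> z zr; rewrite horner_coef; apply: le_trans (nc_sum _ _ _) _.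
apply: ler_sum => k _; rewrite ncM ncX ler_wpM2l ?nc_ge0 //.
by rewrite lerXn2r ?nnegrE ?nc_ge0 // (le_trans zr) // ler_norm.
Qed.

Lemma geometric_sum x n : 0 <= x < 1 -> \sum_(k < n) x ^+ k <= (1 - x)^-1.
Proof.
move=> /andP[x0 x1]; have x1' : 0 < 1 - x by rewrite subr_gt0.
rewrite -(ler_pM2l x1') mulfV ?gt_eqF //.
have := subrX1 x n; have := exprn_ge0 n x0; lra.
Qed.

Lemma coef_horner_bound q d S x t : 0 < d -> 0 <= x < 1 ->
  (forall k, nc q`_k * d ^+ k <= S) -> nc t <= x * d -> nc q.[t] <= S / (1 - x).
Proof.
move=> d0 x01 h tx; have /andP[x0 x1] := x01.
have S0 : 0 <= S by apply: le_trans (h 0%N); rewrite expr0 mulr1 nc_ge0.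
rewrite horner_coef; apply: le_trans (nc_sum _ _ _) _.
apply: le_trans (_ : _ <= \sum_(k < size q) S * x ^+ k) _; last first.
  by rewrite -mulr_sumr ler_wpM2l // geometric_sum.
apply: ler_sum => k _; rewrite ncM ncX.
apply: le_trans (_ : _ <= nc q`_k * (x * d) ^+ k) _.
  by rewrite ler_wpM2l ?nc_ge0 // lerXn2r ?nnegrE ?nc_ge0 ?mulr_ge0 // ltW.
by rewrite exprMn mulrCA mulrC ler_wpM2r ?exprn_ge0.
Qed.

Lemma comp_shift q c t : (q \Po ('X + c%:P)).[t] = q.[t + c].
Proof. by rewrite horner_comp !hornerE. Qed.

Lemma coef0_shift q c : (q \Po ('X + c%:P))`_0 = q.[c].
Proof. by rewrite -horner_coef0 comp_shift add0r. Qed.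

Lemma coef1_shift q c : (q \Po ('X + c%:P))`_1 = q^`().[c].
Proof.
have := coef_deriv (q \Po ('X + c%:P)) 0; rewrite mulr1n => <-.
rewrite deriv_comp -horner_coef0 !hornerE derivD derivX derivC addr0 hornerE mulr1.
by rewrite comp_shift add0r.
Qed.

(** Beyond the first m terms a factor t^m splits off, and the cofactor is summed as a geometric
    series of ratio 1/2; hence the 2. *)
Lemma tail_bound q d S t (m : nat) : 0 < d ->
  (forall k, (m <= k)%N -> nc q`_k * d ^+ k <= S) -> nc t <= d / 2 ->
  nc (q.[t] - \sum_(k < m) q`_k * t ^+ k) <= 2 * S * (nc t / d) ^+ m.
Proof.
move=> d0 h td.
have -> : q.[t] - \sum_(k < m) q`_k * t ^+ k = (drop_poly m q).[t] * t ^+ m.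
  rewrite -{1}(poly_take_drop m q) hornerD hornerM hornerXn horner_poly.
  by rewrite addrAC subrr add0r.
rewrite ncM ncX expr_div_n mulrA (mulrAC _ (nc t ^+ m)).
rewrite ler_wpM2r ?exprn_ge0 ?nc_ge0 //.
have -> : 2 * S / d ^+ m = (S / d ^+ m) / (1 - 2^-1) by field; rewrite expf_neq0 // gt_eqF.
apply: (@coef_horner_bound _ d) => //; [lra| |by rewrite mulrC].
move=> k; rewrite coef_drop_poly ler_pdivlMr ?exprn_gt0 // -mulrA -exprD.
by apply: h; rewrite leq_addl.
Qed.

Lemma poly_cont_bound q r S c t : nc c < r ->
  (forall z, nc z <= r -> nc q.[z] <= S) -> nc t <= (r - nc c) / 2 ->
  nc (q.[c + t] - q.[c]) <= 2 * S * (nc t / (r - nc c)).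
Proof.
move=> cr h td; set d := r - nc c in td *.
have d0 : 0 < d by rewrite subr_gt0.
have := @tail_bound (q \Po ('X + c%:P)) d S t 1 d0 _ td.
rewrite comp_shift big_ord1 coef0_shift expr0 mulr1 expr1 [t + c]addrC; apply=> k _.
apply: coef_bound => // w wd; rewrite comp_shift; apply: h.
by apply: le_trans (ncD _ _) _; rewrite wd /d subrK.
Qed.

(** At distance at least d/2 from c, with d = r - |c|, one divides directly. Closer to c, the Taylor
    coefficients of D at c are those of q shifted by one, and the Cauchy inequality applies. The
    constant is independent of the degree, so division by X - c survives uniform limits. *)
Lemma poly_div_bound q D r S c : nc c < r ->
  (forall z, nc z <= r -> nc q.[z] <= S) -> q = (q.[c])%:P + ('X - c%:P) * D ->
  forall z, nc z <= r -> nc D.[z] <= 4 * S / (r - nc c).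
Proof.
move=> cr h qE z zr; set d := r - nc c.
have d0 : 0 < d by rewrite subr_gt0.
have S0 : 0 <= S by apply: le_trans (h c (ltW cr)); exact: nc_ge0.
have [le|gt] := leP (d / 2) (nc (z - c)).
  have zc : 0 < nc (z - c) by apply: lt_le_trans le; rewrite divr_gt0.
  have E : q.[z] - q.[c] = (z - c) * D.[z].
    by rewrite {1}qE !hornerE /= addrC addKr.
  have : nc (z - c) * nc D.[z] <= 2 * S.
    rewrite -ncM -E; apply: le_trans (ncB _ _) _.
    by rewrite mulr_natl mulr2n lerD ?h // ltW.
  move=> le2; rewrite ler_pdivlMr //.
  have := nc_ge0 D.[z]; nra.
set Dc := D \Po ('X + c%:P).
have E k : Dc`_k = (q \Po ('X + c%:P))`_k.+1.
  rewrite {1}qE comp_polyD comp_polyC comp_polyM comp_polyB comp_polyX comp_polyC.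
  by rewrite addrK coefD coefC /= add0r coefXM.
have -> : D.[z] = Dc.[z - c] by rewrite comp_shift subrK.
have b : forall k, nc Dc`_k * d ^+ k <= S / d.
  move=> k; rewrite E ler_pdivlMr // -mulrA -exprSr.
  apply: coef_bound => // w wd; rewrite comp_shift; apply: h.
  by apply: le_trans (ncD _ _) _; rewrite wd /d subrK.
apply: le_trans (coef_horner_bound d0 (_ : 0 <= 2^-1 < 1) b _) _; first lra.
  by rewrite mulrC ltW.
have -> : S / d / (1 - 2^-1) = 2 * S / d by field; rewrite gt_eqF.
by rewrite ler_pM2r ?invr_gt0 // ler_wpM2r // ler_nat.
Qed.

Lemma geometric_cvg (x : nat -> R) (C : R) :
  (forall n, `|x n.+1 - x n| <= C / 2 ^+ n) ->
  exists l, forall n, `|x n - l| <= 2 * C / 2 ^+ n.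
Proof.
(* The intervals from [a n] to [b n] are nested, because the variation left after n is at most 2 C /
   2^n. The limit is the supremum of the lower ends. *)
move=> h; set a := fun n => x n - 2 * C / 2 ^+ n; set b := fun n => x n + 2 * C / 2 ^+ n.
have p2 n : 0 < 2 ^+ n :> R by rewrite exprn_gt0.
have half n : 2 * C / 2 ^+ n.+1 = C / 2 ^+ n.
  by rewrite exprS; field; rewrite expf_neq0.
have C0 n : 0 <= C / 2 ^+ n by apply: le_trans (h n).
have aS n : a n <= a n.+1.
  by rewrite /a half; have := h n; rewrite ler_norml => /andP[]; have := C0 n; lra.
have bS n : b n.+1 <= b n.
  by rewrite /b half; have := h n; rewrite ler_norml => /andP[]; have := C0 n; lra.
have ha m n : (m <= n)%N -> a m <= a n.
  by move=> /subnK <-; elim: (n - m)%N => // k IH; rewrite addSn (le_trans IH).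
have hb m n : (m <= n)%N -> b n <= b m.
  by move=> /subnK <-; elim: (n - m)%N => // k IH; rewrite addSn (le_trans _ IH).
have ab m n : a m <= b n.
  apply: (le_trans (ha _ _ (leq_maxl m n))); apply: le_trans (hb _ _ (leq_maxr m n)).
  by have := C0 (maxn m n); rewrite /a /b; lra.
exists (sup (range a)) => n.
have hs : has_sup (range a).
  by split; [exists (a 0%N), 0%N|exists (b 0%N) => _ [m _ <-]; exact: ab].
rewrite distrC ler_distl -/(a n) -/(b n); apply/andP; split.
  by apply: sup_upper_bound => //; exists n.
by apply: ge_sup; [case: hs|move=> _ [m _ <-]; exact: ab].
Qed.

Lemma geometric_cvgC (s : nat -> R[i]) (C : R) :
  (forall n, nc (s n.+1 - s n) <= C / 2 ^+ n) ->
  exists l, forall n, nc (s n - l) <= 4 * C / 2 ^+ n.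
Proof.
move=> h.
have [n|a ha] := @geometric_cvg (fun n => Re (s n)) C.
  by apply: le_trans (h n); rewrite -ReN -ReD nc_Re.
have [n|b hb] := @geometric_cvg (fun n => Im (s n)) C.
  by apply: le_trans (h n); rewrite -ImN -ImD nc_Im.
exists (a +i* b)%C => n; apply: le_trans (nc_le_ReIm _) _.
rewrite ReD ImD ReN ImN /=; have := ha n; have := hb n; lra.
Qed.

Lemma exp2_small (C e : R) : 0 < e -> exists n, C / 2 ^+ n <= e.
Proof.
move=> e0; exists (Num.bound (C / e)).
have p2 n : 0 < 2 ^+ n :> R by rewrite exprn_gt0.
rewrite ler_pdivrMr // mulrC -ler_pdivrMr //.
have [le|gt] := leP 0 (C / e); last by apply: le_trans (ltW gt) (ltW (p2 _)).
apply: le_trans (ltW (archi_boundP le)) _.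
by rewrite -natrX ler_nat ltnW // ltn_expl.
Qed.

Lemma pow_small x (C e : R) : 0 <= x < 1 -> 0 < e -> exists n, C * x ^+ n <= e.
Proof.
move=> /andP[x0 x1] e0.
have := @cvg_expr R x; rewrite ger0_norm // => /(_ x1) cx.
have [|gt] := leP C 0; first by exists 0%N; rewrite expr0 mulr1; lra.
have : \forall n \near \oo, `|x ^+ n| < e / C.
  by apply: (cvgr0_norm_lt _ cx); rewrite divr_gt0.
move=> [n _ /(_ n (leqnn n))] /= hn; exists n.
rewrite ger0_norm ?exprn_ge0 // in hn.
by rewrite mulrC -ler_pdivlMr // ltW.
Qed.

End PolyTaylor.

(** * The disc algebra and harmonic functions *)

Section DiscAlgebra.
Context {R : realType}.
Implicit Types (q p : {poly R[i]}) (z w t c : R[i]) (d S B e x r : R) (f g h : R[i] -> R[i]).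

Definition holo r f := forall e, 0 < e -> exists q, forall z, nc z <= r ->
  nc (f z - q.[z]) <= e.

Lemma holo_ext r f g : (forall z, nc z <= r -> f z = g z) -> holo r f -> holo r g.
Proof.
move=> fg hf e e0; have [q hq] := hf e e0; exists q => z zr.
by rewrite -fg ?hq.
Qed.

Lemma holo_sub r r' f : r' <= r -> holo r f -> holo r' f.
Proof.
move=> rr hf e e0; have [q hq] := hf e e0; exists q => z zr.
by apply: hq; exact: le_trans zr rr.
Qed.

Lemma holo_lim r f :
  (forall e, 0 < e -> exists2 g, holo r g & forall z, nc z <= r -> nc (f z - g z) <= e) ->
  holo r f.
Proof.
move=> hf e e0; have e2 : 0 < e / 2 by rewrite divr_gt0.
have [g hg fg] := hf _ e2; have [q hq] := hg _ e2; exists q => z zr.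
apply: le_trans (nc_triangle _ _ (g z)) _.
by rewrite (splitr e) lerD ?fg ?hq.
Qed.

Lemma holo_poly r q : holo r (fun z => q.[z]).
Proof. by move=> e e0; exists q => z _; rewrite subrr nc0 ltW. Qed.

Lemma holo_cst r c : holo r (fun=> c).
Proof. by apply: holo_ext (holo_poly r c%:P) => z _; rewrite hornerC. Qed.

Lemma holo_id r : holo r id.
Proof. by apply: holo_ext (holo_poly r 'X) => z _; rewrite hornerX. Qed.

Lemma holo_bounded r f : holo r f -> exists B, 0 < B /\ forall z, nc z <= r -> nc (f z) <= B.
Proof.
move=> /(_ 1 ltr01)[q hq]; have [B [B0 hB]] := poly_bounded q r.
exists (B + 1); split=> [|z zr]; first by rewrite ltr_wpDl.
by apply: le_trans (nc_dist_le _ q.[z]) _; rewrite lerD ?hB ?hq.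
Qed.

Lemma holo_add r f g : holo r f -> holo r g -> holo r (fun z => f z + g z).
Proof.
move=> hf hg e e0; have e2 : 0 < e / 2 by rewrite divr_gt0.
have [p hp] := hf _ e2; have [q hq] := hg _ e2; exists (p + q) => z zr.
rewrite hornerD opprD addrACA; apply: le_trans (ncD _ _) _.
by rewrite (splitr e) lerD ?hp ?hq.
Qed.

Lemma holo_mul r f g : holo r f -> holo r g -> holo r (fun z => f z * g z).
Proof.
move=> hf hg; have [A [A0 hA]] := holo_bounded hf; have [B [B0 hB]] := holo_bounded hg.
apply: holo_lim => e e0.
have e1 : 0 < e / (2 * (B + 1)) by rewrite divr_gt0 ?mulr_gt0 // addr_gt0.
have [p hp] := hf _ e1; have [C [C0 hC]] := poly_bounded p r.
have e2 : 0 < e / (2 * (C + 1)) by rewrite divr_gt0 ?mulr_gt0 // ltr_wpDl.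
have [q hq] := hg _ e2; exists (fun z => (p * q).[z]); first exact: holo_poly.
move=> z zr; rewrite hornerM.
have -> : f z * g z - p.[z] * q.[z] = (f z - p.[z]) * g z + p.[z] * (g z - q.[z]) by ring.
apply: le_trans (ncD _ _) _; rewrite !ncM.
have B1 : nc (g z) <= B + 1 by apply: le_trans (hB _ zr) _; rewrite lerDl.
have C1 : nc p.[z] <= C + 1 by apply: le_trans (hC _ zr) _; rewrite lerDl.
apply: (@le_trans _ _ (e / (2 * (B + 1)) * (B + 1) + (C + 1) * (e / (2 * (C + 1))))).
  by apply: lerD; apply: ler_pM; rewrite ?nc_ge0 ?hp ?hq.
have b1 : 0 < B + 1 by lra.
have c1 : 0 < C + 1 by lra.
by apply: eqRle; field; rewrite !gt_eqF.
Qed.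

Lemma holo_opp r f : holo r f -> holo r (fun z => - f z).
Proof.
by move=> hf; apply: holo_ext (holo_mul (holo_cst r (-1)) hf) => z _; rewrite mulN1r.
Qed.

Lemma holo_subr r f g : holo r f -> holo r g -> holo r (fun z => f z - g z).
Proof. by move=> hf /holo_opp; exact: holo_add. Qed.

Lemma holo_exp r f n : holo r f -> holo r (fun z => f z ^+ n).
Proof.
move=> hf; elim: n => [|n IH].
  by apply: holo_ext (holo_cst r 1) => z _; rewrite expr0.
by apply: holo_ext (holo_mul hf IH) => z _; rewrite exprS.
Qed.

Lemma holo_sum r (n : nat) (F : nat -> R[i] -> R[i]) : (forall k, holo r (F k)) ->
  holo r (fun z => \sum_(k < n) F k z).
Proof.
move=> hF; elim: n => [|n IH].
  by apply: holo_ext (holo_cst r 0) => z _; rewrite big_ord0.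
by apply: holo_ext (holo_add IH (hF n)) => z _; rewrite big_ord_recr.
Qed.

(** Geometric series: n terms leave the remainder (-f)^n / (1 + f), of modulus at most 2 / 2^n. *)
Lemma holo_inv1 r f : holo r f -> (forall z, nc z <= r -> nc (f z) <= 2^-1) ->
  holo r (fun z => (1 + f z)^-1).
Proof.
move=> hf fb; apply: holo_lim => e e0.
have [n hn] := @exp2_small R 2 e e0.
exists (fun z => \sum_(k < n) (- f z) ^+ k).
  by apply: (@holo_sum _ _ (fun k z => (- f z) ^+ k)) => k; apply: holo_exp; exact: holo_opp.
move=> z zr; apply: le_trans hn.
have f1 : 2^-1 <= nc (1 + f z).
  have := ncB (1 + f z) (f z); rewrite addrK nc1; have := fb _ zr; lra.
have f0 : 0 < nc (1 + f z) by apply: lt_le_trans f1; rewrite invr_gt0.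
have ne : 1 + f z != 0 by rewrite -nc_gt0.
have -> : (1 + f z)^-1 - \sum_(k < n) (- f z) ^+ k = (- f z) ^+ n / (1 + f z).
  apply: (mulIf ne); rewrite mulfVK // mulrBl mulVf //.
  have := subrX1 (- f z) n; set s := \sum_(_ < _) _ => E.
  have -> : (- f z) ^+ n = 1 + (- f z - 1) * s by rewrite -E; ring.
  by ring.
rewrite ncM ncV ncX ncN ler_pdivrMr //.
have : nc (f z) ^+ n <= (2 ^+ n)^-1.
  by rewrite -exprVn lerXn2r ?nnegrE ?nc_ge0 ?invr_ge0 // fb.
have p2 : 0 < (2 ^+ n : R)^-1 by rewrite invr_gt0 exprn_gt0.
nra.
Qed.

Lemma holo_cont r f c : holo r f -> nc c < r -> forall e, 0 < e ->
  exists d, [/\ 0 < d, d <= r - nc c & forall z, nc (z - c) <= d -> nc (f z - f c) <= e].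
Proof.
move=> hf cr e e0; have e3 : 0 < e / 3 by rewrite divr_gt0.
have [q hq] := hf _ e3; have [B [B0 hB]] := poly_bounded q r.
set s := r - nc c; have s0 : 0 < s by rewrite subr_gt0.
have k0 : 0 < 3 * 2 * (B + 1) by rewrite !mulr_gt0 // ltr_wpDl.
exists (Num.min (s / 2) (s * e / (3 * 2 * (B + 1)))); split.
- by rewrite lt_min !divr_gt0 // mulr_gt0.
- by rewrite ge_min ler_pdivrMr // ler_peMr ?ler1n // ltW.
move=> z; rewrite le_min => /andP[z1 z2].
have zr : nc z <= r.
  have := nc_dist_le z c; have : s / 2 <= s by rewrite ler_pdivrMr // ler_peMr ?ler1n // ltW.
  by rewrite /s in s0 z1 *; lra.
have hB1 w : nc w <= r -> nc q.[w] <= B + 1.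
  by move=> wr; apply: le_trans (hB _ wr) _; rewrite lerDl.
have := poly_cont_bound cr hB1 z1; rewrite [c + _]addrC subrK -/s => b.
have b' : 2 * (B + 1) * (nc (z - c) / s) <= e / 3.
  rewrite ler_pdivlMr // in z2.
  have -> : 2 * (B + 1) * (nc (z - c) / s) = (2 * (B + 1) * nc (z - c)) / s by ring.
  rewrite ler_pdivrMr //; lra.
apply: le_trans (nc_triangle _ _ q.[z]) _.
have -> : e = e / 3 + (e / 3 + e / 3) by field.
apply: lerD; first exact: hq.
apply: le_trans (nc_triangle _ _ q.[c]) _; apply: lerD; first exact: le_trans b b'.
by rewrite ncC hq // ltW.
Qed.

(** Writing f = f 0 (1 + g) on a disc where |g| <= 1/2 reduces to the geometric series. The bound on
    f z - f 0 is exported because [harm_ln] needs it. *)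
Lemma holo_inv r f : 0 < r -> holo r f -> f 0 != 0 ->
  exists r', [/\ 0 < r', r' <= r, holo r' (fun z => (f z)^-1) &
    forall z, nc z <= r' -> f z != 0 /\ nc (f z - f 0) <= nc (f 0) / 2].
Proof.
move=> r0 hf f0; have f0' : 0 < nc (f 0) by rewrite nc_gt0.
have [||d [d0 dr hd]] := @holo_cont _ _ 0 hf _ (nc (f 0) / 2).
- by rewrite nc0.
- by rewrite divr_gt0.
have hdz z : nc z <= d -> nc (f z - f 0) <= nc (f 0) / 2.
  by move=> zd; apply: hd; rewrite subr0.
rewrite nc0 subr0 in dr.
exists d; split=> // [|z zd]; last first.
  split; last exact: hdz.
  apply/negP => /eqP fz; have := hdz _ zd; rewrite fz sub0r ncN; lra.
set g := fun z => (f z - f 0) / f 0.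
have hg : holo d g.
  apply: holo_mul (holo_cst _ _); apply: holo_subr (holo_cst _ _).
  exact: holo_sub hf.
apply: holo_ext (holo_mul (holo_cst d (f 0)^-1) (holo_inv1 hg _)) => z zd.
  rewrite -invfM; congr (_^-1); rewrite /g; field; exact: f0.
rewrite /g ncM ncV ler_pdivrMr //; have := hdz _ zd; lra.
Qed.

Lemma holo_cauchy r (q : nat -> {poly R[i]}) C :
  (forall n z, nc z <= r -> nc ((q n.+1).[z] - (q n).[z]) <= C / 2 ^+ n) ->
  exists f, holo r f /\ forall n z, nc z <= r -> nc ((q n).[z] - f z) <= 4 * C / 2 ^+ n.
Proof.
move=> h.
have /choice[f hf] : forall z, exists l, nc z <= r -> forall n, nc ((q n).[z] - l) <= 4 * C / 2 ^+ n.
  move=> z; have [zr|_] := boolP (nc z <= r); last by exists 0.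
  by have [|l hl] := @geometric_cvgC R (fun n => (q n).[z]) C; [move=> n; exact: h|exists l].
exists f; split=> [e e0|n z zr]; last exact: hf.
have [n hn] := @exp2_small R (4 * C) e e0; exists (q n) => z zr.
by rewrite ncC; apply: le_trans (hf _ zr n) hn.
Qed.

Lemma holo_seq r f : holo r f -> exists q : nat -> {poly R[i]},
  forall n z, nc z <= r -> nc (f z - (q n).[z]) <= (2 ^+ n)^-1.
Proof.
move=> hf; have [n|q hq] := @choice _ _ (fun n q => forall z, nc z <= r -> nc (f z - q.[z]) <= (2 ^+ n)^-1).
  by apply: hf; rewrite invr_gt0 exprn_gt0.
by exists q.
Qed.

(** The polynomial approximants are divided one at a time. Division by X - c is linear and bounded
    by [poly_div_bound], so the quotients form a uniform Cauchy sequence. *)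
Lemma holo_div r f c : holo r f -> nc c < r ->
  exists2 h, holo r h & forall z, nc z <= r -> f z = f c + (z - c) * h z.
Proof.
move=> hf cr; have [q hq] := holo_seq hf.
have p2 n : 0 < 2 ^+ n :> R by rewrite exprn_gt0.
have cr' := ltW cr; have s0 : 0 < r - nc c by rewrite subr_gt0.
have /choice[D hD] n : exists D, q n = ((q n).[c])%:P + ('X - c%:P) * D.
  have /factor_theorem[D hD] : root (q n - ((q n).[c])%:P) c by rewrite /root !hornerE subrr.
  by exists D; rewrite mulrC -hD addrC subrK.
have bd n z : nc z <= r -> nc ((q n.+1).[z] - (q n).[z]) <= 2 / 2 ^+ n.
  move=> zr; apply: le_trans (nc_triangle _ _ (f z)) _.
  have := hq n _ zr; have := hq n.+1 _ zr; rewrite ncC => a b.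
  have : (2 ^+ n.+1 : R)^-1 <= (2 ^+ n)^-1 by rewrite lef_pV2 ?posrE ?p2 // ler_eXn2l ?ltr1n.
  lra.
have [|h [hh lim]] := @holo_cauchy r D (4 * 2 / (r - nc c)).
  move=> n z zr; rewrite -hornerN -hornerD.
  rewrite (_ : 4 * 2 / _ / _ = 4 * (2 / 2 ^+ n) / (r - nc c)); last first.
    by field; rewrite !gt_eqF.
  apply: (@poly_div_bound _ (q n.+1 - q n)) => //.
    by move=> w wr; rewrite hornerD hornerN; exact: bd.
  rewrite {1}(hD n.+1) {1}(hD n) mulrBr hornerD hornerN polyCB; ring.
exists h => // z zr; apply/eqP; rewrite -subr_eq0 -nc_eq0.
have zc : 0 <= nc (z - c) by exact: nc_ge0.
rewrite eq_le nc_ge0 andbT; apply/ler_addgt0Pl => e e0.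
have [n hn] := @exp2_small R (2 + nc (z - c) * (4 * (4 * 2 / (r - nc c)))) e e0.
rewrite addr0; apply: le_trans hn.
have -> : f z - (f c + (z - c) * h z) =
    (f z - (q n).[z]) + (((q n).[c] - f c) + (z - c) * ((D n).[z] - h z)).
  have -> : (q n).[z] = (q n).[c] + (z - c) * (D n).[z] by rewrite {1}(hD n) !hornerE.
  by ring.
have -> (n' K P : R) : (2 + n' * K) / P = P^-1 + (P^-1 + n' * (K / P)) by ring.
apply: le_trans (ncD _ _) _.
apply: lerD; first exact: hq.
apply: le_trans (ncD _ _) _; apply: lerD; first by rewrite ncC hq.
by rewrite ncM ler_wpM2l // lim.
Qed.

(** Weak maximum principle: coefficient bounds from the circle, then a geometric series. The factor
    1 / (1 - x) is absorbed in each use, by x^m or by 3^-n. *)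
Lemma holo_schwarz r h S x z : 0 < r -> holo r h -> 0 <= x < 1 ->
  (forall w, nc w = r -> nc (h w) <= S) -> nc z <= x * r -> nc (h z) <= S / (1 - x).
Proof.
move=> r0 hh x01 hS zr; have /andP[x0 x1] := x01.
have zr' : nc z <= r by apply: le_trans zr _; rewrite ler_piMl // ltW.
have x1' : 0 < 1 - x by rewrite subr_gt0.
apply/ler_addgt0Pl => e e0.
pose k := 1 + (1 - x)^-1; have k0 : 0 < k by rewrite addr_gt0 // invr_gt0.
have [|q hq] := hh (e / k); first by rewrite divr_gt0.
have b j : nc q`_j * r ^+ j <= S + e / k.
  apply: coef_bound => // w wr; apply: le_trans (nc_dist_le _ (h w)) _.
  by apply: lerD; [exact: hS|rewrite ncC hq // wr].
have := coef_horner_bound r0 x01 b zr.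
have := nc_dist_le (h z) q.[z]; have := hq _ zr' => a1 a2 a3.
have -> : e + S / (1 - x) = (S + e / k) / (1 - x) + e / k.
  by rewrite /k; field; rewrite !gt_eqF // addr_gt0 // ltr_pwDr.
by apply: le_trans a2 _; apply: lerD.
Qed.

(** Each step divides by z - c, after f c = 0 has been obtained from the values at points c + s
    close to c. The bound is asked only off c, so the lemma serves to remove singularities. *)
Lemma holo_vanish r f c (m : nat) B eta : holo r f -> nc c < r -> 0 < eta ->
  (forall z, nc z <= r -> 0 < nc (z - c) <= eta -> nc (f z) <= B * nc (z - c) ^+ m) ->
  exists2 h, holo r h & forall z, nc z <= r -> f z = (z - c) ^+ m * h z.
Proof.
move=> + cr eta0; elim: m f => [|m IH] f hf fb.
  by exists f => // z _; rewrite expr0 mul1r.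
have [h hh hE] := holo_div hf cr.
have B0 : 0 <= `|B| by [].
have f0 : f c = 0.
  apply/eqP; rewrite -nc_eq0 eq_le nc_ge0 andbT; apply/ler_addgt0Pl => e e0.
  have e2 : 0 < e / 2 by rewrite divr_gt0.
  have [d [d0 dr hd]] := holo_cont hf cr e2.
  have k0 : 0 < 2 * (`|B| + 1) by rewrite mulr_gt0 // ltr_wpDl.
  (* Small enough for continuity at c, for the hypothesis on f, for s^m <= 1, and for (|B| + 1) s <=
     e / 2. *)
  pose s := Num.min d (Num.min eta (Num.min 1 (e / (2 * (`|B| + 1))))).
  have s0 : 0 < s by rewrite !lt_min d0 eta0 ltr01 divr_gt0.
  have [s1 s2 s3 s4] : [/\ s <= d, s <= eta, s <= 1 & s <= e / (2 * (`|B| + 1))].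
    have := lexx s; rewrite {2}/s !le_min => /and4P[]; by [].
  have ncs : nc (c + s%:C%C - c) = s by rewrite addrC addKr nc_real gtr0_norm.
  have cs : nc (c + s%:C%C) <= r.
    by apply: le_trans (ncD _ _) _; rewrite nc_real gtr0_norm //; lra.
  have := fb _ cs; rewrite ncs s0 s2 => /(_ isT) b1.
  have := hd (c + s%:C%C); rewrite ncs => /(_ s1) b2.
  have b3 : B * s ^+ m.+1 <= e / 2.
    apply: le_trans (_ : _ <= (`|B| + 1) * s) _; last first.
      by move: s4; rewrite !ler_pdivlMr // => s4; lra.
    have s5 : 0 <= s ^+ m by rewrite exprn_ge0 // ltW.
    have s6 : s ^+ m <= 1 by rewrite exprn_ile1 // ltW.
    rewrite exprS; apply: le_trans (_ : _ <= `|B| * (s * s ^+ m)) _.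
      by rewrite ler_wpM2r ?ler_norm // mulr_ge0 // ltW.
    apply: le_trans (_ : _ <= `|B| * s) _; last by rewrite ler_wpM2r ?lerDl // ltW.
    by rewrite ler_wpM2l // ler_piMr // ltW.
  have := nc_dist_le (f c) (f (c + s%:C%C)); rewrite ncC addr0; lra.
have [|g hg gE] := IH h hh.
  move=> z zr /andP[z0 ze]; have := fb z zr; rewrite z0 ze => /(_ isT).
  by rewrite hE // f0 add0r ncM exprS mulrCA ler_pM2l.
by exists g => // z zr; rewrite hE // f0 add0r gE // exprS mulrA.
Qed.

Lemma holo_taylor r f c (m : nat) : holo r f -> nc c < r ->
  exists T h, holo r h /\ forall z, nc z <= r -> f z = T.[z] + (z - c) ^+ m * h z.
Proof.
move=> + cr; elim: m f => [|m IH] f hf.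
  by exists 0, f; split=> // z _; rewrite horner0 add0r expr0 mul1r.
have [g hg gE] := holo_div hf cr; have [T [h [hh hE]]] := IH g hg.
exists ((f c)%:P + ('X - c%:P) * T), h; split=> // z zr.
by rewrite gE // hE // !hornerE exprS; ring.
Qed.

(** Flatness of order m gives f = z^m h, and the bound S / r^m for h on the circle yields |f z| <= S
    x^m / (1 - x) with x = |z| / r < 1. Then m tends to infinity. *)
Lemma holo_identity r f : holo r f ->
  (forall m : nat, exists B, forall z, nc z <= r -> nc (f z) <= B * nc z ^+ m) ->
  forall z, nc z < r -> f z = 0.
Proof.
move=> hf fb z zr; have r0 : 0 < r by apply: le_lt_trans zr; exact: nc_ge0.
have [S [S0 hS]] := holo_bounded hf.
have [x xE] : exists x, x = nc z / r by exists (nc z / r).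
have x01 : 0 <= x < 1.
  by rewrite xE divr_ge0 ?nc_ge0 ?(ltW r0) //= ltr_pdivrMr // mul1r.
have /andP[x0 x1] := x01; have x1' : 0 < 1 - x by rewrite subr_gt0.
apply/eqP; rewrite -nc_eq0 eq_le nc_ge0 andbT; apply/ler_addgt0Pl => e e0.
have [m hm] := @pow_small R x (S / (1 - x)) e x01 e0.
rewrite addr0; apply: le_trans hm.
have [B hB] := fb m.
have [|||h hh hE] := @holo_vanish r f 0 m B 1 hf.
- by rewrite nc0.
- by [].
- by move=> w wr _; rewrite subr0; exact: hB.
have zx : nc z = x * r by rewrite xE divfK // gt_eqF.
have b : nc (h z) <= (S / r ^+ m) / (1 - x).
  apply: (holo_schwarz r0 hh x01 _ (eqRle zx)) => w wr.
  rewrite ler_pdivlMr ?exprn_gt0 //; apply: le_trans (hS w _); last by rewrite wr.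
  by rewrite hE ?wr // subr0 ncM ncX wr mulrC.
rewrite hE ?(ltW zr) // subr0 ncM ncX.
apply: le_trans (ler_wpM2l _ b) _; first by rewrite exprn_ge0 ?nc_ge0.
by apply: eqRle; rewrite zx exprMn; field; rewrite !gt_eqF // exprn_gt0.
Qed.

End DiscAlgebra.

(** * Limits of real parts of polynomials are harmonic *)

Section Harmonic.
Context {R : realType}.
Implicit Types (q : nat -> {poly R[i]}) (z w t c : R[i]) (e r s x : R).
Implicit Types (p v : R * R) (H : R * R -> R) (h : R[i] -> R).

Definition toC p : R[i] := (p.1 +i* p.2)%C.

Lemma toCD p v : toC (p + v) = toC p + toC v.
Proof. by []. Qed.

Lemma toCZ (x : R) v : toC (x *: v) = x%:C%C * toC v.
Proof. by rewrite /toC /=; apply/eqP; rewrite eq_complex /= !mul0r subr0 addr0 !eqxx. Qed.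

Lemma toC_ReIm w : toC (Re w, Im w) = w.
Proof. by case: w. Qed.

Lemma toC10 : toC (1, 0) = 1. Proof. by []. Qed.

Lemma nc_toC10 : nc (toC (1, 0)) = 1. Proof. exact: nc1. Qed.

Lemma nc_toC01 : nc (toC (0, 1)) = 1.
Proof. by rewrite /toC /= expr0n expr1n add0r sqrtr1. Qed.

Lemma near_plane p (P : set (R * R)) e : 0 < e ->
  (forall p', nc (toC p' - toC p) < e -> P p') -> \forall p' \near p, P p'.
Proof.
move=> e0 hP; apply/nbhs_ballP; exists (e / 2) => /=; first by rewrite divr_gt0.
move=> p' [/= b1 b2]; apply: hP.
apply: le_lt_trans (nc_le_ReIm _) _.
rewrite (splitr e) /=; apply: ltrD; rewrite distrC; [exact: b1|exact: b2].
Qed.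

Lemma near_disc (D : set (R * R)) p e : 0 < e -> (\forall p' \near p, D p') ->
  exists2 d, 0 < d <= e & forall p', nc (toC p' - toC p) <= d -> D p'.
Proof.
move=> e0 /nbhs_ballP[d /= d0 hd]; exists (Num.min (d / 2) e).
  by rewrite lt_min e0 divr_gt0 //= ge_min lexx orbT.
move=> p'; rewrite le_min => /andP[b _]; apply: hd.
have b1 := nc_Re (toC p' - toC p); have b2 := nc_Im (toC p' - toC p).
have d2 : d / 2 < d by rewrite ltr_pdivrMr // ltr_pMr // ltr1n.
have h1 : `|p.1 - p'.1| < d by rewrite distrC; exact: le_lt_trans (le_trans b1 b) d2.
have h2 : `|p.2 - p'.2| < d by rewrite distrC; exact: le_lt_trans (le_trans b2 b) d2.
by split.
Qed.

(** The sequence [q] is common to all points; only the radius and the constant depend on [p]. In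
    this form a directional derivative of [H] is again of the same kind, for the derived
    polynomials, so that second derivatives need no new argument. *)
Definition locharm p H q := exists r C, [/\ 0 < r, 0 <= C &
  forall n p', nc (toC p' - toC p) <= r -> `|H p' - Re (q n).[toC p']| <= C / 2 ^+ n].

Lemma locharm_shift p p' H q r C : 0 < r -> 0 <= C ->
  (forall n p', nc (toC p' - toC p) <= r -> `|H p' - Re (q n).[toC p']| <= C / 2 ^+ n) ->
  nc (toC p' - toC p) <= r / 2 -> forall n p'', nc (toC p'' - toC p') <= r / 2 ->
  `|H p'' - Re (q n).[toC p'']| <= C / 2 ^+ n.
Proof.
move=> r0 C0 hH pp n p'' pp'; apply: hH.
by apply: le_trans (nc_triangle _ _ (toC p')) _; rewrite (splitr r) lerD.
Qed.

Lemma exp2_gt0 n : 0 < 2 ^+ n :> R. Proof. by rewrite exprn_gt0. Qed.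

(** Convergence of the real parts at rate 2^-n on a disc forces the Taylor coefficients, hence the
    derivatives at the centre, to converge at the same rate. A second order Taylor bound uniform in
    n then identifies their limit with the derivative of [H]. *)
Lemma locharm_deriv p H q v r C : 0 < r -> 0 <= C -> nc (toC v) = 1 ->
  (forall n p', nc (toC p' - toC p) <= r -> `|H p' - Re (q n).[toC p']| <= C / 2 ^+ n) ->
  derivable H p v /\
  forall n, `|'D_v H p - Re (toC v * (q n)^`().[toC p])| <= (8 * C / r) / 2 ^+ n.
Proof.
move=> r0 C0 v1 hH; set z0 := toC p; set c := toC v.
have hz n w : nc (w - z0) <= r ->
    `|Re ((q n.+1).[w] - (q n).[w])| <= 2 * C / 2 ^+ n.
  move=> wr; pose p' : R * R := (Re w, Im w).
  have pw : toC p' = w by exact: toC_ReIm.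
  have := hH n p'; have := hH n.+1 p'; rewrite pw => /(_ wr) a /(_ wr) b.
  rewrite ReD ReN; have : C / 2 ^+ n.+1 <= C / 2 ^+ n.
    by rewrite ler_wpM2l // lef_pV2 ?posrE ?exp2_gt0 // ler_eXn2l ?ltr1n.
  move: a b; rewrite !ler_norml => /andP[a1 a2] /andP[b1 b2] cc.
  by apply/andP; split; lra.
have hd n : `|Re (c * (q n.+1)^`().[z0]) - Re (c * (q n)^`().[z0])| <= (4 * C / r) / 2 ^+ n.
  rewrite -ReN -ReD -mulrBr -hornerN -hornerD -derivB.
  apply: le_trans (nc_Re _) _; rewrite ncM v1 mul1r.
  rewrite -coef1_shift (_ : _ / _ / _ = 2 * (2 * C / 2 ^+ n) / r); last first.
    by field; rewrite !gt_eqF // exp2_gt0.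
  rewrite ler_pdivlMr // -[X in _ * X]expr1; apply: coef_bound_Re => // w wr.
  by rewrite comp_shift hornerD hornerN; apply: hz; rewrite addrK wr.
have [d hdd] := geometric_cvg hd.
have dE n : `|d - Re (c * (q n)^`().[z0])| <= (8 * C / r) / 2 ^+ n.
  by rewrite distrC; apply: le_trans (hdd n) _; apply: eqRle; field; rewrite !gt_eqF // exp2_gt0.
have [B [B0 hB]] := poly_bounded (q 0%N) (nc z0 + r).
pose S := B + 2 * C.
have qS n w : nc (w - z0) <= r -> `|Re (q n).[w]| <= S.
  move=> wr; pose p' : R * R := (Re w, Im w).
  have pw : toC p' = w by exact: toC_ReIm.
  have := hH n p'; have := hH 0%N p'; rewrite pw => /(_ wr) a /(_ wr) b.
  have c1 : C / 2 ^+ n <= C.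
    by rewrite ler_pdivrMr ?exp2_gt0 // ler_peMr // -natrX ler1n expn_gt0.
  have : nc (q 0%N).[w] <= B.
    by apply: hB; have := nc_dist_le w z0; lra.
  move=> /(le_trans (nc_Re _)); rewrite expr0 divr1 in a.
  move: a b; rewrite /S !ler_norml => /andP[a1 a2] /andP[b1 b2] /andP[b3 b4].
  by apply/andP; split; lra.
have S0 : 0 <= S by rewrite /S; lra.
pose K := 4 * S / r ^+ 2.
(* For fixed x the approximation errors tend to 0 with n, whereas the quadratic remainder of [q n]
   has the constant [K], independent of n. *)
have main x : `|x| <= r / 2 -> `|H (x *: v + p) - H p - x * d| <= K * x ^+ 2.
  move=> xr; apply/ler_addgt0Pl => e e0.
  have [n hn] := @exp2_small R (2 * C + `|x| * (8 * C / r)) e e0.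
  have xc : nc (x%:C%C * c) = `|x| by rewrite ncM v1 mulr1 nc_real.
  have T := @tail_bound R ((q n) \Po ('X + z0%:P)) r (2 * S) (x%:C%C * c) 2 r0.
  have {T} : nc ((q n).[x%:C%C * c + z0] - ((q n).[z0] + (q n)^`().[z0] * (x%:C%C * c))) <= K * x ^+ 2.
    move: T; rewrite comp_shift xc !big_ord_recr big_ord0 /= add0r expr0 expr1 mulr1.
    rewrite coef0_shift coef1_shift.
    have -> : 2 * (2 * S) * (`|x| / r) ^+ 2 = K * x ^+ 2.
      by rewrite exprMn real_normK ?num_real // /K exprVn; field; rewrite gt_eqF.
    apply=> // k k2; apply: coef_bound_Re => // [|w wr]; first by lia.
    by rewrite comp_shift qS // addrK wr.
  move=> /(le_trans (nc_Re _)); rewrite ReD ReN ReD => a1.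
  have pz : toC p = z0 by [].
  have a2 := hH n p; rewrite subrr nc0 -/z0 in a2; have {}a2 := a2 (ltW r0).
  have a3 := hH n (x *: v + p); rewrite toCD toCZ addrK xc in a3.
  have {}a3 : `|H (x *: v + p) - Re (q n).[x%:C%C * c + z0]| <= C / 2 ^+ n.
    by apply: a3; lra.
  have a4 := dE n.
  have a5 : Re ((q n)^`().[z0] * (x%:C%C * c)) = x * Re (c * (q n)^`().[z0]).
    by rewrite mulrCA ReCM [c * _]mulrC.
  rewrite a5 in a1.
  have a6 : `|x * (d - Re (c * (q n)^`().[z0]))| <= `|x| * ((8 * C / r) / 2 ^+ n).
    by rewrite normrM ler_wpM2l.
  rewrite mulrDl -mulrA in hn.
  have -> : H (x *: v + p) - H p - x * d =
    (H (x *: v + p) - Re (q n).[x%:C%C * c + z0]) - (H p - Re (q n).[z0]) +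
    (Re (q n).[x%:C%C * c + z0] - (Re (q n).[z0] + x * Re (c * (q n)^`().[z0])))
    - x * (d - Re (c * (q n)^`().[z0])) by ring.
  move: a1 a2 a3 a6; rewrite !ler_norml => /andP[? ?] /andP[? ?] /andP[? ?] /andP[? ?].
  by apply/andP; split; lra.
have K0 : 0 <= K by apply: divr_ge0; [exact: mulr_ge0|apply: exprn_ge0; exact: ltW].
have cv : (fun x : R => x^-1 *: ((H \o shift p) (x *: v) - H p)) @ 0^' --> d.
  apply/cvgrPdist_le => e e0.
  pose eta := Num.min (r / 2) (e / (K + 1)).
  have eta0 : 0 < eta by rewrite lt_min !divr_gt0 // ltr_wpDl.
  near=> x.
  have x0 : x != 0 by near: x; exact: nbhs_dnbhs_neq.
  have : `|x| <= eta by near: x; exact: dnbhs0_le.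
  rewrite le_min => /andP[x1 x2].
  rewrite /shift /= distrC.
  have -> : x^-1 *: (H (x *: v + p) - H p) - d = x^-1 * (H (x *: v + p) - H p - x * d).
    by rewrite /GRing.scale /=; field.
  rewrite normrM normfV mulrC ler_pdivrMr ?normr_gt0 //.
  apply: le_trans (main _ x1) _; rewrite -(real_normK (num_real x)) expr2 mulrA.
  rewrite ler_wpM2r //; rewrite ler_pdivlMr ?ltr_wpDl // in x2.
  have := normr_ge0 x; lra.
have dv : 'D_v H p = d by apply: cvg_lim.
split; first by apply/cvg_ex; exists d.
by rewrite dv.
Unshelve. all: by end_near.
Qed.

Lemma locharm_cont p H q : locharm p H q -> {for p, continuous H}.
Proof.
move=> [r [C [r0 C0 hH]]]; apply/cvgrPdist_le => e e0.
have e2 : 0 < e / 2 by rewrite divr_gt0.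
have [n hn] := @exp2_small R (2 * C) (e / 2) e2.
have hq := @holo_poly R (nc (toC p) + 1) (q n).
have [||d [d0 _ hd]] := @holo_cont _ _ _ (toC p) hq _ (e / 2).
- by rewrite ltrDl.
- by rewrite divr_gt0.
apply: (@near_plane p _ (Num.min r d)); first by rewrite lt_min r0.
move=> p'; rewrite lt_min => /andP[p1 p2].
have := hH n p' (ltW p1); have := hH n p; rewrite subrr nc0 => /(_ (ltW r0)).
have := hd _ (ltW p2) => /(le_trans (nc_Re _)); rewrite ReD ReN.
rewrite !ler_norml => /andP[? ?] /andP[? ?] /andP[? ?].
by apply/andP; split; lra.
Qed.

Lemma locharm_D p H q v : nc (toC v) = 1 -> locharm p H q ->
  derivable H p v /\ locharm p (fun p => 'D_v H p) (fun n => (toC v)%:P * (q n)^`()).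
Proof.
move=> v1 [r [C [r0 C0 hH]]]; split.
  by have [] := locharm_deriv r0 C0 v1 hH.
have r2 : 0 < r / 2 by rewrite divr_gt0.
exists (r / 2), (8 * C / (r / 2)); split=> // [|n p' pp].
  by rewrite divr_ge0 ?mulr_ge0 // ltW.
have [_ h] := locharm_deriv r2 C0 v1 (locharm_shift r0 C0 hH pp).
by apply: le_trans (h n); rewrite hornerM hornerC.
Qed.

Lemma locharm_ddx p H q : locharm p H q ->
  derivable H p (1, 0) /\ locharm p (ddx H) (fun n => (toC (1, 0))%:P * (q n)^`()).
Proof. by move=> h; have [d l] := locharm_D nc_toC10 h; split; [exact: d|exact: l]. Qed.

Lemma locharm_ddy p H q : locharm p H q ->
  derivable H p (0, 1) /\ locharm p (ddy H) (fun n => (toC (0, 1))%:P * (q n)^`()).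
Proof. by move=> h; have [d l] := locharm_D nc_toC01 h; split; [exact: d|exact: l]. Qed.

Lemma locharm_C1 (D : set (R * R)) H q : (forall p, D p -> locharm p H q) -> C1_on D H.
Proof.
move=> h p /h hp; have [d1 l1] := locharm_ddx hp; have [d2 l2] := locharm_ddy hp.
exact: And4 d1 d2 (locharm_cont l1) (locharm_cont l2).
Qed.

Lemma locharm_planar (D : set (R * R)) H q : (forall p, D p -> locharm p H q) ->
  planar_harmonic D H.
Proof.
move=> h.
have h1 p (d : D p) := (locharm_ddx (h p d)).2.
have h2 p (d : D p) := (locharm_ddy (h p d)).2.
split; first exact: And3 (locharm_C1 h) (locharm_C1 h1) (locharm_C1 h2).
move=> p Dp.
have [_ [r1 [C1 [r10 C10 H1]]]] := locharm_ddx (h1 p Dp).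
have [_ [r2 [C2 [r20 C20 H2]]]] := locharm_ddy (h2 p Dp).
apply/eqP; rewrite -normr_eq0 eq_le normr_ge0 andbT; apply/ler_addgt0Pl => e e0.
have [n hn] := @exp2_small R (C1 + C2) e e0.
have {H1} := H1 n p; have {H2} := H2 n p; rewrite subrr nc0 => /(_ (ltW r20)) a /(_ (ltW r10)) b.
rewrite addr0; apply: le_trans hn.
(* The second derivatives in x and y are approximated by the real parts of q'' and of i^2 q'' = -
   q''. *)
have E : Re ((toC (1, 0))%:P * ((toC (1, 0))%:P * (q n)^`())^`()).[toC p] =
   - Re ((toC (0, 1))%:P * ((toC (0, 1))%:P * (q n)^`())^`()).[toC p].
  rewrite !derivM !derivC !mul0r !add0r !hornerM !hornerC -ReN; congr Re.
  have i2 : toC (0, 1) * toC (0, 1) = -1 by rewrite -expr2; exact: sqr_i.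
  by rewrite toC10 !mul1r mulrA i2 mulN1r opprK.
rewrite E in b; rewrite mulrDl; move: a b; rewrite !ler_norml => /andP[? ?] /andP[? ?].
by apply/andP; split; lra.
Qed.

Definition harm r h := forall e, 0 < e -> exists q : {poly R[i]}, forall z, nc z <= r ->
  `|h z - Re q.[z]| <= e.

Lemma disc_nc r p : 0 < r -> disc r p -> nc (toC p) < r.
Proof.
move=> r0 h; rewrite -(@ltr_pXn2r _ 2) ?nnegrE ?nc_ge0 ?(ltW r0) //.
by rewrite nc_sqr; exact: h.
Qed.

Lemma nc_disc r p : nc (toC p) < r -> disc r p.
Proof.
move=> pr; have r0 : 0 <= r by apply: le_trans (ltW pr); exact: nc_ge0.
by move: pr; rewrite -(@ltr_pXn2r _ 2) ?nnegrE ?nc_ge0 // nc_sqr.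
Qed.

Lemma harm_planar r h H : 0 < r -> harm r h ->
  (forall p, disc r p -> H p = h (toC p)) -> planar_harmonic (disc r) H.
Proof.
move=> r0 hh hH.
have [n|q hq] := @choice _ _ (fun n pn => forall z, nc z <= r -> `|h z - Re pn.[z]| <= (2 ^+ n)^-1).
  by apply: hh; rewrite invr_gt0 exp2_gt0.
apply: (@locharm_planar _ _ q) => p /(disc_nc r0) pr.
exists ((r - nc (toC p)) / 2), 1; split=> //; first by rewrite divr_gt0 // subr_gt0.
move=> n p' pp; have p'r : nc (toC p') < r.
  by have := nc_dist_le (toC p') (toC p); lra.
by rewrite hH ?div1r ?hq //; [exact: ltW|exact: nc_disc].
Qed.

Lemma harm_ext r h h' : (forall z, nc z <= r -> h z = h' z) -> harm r h -> harm r h'.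
Proof.
move=> hh ha e e0; have [q hq] := ha e e0; exists q => z zr.
by rewrite -hh ?hq.
Qed.

Lemma harm_lim r h :
  (forall e, 0 < e -> exists2 g, harm r g & forall z, nc z <= r -> `|h z - g z| <= e) ->
  harm r h.
Proof.
move=> hf e e0; have e2 : 0 < e / 2 by rewrite divr_gt0.
have [g hg fg] := hf _ e2; have [q hq] := hg _ e2; exists q => z zr.
by apply: le_trans (ler_distD (g z) _ _) _; rewrite (splitr e) lerD ?fg ?hq.
Qed.

Lemma harm_add r h g : harm r h -> harm r g -> harm r (fun z => h z + g z).
Proof.
move=> hf hg e e0; have e2 : 0 < e / 2 by rewrite divr_gt0.
have [p hp] := hf _ e2; have [q hq] := hg _ e2; exists (p + q) => z zr.
rewrite hornerD ReD opprD addrACA; apply: le_trans (ler_normD _ _) _.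
by rewrite (splitr e) lerD ?hp ?hq.
Qed.

Lemma harm_cst r (x : R) : harm r (fun=> x).
Proof. by move=> e e0; exists (x%:C%C)%:P => z _; rewrite hornerC subrr normr0 ltW. Qed.

Lemma harm_scale r (x : R) h : harm r h -> harm r (fun z => x * h z).
Proof.
move=> hf e e0; have e2 : 0 < e / (`|x| + 1) by rewrite divr_gt0 // ltr_wpDl.
have [p hp] := hf _ e2; exists ((x%:C%C)%:P * p) => z zr.
rewrite hornerM hornerC ReCM -mulrBr normrM.
have := hp z zr; rewrite ler_pdivlMr ?ltr_wpDl //.
by have := normr_ge0 x; have := normr_ge0 (h z - Re p.[z]); nra.
Qed.

Lemma harm_sum r (n : nat) (F : nat -> R[i] -> R) : (forall k, harm r (F k)) ->
  harm r (fun z => \sum_(k < n) F k z).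
Proof.
move=> hF; elim: n => [|n IH].
  by apply: harm_ext (harm_cst r 0) => z _; rewrite big_ord0.
by apply: harm_ext (harm_add IH (hF n)) => z _; rewrite big_ord_recr.
Qed.

Lemma harm_holo r f : holo r f -> harm r (fun z => Re (f z)).
Proof.
move=> hf e e0; have [q hq] := hf e e0; exists q => z zr.
by rewrite -ReN -ReD; apply: le_trans (nc_Re _) (hq _ zr).
Qed.

End Harmonic.

(** * Harmonicity of log |f| without a complex logarithm *)

Section LogModulus.
Context {R : realType}.
Implicit Types (z w : R[i]) (e r x : R) (f : R[i] -> R[i]).

(** Partial sum of the series of log (1 + X). *)
Definition logpoly n : {poly R[i]} := \sum_(k < n) ((-1) ^+ k / (k.+1)%:R) *: 'X^(k.+1).

Lemma deriv_logpoly n : (logpoly n)^`() * (1 + 'X) = 1 - (- 'X) ^+ n.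
Proof.
have -> : (logpoly n)^`() = \sum_(k < n) (- 'X) ^+ k.
  rewrite /logpoly raddf_sum /=; apply: eq_bigr => k _.
  rewrite derivZ derivXn /= -[X in _ *: X]scaler_nat scalerA divfK ?pnatr_eq0 //.
  by rewrite [RHS]exprNn -[in LHS]signr_odd -[in RHS]signr_odd scaler_sign mulr_sign.
have := subrX1 (- 'X : {poly R[i]}) n; set s := \sum_(_ < _) _ => E.
have -> : (- 'X) ^+ n = 1 + (- 'X - 1) * s by rewrite -E; ring.
by ring.
Qed.

(** Along the ray t w the real part is a real polynomial in t, with coefficients the real parts of
    the coefficients of P times powers of w. *)
Lemma is_derive_Re_poly (P : {poly R[i]}) w (x : R) :
  is_derive x (1 : R) (fun t : R => Re P.[t%:C%C * w]) (Re (w * P^`().[x%:C%C * w])).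
Proof.
pose Q : {poly R} := \sum_(k < size P) (Re (P`_k * w ^+ k)) *: 'X^k.
have E : (fun t : R => Re P.[t%:C%C * w]) = horner Q.
  apply/funext => t; rewrite horner_coef /Q horner_sum.
  rewrite (big_morph (@complex.Re R) (@ReD R) (erefl : Re (0 : R[i]) = 0)).
  apply: eq_bigr => k _; rewrite hornerZ hornerXn exprMn mulrCA -rmorphXn /= ReCM.
  by rewrite mulrC.
rewrite E; apply: trigger_derive (is_derive_poly Q x) _.
rewrite /Q raddf_sum /= horner_sum.
have -> : w * P^`().[x%:C%C * w] = \sum_(k < size P) ((P`_k * w ^+ k) * (k%:R * x ^+ k.-1)%:C%C).
  rewrite {1}(_ : P = \sum_(k < size P) P`_k *: 'X^k); last by rewrite -poly_def coefK.
  rewrite raddf_sum /= horner_sum mulr_sumr; apply: eq_bigr => k _.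
  rewrite derivZ derivXn hornerZ hornerMn hornerXn rmorphM rmorphXn rmorph_nat /=.
  case: (nat_of_ord k) => [|m]; first by rewrite mulr0n mul0r !mulr0.
  by rewrite -mulr_natl exprMn exprS /=; ring.
rewrite (big_morph (@complex.Re R) (@ReD R) (erefl : Re (0 : R[i]) = 0)).
apply: eq_bigr => k _; rewrite derivZ derivXn hornerZ hornerMn hornerXn -mulr_natl.
by rewrite [P`_k * _ * _]mulrC ReCM mulrC.
Qed.

(** The square |1 + t w|^2 is a real quadratic polynomial [Q] in t, and the logarithm of the modulus
    is half of ln Q. *)
Lemma is_derive_ln_nc w (x : R) : 0 < nc (1 + x%:C%C * w) ->
  is_derive x (1 : R) (fun t : R => ln (nc (1 + t%:C%C * w))) (Re (w / (1 + x%:C%C * w))).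
Proof.
move=> n0.
pose Q : {poly R} := 1%:P + (2 * Re w) *: 'X + (Re w ^+ 2 + Im w ^+ 2) *: 'X^2.
have E (t : R) : nc (1 + t%:C%C * w) ^+ 2 = Q.[t].
  rewrite nc_sqr /Q !hornerE ReD ImD ReM ImM /=; ring.
have Q0 : 0 < Q.[x] by rewrite -E exprn_gt0.
have F : (fun t : R => ln (nc (1 + t%:C%C * w))) = (fun t => 2^-1 * (@ln R \o horner Q) t).
  apply/funext => t /=; rewrite -E expr2.
  have [->|] := eqVneq (nc (1 + t%:C%C * w)) 0; first by rewrite mulr0 ln0 // mulr0.
  rewrite neq_lt ltNge nc_ge0 /= => p; rewrite lnM ?posrE //; by field.
rewrite F; have h := is_derive1_comp (is_derive1_ln Q0) (is_derive_poly Q x).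
have h2 : is_derive x (1 : R) ((2^-1 : R) \*: (@ln R \o horner Q)) ((2^-1 : R) *: (Q.[x]^-1 * Q^`().[x])).
  exact: is_deriveZ.
apply: trigger_derive h2 _.
rewrite /GRing.scale /= -E.
have -> : Re (w / (1 + x%:C%C * w)) = Re (w * (1 + x%:C%C * w)^*%C) / nc (1 + x%:C%C * w) ^+ 2.
  have [a [b ab]] : exists a b, 1 + x%:C%C * w = (a +i* b)%C by case: (1 + _) => a b; exists a, b.
  rewrite ab nc_sqr /= !ReM /=; have := n0; rewrite ab.
  rewrite -(@ltr_pXn2r _ 2) ?nnegrE ?nc_ge0 // nc_sqr expr0n /= => n0'.
  by field; rewrite gt_eqF.
rewrite /Q !(derivD, derivZ, derivXn, derivX, derivC) !hornerE ReM /=; case: w n0 {F Q0 E Q h} => a b n0 /=.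
by field; rewrite gt_eqF // exprn_gt0.
Qed.

(** Mean value theorem along the segment from 0 to w: the two derivatives differ by w (-u)^n / (1 +
    u), where |w| and |u| are at most 1/2 and |1 + u| is at least 1/2. *)
Lemma ln1_logpoly w n : nc w <= 2^-1 ->
  `|ln (nc (1 + w)) - Re (logpoly n).[w]| <= (2 ^+ n)^-1.
Proof.
move=> w1.
have lb (t : R) : 0 <= t <= 1 -> 2^-1 <= nc (1 + t%:C%C * w).
  move=> /andP[t0 t1]; have := ncB (1 + t%:C%C * w) (t%:C%C * w).
  rewrite addrK nc1 ncM nc_real ger0_norm //; have := nc_ge0 w; nra.
have pos (t : R) : 0 <= t <= 1 -> 0 < nc (1 + t%:C%C * w).
  by move=> /lb; apply: lt_le_trans; rewrite invr_gt0.
pose phi (t : R) := ln (nc (1 + t%:C%C * w)) - Re (logpoly n).[t%:C%C * w].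
pose dphi (t : R) := Re (w / (1 + t%:C%C * w)) - Re (w * (logpoly n)^`().[t%:C%C * w]).
have hd (t : R) : 0 <= t <= 1 -> is_derive t (1 : R) phi (dphi t).
  by move=> /pos p; apply: is_deriveB; [exact: is_derive_ln_nc|exact: is_derive_Re_poly].
have [||c c01] := @MVT R phi dphi 0 1 ltr01.
- by move=> t; rewrite in_itv /= => /andP[a b]; apply: hd; rewrite !ltW.
- apply: derivable_within_continuous => t; rewrite in_itv /= => ab.
  by have [] := hd t ab.
have : phi 0 = 0.
  rewrite /phi mul0r addr0 nc1 ln1 /logpoly horner_sum big1 ?subr0 // => k _.
  by rewrite hornerZ hornerXn expr0n /= mulr0.
move=> ->; rewrite !subr0 mulr1 /phi mul1r => ->.
have {}c01 : 0 <= c <= 1 by move: c01; rewrite in_itv /= => /andP[a b]; rewrite !ltW.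
have p := pos c c01; have l := lb c c01.
rewrite /dphi -ReN -ReD; apply: le_trans (nc_Re _) _.
set u := c%:C%C * w in p l *.
have ne : 1 + u != 0 by rewrite -nc_gt0.
have -> : w / (1 + u) - w * (logpoly n)^`().[u] = w * (- u) ^+ n / (1 + u).
  have := congr1 (fun P : {poly R[i]} => P.[u]) (deriv_logpoly n).
  rewrite !hornerE => D.
  apply: (mulIf ne); rewrite mulrBl !divfK // -mulrA D; ring.
rewrite !ncM ncV ncX ncN ler_pdivrMr //.
have un : nc u ^+ n <= (2 ^+ n)^-1.
  rewrite -exprVn lerXn2r ?nnegrE ?nc_ge0 ?invr_ge0 // /u ncM nc_real.
  by have /andP[c0 c1] := c01; rewrite ger0_norm //; have := nc_ge0 w; nra.
have p2 : 0 < (2 ^+ n : R)^-1 by rewrite invr_gt0 exprn_gt0.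
have u0 : 0 <= nc u ^+ n by rewrite exprn_ge0 ?nc_ge0.
have := nc_ge0 w; nra.
Qed.

Lemma harm_ln1 r f : holo r f -> (forall z, nc z <= r -> nc (f z) <= 2^-1) ->
  harm r (fun z => ln (nc (1 + f z))).
Proof.
move=> hf fb; apply: harm_lim => e e0.
have [n hn] := @exp2_small R 1 e e0; rewrite div1r in hn.
exists (fun z => Re (logpoly n).[f z]); last first.
  by move=> z /fb /(ln1_logpoly n) /le_trans; apply.
apply: harm_holo; apply: (@holo_ext _ _ (fun z => \sum_(k < size (logpoly n)) (logpoly n)`_k * f z ^+ k)).
  by move=> z _; rewrite horner_coef.
apply: (@holo_sum _ _ _ (fun k z => (logpoly n)`_k * f z ^+ k)) => k.
by apply: holo_mul (holo_cst _ _) (holo_exp _ hf).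
Qed.

Lemma harm_ln r f : holo r f ->
  f 0 != 0 -> (forall z, nc z <= r -> nc (f z - f 0) <= nc (f 0) / 2) ->
  harm r (fun z => ln (nc (f z))).
Proof.
move=> hf f0 fb; have f0' : 0 < nc (f 0) by rewrite nc_gt0.
pose g z := (f z - f 0) / f 0.
have gb z : nc z <= r -> nc (g z) <= 2^-1.
  by move=> /fb b; rewrite /g ncM ncV ler_pdivrMr // mulrC.
have hg : holo r g.
  by apply: holo_mul (holo_cst _ _); apply: holo_subr hf (holo_cst _ _).
apply: harm_ext (harm_add (harm_cst r (ln (nc (f 0)))) (harm_ln1 hg gb)) => z zr.
have -> : f z = f 0 * (1 + g z) by rewrite /g; field.
rewrite ncM lnM ?posrE // nc_gt0; apply/negP => /eqP E.
have ge : g z = -1 by apply/eqP; rewrite -subr_eq0 opprK addrC E.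
by have := gb z zr; rewrite ge ncN nc1; lra.
Qed.

End LogModulus.

(** * Averages of log+ of a polynomial *)

Section SubMean.
Context {R : realType}.
Implicit Types (z w c s : R[i]) (e r x y : R) (f : R[i] -> R[i]).

Lemma logplus_ge0 x : 0 <= logplus x.
Proof. by rewrite /logplus le_max lexx. Qed.

(** log+ x is ln (max (1, x)), and ln has slope at most 1 on [1, oo). *)
Lemma logplus_lip1 x y : 0 <= y -> y <= x -> logplus x - logplus y <= x - y.
Proof.
move=> y0 yx; have [x1|x1] := leP x 1.
  have E u : u <= 1 -> logplus u = 0.
    by move=> u1; rewrite /logplus max_l // ln_le0.
  by rewrite !E ?subrr ?subr_ge0 // (le_trans yx).
have x0 : 0 < x by apply: lt_trans x1.
pose m := Num.max 1 y; have m1 : 1 <= m by rewrite le_max lexx.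
have m0 : 0 < m by apply: lt_le_trans m1.
have mx : m <= x by rewrite ge_max ltW.
have -> : logplus x = ln x by rewrite /logplus max_r // ln_ge0 // ltW.
have -> : logplus y = ln m.
  rewrite /logplus /m; have [y1|y1] := leP y 1; first by rewrite ln1 max_l // ln_le0.
  by rewrite max_r // ln_ge0 // ltW.
have ym : y <= m by rewrite le_max lexx orbT.
have -> : ln x - ln m = ln (1 + (x - m) / m).
  have -> : 1 + (x - m) / m = x / m by field; rewrite gt_eqF.
  by rewrite ln_div.
have h0 : 0 <= (x - m) / m by rewrite divr_ge0 ?subr_ge0 // ltW.
apply: le_trans (le_ln1Dx _) _; first by apply: lt_le_trans h0; rewrite ltrN10.
apply: le_trans (_ : _ <= x - m) _; last by rewrite lerD2l lerN2.
by rewrite ler_pdivrMr // ler_peMr // subr_ge0.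
Qed.

Lemma logplus_le x y : 0 <= x -> x <= y -> logplus x <= logplus y.
Proof.
move=> x0 xy; rewrite /logplus ge_max le_max lexx /=.
have [x1|x1] := leP x 1; first by rewrite le_max ln_le0.
have px : 0 < x by lra.
have py : 0 < y by lra.
by rewrite le_max ler_ln ?posrE // xy orbT.
Qed.

Lemma logplus_lip x y : 0 <= x -> 0 <= y -> `|logplus x - logplus y| <= `|x - y|.
Proof.
move=> x0 y0; wlog yx : x y x0 y0 / y <= x.
  by move=> h; have [yx|/ltW xy] := leP y x; [exact: h|rewrite distrC (distrC x); exact: h].
rewrite ger0_norm ?subr_ge0 ?logplus_le // ger0_norm ?subr_ge0 //.
exact: logplus_lip1.
Qed.

Lemma logplus_nc z w : `|logplus (nc z) - logplus (nc w)| <= nc (z - w).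
Proof.
apply: le_trans (logplus_lip (nc_ge0 _) (nc_ge0 _)) _.
have := nc_dist_le z w; have := nc_dist_le w z; rewrite ncC ler_norml => a b.
by apply/andP; split; lra.
Qed.

Lemma ln_le_logplus x : ln x <= logplus x.
Proof. by rewrite /logplus le_max lexx orbT. Qed.

Lemma logplusM x y : 0 <= x -> 0 <= y -> logplus (x * y) <= logplus x + logplus y.
Proof.
move=> x0 y0; rewrite {1}/logplus ge_max addr_ge0 ?logplus_ge0 //=.
have [->|xn] := eqVneq x 0; first by rewrite mul0r ln0 // addr_ge0 ?logplus_ge0.
have [->|yn] := eqVneq y 0; first by rewrite mulr0 ln0 // addr_ge0 ?logplus_ge0.
by rewrite lnM ?posrE ?lt_def ?xn ?yn // lerD // ln_le_logplus.
Qed.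

Lemma logplusX x n : 0 <= x -> logplus (x ^+ n) = n%:R * logplus x.
Proof.
move=> x0; have [->|xn] := eqVneq x 0.
  rewrite expr0n; case: n => [|n]; first by rewrite /logplus ln1 maxxx mul0r.
  by rewrite /logplus ln0 // maxxx mulr0.
by rewrite /logplus lnXn ?lt_def ?xn // maxr_pMr // mulr0 mulr_natl.
Qed.

Lemma logplus_prod (I : Type) (l : seq I) (F : I -> R) : (forall i, 0 <= F i) ->
  logplus (\prod_(i <- l) F i) <= \sum_(i <- l) logplus (F i).
Proof.
move=> F0; elim: l => [|i l IH]; first by rewrite !big_nil /logplus ln1 maxxx.
rewrite !big_cons; apply: le_trans (logplusM _ _) _ => //; last by rewrite lerD2l.
by apply: prodr_ge0.
Qed.

Lemma poly_lipschitz (q : {poly R[i]}) (B : R) : 0 <= B -> exists L, 0 <= L /\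
  forall z w, nc z <= B -> nc w <= B -> nc (q.[z] - q.[w]) <= L * nc (z - w).
Proof.
move=> B0; elim/poly_ind: q => [|p c [L [L0 hL]]].
  by exists 0; split=> // z w _ _; rewrite !horner0 subrr nc0 mul0r.
have [M [M0 hM]] := poly_bounded p B.
exists (M + B * L); split=> [|z w zB wB]; first by rewrite addr_ge0 ?mulr_ge0.
rewrite !hornerMXaddC.
have -> : p.[z] * z + c - (p.[w] * w + c) = p.[z] * (z - w) + w * (p.[z] - p.[w]) by ring.
apply: le_trans (ncD _ _) _; rewrite !ncM mulrDl lerD //.
  by rewrite ler_wpM2r ?nc_ge0 ?hM.
by rewrite -mulrA; apply: ler_pM; rewrite ?nc_ge0 ?hL.
Qed.

(** Factorization of X^n - 1, evaluated at (s - c) / r. It makes averages of log |z - s| over the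
    circle explicit. *)
Lemma prod_roots_circle n w c s r : 0 < r -> n.-primitive_root w ->
  \prod_(j < n) nc (c + r%:C%C * w ^+ j - s) = nc ((s - c) ^+ n - r%:C%C ^+ n).
Proof.
move=> r0 pw; have rn : r%:C%C != 0 :> R[i] by rewrite -nc_gt0 nc_real gtr0_norm.
have E (y : R[i]) : ('X^n - 1 : {poly R[i]}).[y] = y ^+ n - 1 by rewrite !hornerE.
have {}E := E ((s - c) / r%:C%C).
rewrite -(factor_Xn_sub_1 pw) big_mkord horner_prod in E.
have -> : (s - c) ^+ n - r%:C%C ^+ n = r%:C%C ^+ n * (((s - c) / r%:C%C) ^+ n - 1).
  by rewrite expr_div_n; field; rewrite expf_neq0.
have rnE : nc (r%:C%C ^+ n) = \prod_(j < n) r.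
  by rewrite ncX nc_real gtr0_norm // prodr_const card_ord.
rewrite -E ncM rnE nc_prod -big_split /=; apply: eq_bigr => j _.
rewrite hornerXsubC -{2}(gtr0_norm r0) -nc_real -ncM -ncN; congr nc; field; exact: rn.
Qed.

(** Off the circle one of |s - c|^N and r^N eventually exceeds twice the other. *)
Lemma far_root s c r : 0 < r -> nc (s - c) != r -> exists N0, forall N, (N0 <= N)%N ->
  nc (s - c) ^+ N <= 2 * nc ((s - c) ^+ N - r%:C%C ^+ N).
Proof.
move=> r0; set p := nc (s - c); have p0 : 0 <= p by exact: nc_ge0.
have key x y : 0 <= x < y -> exists N0, forall N, (N0 <= N)%N -> 2 * x ^+ N <= y ^+ N.
  move=> /andP[x0 xy]; have y0 : 0 < y by apply: le_lt_trans xy.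
  have h01 : 0 <= x / y < 1 by rewrite divr_ge0 ?(ltW y0) //= ltr_pdivrMr // mul1r.
  have /andP[h0 h1] := h01.
  have [n hn] := @pow_small R (x / y) 2 1 h01 ltr01; exists n => N nN.
  have : 2 * (x / y) ^+ N <= 1.
    apply: le_trans hn; rewrite ler_pM2l //.
    by rewrite -(subnK nN) exprD ler_piMl ?exprn_ge0 // exprn_ile1 // ltW.
  by rewrite expr_div_n mulrA ler_pdivrMr ?exprn_gt0 // mul1r.
have tri N : p ^+ N - r ^+ N <= nc ((s - c) ^+ N - r%:C%C ^+ N) /\
     r ^+ N - p ^+ N <= nc ((s - c) ^+ N - r%:C%C ^+ N).
  have := nc_dist_le ((s - c) ^+ N) (r%:C%C ^+ N).
  have := nc_dist_le (r%:C%C ^+ N) ((s - c) ^+ N).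
  rewrite (ncC (r%:C%C ^+ N)) !ncX nc_real (gtr0_norm r0) -/p => a b.
  by split; lra.
rewrite neq_lt => /orP[pr|rp].
  have [|N0 h] := key p r; first by rewrite p0.
  by exists N0 => N /h; have [_] := tri N; have := exprn_ge0 N p0; lra.
have [|N0 h] := key r p; first by rewrite ltW.
by exists N0 => N /h; have [] := tri N; have := exprn_ge0 N (ltW r0); lra.
Qed.

(** Discrete sub-mean inequality. The values of q at the N points multiply to a product over the
    roots of q, whence |q c|^N <= 2^d prod |q (c + r w^j)| with d the number of roots. Since log+ is
    subadditive on products, the average loses only d ln 2 / N. *)
Lemma avg_poly (q : {poly R[i]}) c r e : 0 < r -> 0 < e ->
  (forall w, nc (w - c) = r -> q.[w] != 0) ->
  exists N0, forall N, (N0 <= N)%N -> (0 < N)%N ->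
  N%:R * (logplus (nc q.[c]) - e) <=
  \sum_(j < N) logplus (nc q.[c + r%:C%C * cis (2 * pi / N%:R) ^+ j]).
Proof.
move=> r0 e0 hq.
have [l ql] := closed_field_poly_normal q.
have q0 : q != 0.
  apply/negP => /eqP q0; have := hq (c + r%:C%C); rewrite q0 horner0 eqxx addrC addKr.
  by rewrite nc_real gtr0_norm // => /(_ erefl).
have far : exists N0, forall N, (N0 <= N)%N -> {in l, forall s,
     nc (s - c) ^+ N <= 2 * nc ((s - c) ^+ N - r%:C%C ^+ N)}.
  have hl : {in l, forall s, nc (s - c) != r}.
    move=> s sl; apply/negP => /eqP sr; have := hq s sr.
    by rewrite ql hornerZ horner_prod (big_rem s) //= hornerXsubC subrr mul0r mulr0 eqxx.
  elim: (l) hl => [|s l' IH] hl; first by exists 0%N.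
  have [N1 h1] := far_root r0 (hl s (mem_head _ _)).
  have [|N2 h2] := IH; first by move=> t tl; apply: hl; rewrite inE tl orbT.
  exists (maxn N1 N2) => N; rewrite geq_max => /andP[a b] t; rewrite inE => /orP[/eqP->|tl].
    exact: h1.
  exact: h2.
have [N1 h1] := far.
pose d := size l; pose N2 := Num.bound (d%:R * ln 2 / e).
exists (maxn N1 N2) => N; rewrite geq_max => /andP[/h1 hN NN] N0.
have pw := @prim_root_cis R N N0; set w := cis _ in pw *.
have horn t : nc q.[t] = nc (lead_coef q) * \prod_(s <- l) nc (t - s).
  rewrite {1}ql hornerZ ncM horner_prod nc_prod; congr (_ * _).
  by apply: eq_bigr => s _; rewrite !hornerE.
have prodE : \prod_(j < N) nc q.[c + r%:C%C * w ^+ j] =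
    nc (lead_coef q) ^+ N * \prod_(s <- l) nc ((s - c) ^+ N - r%:C%C ^+ N).
  rewrite (eq_bigr _ (fun (j : 'I_N) _ => horn (c + r%:C%C * w ^+ j))).
  rewrite big_split /= prodr_const card_ord exchange_big /=; congr (_ * _).
  by apply: eq_bigr => s _; exact: prod_roots_circle.
have le1 : nc q.[c] ^+ N <= 2 ^+ d * \prod_(j < N) nc q.[c + r%:C%C * w ^+ j].
  rewrite prodE horn exprMn mulrCA ler_wpM2l ?exprn_ge0 ?nc_ge0 //.
  rewrite -prodrXl /d -[2 ^+ _](_ : \prod_(s <- l) 2 = _); last first.
    by rewrite big_const_seq count_predT; elim: (size l) => //= n ->; rewrite exprS.
  rewrite -big_split /= big_seq [leRHS]big_seq.
  apply: ler_prod => s sl; rewrite exprn_ge0 ?nc_ge0 //= ncC; exact: hN.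
have P0 : 0 <= \prod_(j < N) nc q.[c + r%:C%C * w ^+ j] by apply: prodr_ge0 => j _; exact: nc_ge0.
have := logplus_le (exprn_ge0 N (nc_ge0 _)) le1.
rewrite logplusX ?nc_ge0 // => le2.
have := le_trans le2 (logplusM (exprn_ge0 _ _) P0) => /(_ (ler0n _ _)).
rewrite logplusX // (_ : logplus 2 = ln 2); last first.
  by rewrite /logplus max_r // ln_ge0 // ler1n.
have le3 := @logplus_prod _ (index_enum 'I_N) (fun j : 'I_N => nc q.[c + r%:C%C * w ^+ j]) (fun=> nc_ge0 _).
have le4 : d%:R * ln 2 <= N%:R * e.
  rewrite -ler_pdivrMr //; apply: le_trans (_ : _ <= N2%:R) _; last by rewrite ler_nat.
  by apply: ltW; apply: archi_boundP; rewrite divr_ge0 ?mulr_ge0 ?(ltW e0) // ln_ge0 // ler1n.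
move=> le5; rewrite mulrBr; lra.
Qed.

(** Roots on the circle itself break the previous argument. A slightly smaller circle avoids all of
    them, and a Lipschitz bound for q makes the change of radius cost at most e / 2. *)
Lemma avg_poly_all (q : {poly R[i]}) c r e : 0 < r -> 0 < e ->
  exists N0, forall N, (N0 <= N)%N -> (0 < N)%N ->
  N%:R * (logplus (nc q.[c]) - e) <=
  \sum_(j < N) logplus (nc q.[c + r%:C%C * cis (2 * pi / N%:R) ^+ j]).
Proof.
move=> r0 e0; have [->|q0] := eqVneq q 0.
  exists 0%N => N _ _; rewrite horner0 nc0 /logplus ln0 // maxxx sub0r.
  apply: le_trans (_ : _ <= 0) _; last by apply: sumr_ge0 => j _; exact: logplus_ge0.
  by rewrite mulr_ge0_le0 // oppr_le0 ltW.
have [l ql] := closed_field_poly_normal q.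
have : exists2 eta, 0 < eta <= r & forall r', r - eta < r' < r -> {in l, forall s, nc (s - c) != r'}.
  elim: (l) => [|s l' [eta /andP[n0 nr] hl]]; first by exists r; rewrite ?r0 ?lexx.
  have [sr|sr] := ltP (nc (s - c)) r.
    exists (Num.min eta (r - nc (s - c))); first by rewrite lt_min n0 subr_gt0 sr ge_min nr.
    move=> r' /andP[a b] t; rewrite inE => /orP[/eqP->|tl].
      apply/negP => /eqP E; move: a; rewrite E ltrBlDr => a.
      have : Num.min eta (r - r') <= r - r' by rewrite ge_min lexx orbT.
      lra.
    apply: hl => //; rewrite b andbT; apply: le_lt_trans a.
    by rewrite lerD2l lerN2 ge_min lexx.
  exists eta; rewrite ?n0 ?nr // => r' ab t; rewrite inE => /orP[/eqP->|tl]; last exact: hl ab t tl.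
  by have /andP[_ b] := ab; rewrite gt_eqF // (lt_le_trans b).
move=> [eta /andP[n0 nr] hl].
have [L [L0 hL]] := @poly_lipschitz q (nc c + r) (addr_ge0 (nc_ge0 _) (ltW r0)).
pose d := Num.min (eta / 2) (e / (2 * (L + 1))).
have L1 : 0 < 2 * (L + 1) by rewrite mulr_gt0 // ltr_wpDl.
have d0 : 0 < d by rewrite lt_min !divr_gt0.
have [d1 d2] : d <= eta / 2 /\ d <= e / (2 * (L + 1)).
  by have := lexx d; rewrite {2}/d le_min => /andP[].
have r'0 : 0 < r - d by lra.
have [||N0 hN] := @avg_poly q c (r - d) (e / 2) r'0; first by rewrite divr_gt0.
  move=> w wr; rewrite ql hornerZ mulf_neq0 ?lead_coef_eq0 // horner_prod.
  rewrite prodf_seq_neq0; apply/allP => s sl; rewrite !hornerE subr_eq0 /=.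
  apply/negP => /eqP E; have := hl (r - d) _ s sl; rewrite -E wr eqxx => h.
  by have : false by apply: h; apply/andP; split; lra.
exists N0 => N NN N1; have {}hN := hN N NN N1.
rewrite ler_pdivlMr // in d2.
have term (j : 'I_N) : logplus (nc q.[c + (r - d)%:C%C * cis (2 * pi / N%:R) ^+ j]) - e / 2 <=
     logplus (nc q.[c + r%:C%C * cis (2 * pi / N%:R) ^+ j]).
  set u := cis _ ^+ j; have u1 : nc u = 1 by rewrite ncX nc_cis expr1n.
  have b1 : nc (c + (r - d)%:C%C * u) <= nc c + r.
    apply: le_trans (ncD _ _) _; rewrite ncM u1 mulr1 nc_real gtr0_norm //; lra.
  have b2 : nc (c + r%:C%C * u) <= nc c + r.
    by apply: le_trans (ncD _ _) _; rewrite ncM u1 mulr1 nc_real gtr0_norm.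
  have := le_trans (logplus_nc _ _) (hL _ _ b1 b2).
  have -> : c + (r - d)%:C%C * u - (c + r%:C%C * u) = (- d)%:C%C * u.
    by rewrite !(rmorphB, rmorphN) /=; ring.
  rewrite ncM u1 mulr1 nc_real normrN (gtr0_norm d0) ler_norml => /andP[_]; nra.
apply: le_trans (_ : _ <= \sum_(j < N) (logplus (nc q.[c + (r - d)%:C%C * cis (2 * pi / N%:R) ^+ j]) - e / 2)) _.
  rewrite big_split /= sumr_const card_ord -[- (e / 2) *+ N]mulr_natl.
  have -> : N%:R * (logplus (nc q.[c]) - e) = N%:R * (logplus (nc q.[c]) - e / 2) + N%:R * - (e / 2) by field.
  by rewrite lerD2r.
by apply: ler_sum => j _.
Qed.

End SubMean.

(** * From averages over roots of unity to integrals over circles *)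

Section SubMeanIntegral.
Context {R : realType}.
Implicit Types (z w c s : R[i]) (e r x y : R) (f : R[i] -> R[i]).
Local Notation mu := (@lebesgue_measure R).

Lemma integrable_itv (g : R -> R) (a b : R) : continuous g ->
  mu.-integrable `[a, b] (EFin \o g).
Proof.
move=> cg; apply: continuous_compact_integrable; first exact: segment_compact.
exact: continuous_subspaceT.
Qed.

Lemma lipschitz_continuous (g : R -> R) (L : R) : 0 <= L ->
  (forall x y, `|g x - g y| <= L * `|x - y|) -> continuous g.
Proof.
move=> L0 hL x; apply/cvgrPdist_le => e e0.
have d0 : 0 < e / (L + 1) by rewrite divr_gt0 // ltr_wpDl.
apply/nbhs_ballP; exists (e / (L + 1)) => //= y; rewrite /ball_ /= => xy.
have xy' : `|x - y| < e / (L + 1) by exact: xy.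
rewrite ltr_pdivlMr ?ltr_wpDl // in xy'.
by apply: le_trans (hL _ _) _; have := normr_ge0 (x - y); nra.
Qed.

Lemma Rintegral_itvS (g : R -> R) (a b c : R) : continuous g -> a <= b -> b <= c ->
  \int[mu]_(x in `[a, c]) g x = \int[mu]_(x in `[a, b]) g x + \int[mu]_(x in `[b, c]) g x.
Proof.
move=> cg ab bc.
have := @Rintegral_itvB R g (BLeft a) (BRight c) b (integrable_itv a c cg).
rewrite !bnd_simp => /(_ ab bc).
rewrite Rintegral_itv_obnd_cbnd => [<-|]; first by rewrite addrC subrK.
apply: integrableS (integrable_itv b c cg) => //.
by move=> t /=; rewrite !in_itv /= => /andP[/ltW -> ->].
Qed.

Lemma Rintegral_lipschitz_ge (g : R -> R) (L a d : R) : 0 <= L -> 0 <= d ->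
  (forall x y, `|g x - g y| <= L * `|x - y|) ->
  d * (g a - L * d) <= \int[mu]_(x in `[a, (a + d)%R]) g x.
Proof.
move=> L0 d0 hL; have cg := lipschitz_continuous L0 hL.
have mI : measurable (`[a, (a + d)%R]%classic : set R) by [].
have E : \int[mu]_(x in `[a, (a + d)%R]) (g a - L * d) = d * (g a - L * d).
  rewrite Rintegral_cst //= lebesgue_measure_itv /= lte_fin ltrDl.
  case: ltP => [d1|d1]; first by rewrite -EFinB /= (_ : a + d - a = d) 1?mulrC //; ring.
  have -> : d = 0 by apply/le_anti; rewrite d1 d0.
  by rewrite mulr0 mul0r.
rewrite -E; apply: le_Rintegral => //.
- by apply: integrable_itv => x; exact: cvg_cst.
- exact: integrable_itv.
move=> x /=; rewrite in_itv /= => /andP[ax xd].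
have := hL a x; rewrite ler_norml => /andP[_].
have : `|a - x| <= d by rewrite distrC ger0_norm ?subr_ge0 // lerBlDl.
nra.
Qed.

Lemma Rintegral_riemann (g : R -> R) (L d : R) (n : nat) : 0 <= L -> 0 <= d ->
  (forall x y, `|g x - g y| <= L * `|x - y|) ->
  \sum_(j < n) d * (g (j%:R * d) - L * d) <= \int[mu]_(x in `[0, (n%:R * d)%R]) g x.
Proof.
move=> L0 d0 hL; have cg := lipschitz_continuous L0 hL.
elim: n => [|n IH]; first by rewrite big_ord0 mul0r set_itv1 Rintegral_set1.
rewrite big_ord_recr /= (@Rintegral_itvS _ _ (n%:R * d)) //; last 2 first.
- by rewrite mulr_ge0.
- by rewrite ler_wpM2r // ler_nat.
apply: lerD => //.
have -> : n.+1%:R * d = n%:R * d + d by rewrite -natr1 mulrDl mul1r.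
exact: Rintegral_lipschitz_ge.
Qed.

(** Lower Riemann sums of a Lipschitz function: N equal steps lose at most (2 pi)^2 L / N. *)
Lemma mean_ge_of_avg (g : R -> R) (L A : R) : 0 <= L ->
  (forall x y, `|g x - g y| <= L * `|x - y|) ->
  (forall e, 0 < e -> exists N0, forall N, (N0 <= N)%N -> (0 < N)%N ->
    N%:R * (A - e) <= \sum_(j < N) g (j%:R * (2 * pi / N%:R))) ->
  2 * pi * A <= \int[mu]_(x in `[0, (2 * pi)%R]) g x.
Proof.
move=> L0 hL hA; have pi0 := @pi_gt0 R; have p2 : 0 < 2 * pi :> R by rewrite mulr_gt0.
apply/ler_addgt0Pl => e e0.
have e1 : 0 < e / 2 / (2 * pi) by rewrite !divr_gt0.
have [N0 hN] := hA _ e1.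
pose N := maxn N0.+1 (Num.bound ((2 * pi) * (L * (2 * pi)) / (e / 2))).
have N00 : (0 < N)%N by rewrite /N leq_max.
have Npos : 0 < N%:R :> R by rewrite ltr0n.
have NN : (N0 <= N)%N by rewrite /N leq_max leqnSn.
pose d : R := 2 * pi / N%:R; have d0 : 0 <= d by rewrite divr_ge0 // ltW.
have Nd : N%:R * d = 2 * pi by rewrite /d; field; rewrite gt_eqF.
have := Rintegral_riemann N L0 d0 hL; rewrite Nd.
have -> : \sum_(j < N) d * (g (j%:R * d) - L * d) = d * (\sum_(j < N) g (j%:R * d)) - 2 * pi * (L * d).
  rewrite -mulr_sumr big_split /= sumr_const card_ord -[- (L * d) *+ N]mulr_natl mulrDr.
  by rewrite -Nd; ring.
move=> h1; have h2 := ler_wpM2l d0 (hN N NN N00).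
have h3 : d * (N%:R * (A - e / 2 / (2 * pi))) = 2 * pi * A - e / 2.
  by rewrite mulrA (mulrC d) Nd mulrBr [_ * (e / 2 / _)]mulrC divfK // gt_eqF.
have h4 : 2 * pi * (L * d) <= e / 2.
  have e2 : 0 < e / 2 by rewrite divr_gt0.
  have -> : 2 * pi * (L * d) = (2 * pi) * (L * (2 * pi)) / N%:R by rewrite /d; ring.
  set K := (2 * pi) * (L * (2 * pi)).
  have K0 : 0 <= K / (e / 2) by rewrite divr_ge0 ?mulr_ge0 // ltW.
  have : K / (e / 2) <= N%:R.
    by apply: le_trans (ltW (archi_boundP K0)) _; rewrite ler_nat /N leq_max leqnn orbT.
  by rewrite !ler_pdivrMr // mulrC.
by rewrite h3 in h2; lra.
Qed.

Lemma cis_lipschitz x y : nc (cis x - cis y) <= 2 * `|x - y|.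
Proof.
wlog xy : x y / x < y.
  move=> h; have [xy|] := ltP x y; first exact: h xy.
  rewrite le_eqVlt => /orP[/eqP->|yx]; first by rewrite !subrr nc0 normr0 mulr0.
  by rewrite ncC distrC; exact: h yx.
have lip (f df : R -> R) : (forall t, is_derive t (1 : R) f (df t)) -> (forall t, `|df t| <= 1) ->
    `|f x - f y| <= `|x - y|.
  move=> hf hdf; have [|c _] := @MVT R f df x y xy (fun t _ => hf t).
    by apply: derivable_within_continuous => t _; have [] := hf t.
  by rewrite distrC (distrC x) => ->; rewrite normrM ler_piMl.
apply: le_trans (nc_le_ReIm _) _; rewrite -[2]/(1 + 1) mulrDl mul1r /cis /=.
apply: lerD.
  apply: (lip cos (fun t => - sin t)) => t; rewrite normrN ler_norml.
  by rewrite sin_geN1 sin_le1.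
by apply: (lip sin cos) => t; rewrite ler_norml cos_geN1 cos_le1.
Qed.

Lemma poly_submean (q : {poly R[i]}) c r : 0 < r ->
  2 * pi * logplus (nc q.[c]) <=
  \int[mu]_(x in `[0, (2 * pi)%R]) logplus (nc q.[c + r%:C%C * cis x]) /\
  continuous (fun x => logplus (nc q.[c + r%:C%C * cis x])).
Proof.
move=> r0; have [L [L0 hL]] := @poly_lipschitz R q (nc c + r) (addr_ge0 (nc_ge0 _) (ltW r0)).
have b x : nc (c + r%:C%C * cis x) <= nc c + r.
  by apply: le_trans (ncD _ _) _; rewrite ncM nc_cis mulr1 nc_real gtr0_norm.
have lip x y : `|logplus (nc q.[c + r%:C%C * cis x]) - logplus (nc q.[c + r%:C%C * cis y])| <=
    (L * r * 2) * `|x - y|.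
  apply: le_trans (logplus_nc _ _) _; apply: le_trans (hL _ _ (b _) (b _)) _.
  rewrite -!mulrA ler_wpM2l // opprD addrACA subrr add0r -mulrBr ncM nc_real gtr0_norm //.
  by rewrite ler_wpM2l ?cis_lipschitz // ltW.
have L'0 : 0 <= L * r * 2 by rewrite !mulr_ge0 // ltW.
split; last exact: lipschitz_continuous L'0 lip.
apply: (mean_ge_of_avg L'0 lip) => e e0.
have [N0 hN] := @avg_poly_all R q c r e r0 e0; exists N0 => N NN N1.
apply: le_trans (hN N NN N1) _; apply: ler_sum => j _; by rewrite cisX.
Qed.

(** Only one-sided bounds are asked, below at the centre and above on the circle. This is what is
    available near a pole, where the approximants exceed h by little uniformly but fall below it by
    an amount controlled only pointwise. *)
Lemma submean_of_approx (h : R[i] -> R) c r : 0 < r ->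
  continuous (fun x => h (c + r%:C%C * cis x)) ->
  (forall e, 0 < e -> exists (k : R) (q : {poly R[i]}),
    [/\ 0 <= k, h c - e <= k * logplus (nc q.[c]) &
     forall x, k * logplus (nc q.[c + r%:C%C * cis x]) <= h (c + r%:C%C * cis x) + e]) ->
  2 * pi * h c <= \int[mu]_(x in `[0, (2 * pi)%R]) h (c + r%:C%C * cis x).
Proof.
move=> r0 ch hq; have pi0 := @pi_gt0 R; have p2 : 0 < 2 * pi :> R by rewrite mulr_gt0.
apply/ler_addgt0Pl => e e0.
(* Used twice over an interval of length 2 pi, this error adds up to e. *)
have e1 : 0 < e / (4 * pi) by rewrite divr_gt0 // mulr_gt0.
have [k [q [k0 q1 q2]]] := hq _ e1; have [q3 q4] := poly_submean q c r0.
have che : continuous (fun x : R => h (c + r%:C%C * cis x) + e / (4 * pi)).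
  by move=> x; apply: cvgD; [exact: ch|exact: cvg_cst].
have mI : measurable (`[0, (2 * pi)%R]%classic : set R) by [].
have ck : continuous (fun x : R => k * logplus (nc q.[c + r%:C%C * cis x])).
  by move=> x; apply: cvgM; [exact: cvg_cst|exact: q4].
have : \int[mu]_(x in `[0, (2 * pi)%R]) (k * logplus (nc q.[c + r%:C%C * cis x])) <=
       \int[mu]_(x in `[0, (2 * pi)%R]) (h (c + r%:C%C * cis x) + e / (4 * pi)).
  by apply: le_Rintegral => //; exact: integrable_itv.
rewrite RintegralZl //; last exact: integrable_itv.
rewrite RintegralD //; last 2 first.
- exact: integrable_itv.
- by apply: integrable_itv => x; exact: cvg_cst.
rewrite Rintegral_cst //= lebesgue_measure_itv /= lte_fin p2 -EFinB /= subr0.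
have : 2 * pi * (h c - e / (4 * pi)) <= k * (2 * pi * logplus (nc q.[c])).
  by rewrite mulrCA ler_pM2l.
have := ler_wpM2l k0 q3.
have Ke : e = 4 * pi * (e / (4 * pi)) by rewrite [RHS]mulrC divfK // gt_eqF // mulr_gt0.
lra.
Qed.

Lemma planar_subharmonic_of (D : set (R * R)) (h : R[i] -> R) :
  (forall p, D p -> forall e, 0 < e -> \forall p' \near p, `|h (toC p') - h (toC p)| <= e) ->
  (forall c r, 0 < r -> (forall w, nc (w - c) <= r -> D (Re w, Im w)) ->
     forall e, 0 < e -> exists (k : R) (q : {poly R[i]}),
    [/\ 0 <= k, h c - e <= k * logplus (nc q.[c]) &
     forall x, k * logplus (nc q.[c + r%:C%C * cis x]) <= h (c + r%:C%C * cis x) + e]) ->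
  planar_subharmonic D (fun p => h (toC p)).
Proof.
move=> hc hq; split=> [p Dp e e0|p r r0 hD].
  have e2 : 0 < e / 2 by rewrite divr_gt0.
  apply: filterS (hc p Dp _ e2) => p'; rewrite ler_distl => /andP[_]; lra.
pose c := toC p; pose g := fun x : R => h (c + r%:C%C * cis x).
have hD' w : nc (w - c) <= r -> D (Re w, Im w).
  move=> wc; apply: hD; rewrite /closed_disc /=.
  have : nc (w - c) ^+ 2 <= r ^+ 2 by rewrite lerXn2r ?nnegrE ?nc_ge0 // ltW.
  by rewrite nc_sqr ReD ImD ReN ImN.
have cg : continuous g.
  move=> x; apply/cvgrPdist_le => e e0.
  pose w := c + r%:C%C * cis x.
  have Dw : D (Re w, Im w).
    by apply: hD'; rewrite /w addrC addKr ncM nc_cis mulr1 nc_real gtr0_norm.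
  have [d /andP[d0 _] hd] := near_disc ltr01 (hc _ Dw e e0).
  apply/nbhs_ballP; exists (d / (2 * r)) => /=; first by rewrite divr_gt0 // mulr_gt0.
  move=> y xy; have xy' : `|x - y| < d / (2 * r) by exact: xy.
  have := hd (Re (c + r%:C%C * cis y), Im (c + r%:C%C * cis y)).
  rewrite !toC_ReIm distrC; apply; rewrite /w opprD addrACA subrr add0r -mulrBr ncM nc_real gtr0_norm //.
  have := cis_lipschitz y x; rewrite distrC => l.
  rewrite ltr_pdivlMr ?mulr_gt0 // in xy'; apply: le_trans (ler_wpM2l (ltW r0) l) _; lra.
have E x : h (toC (p.1 + r * cos x, p.2 + r * sin x)) = g x.
  congr h; rewrite /c /toC /cis /=; apply/eqP; rewrite eq_complex /= !mul0r subr0 addr0.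
  by rewrite !eqxx.
have := submean_of_approx r0 cg (hq c r r0 hD').
have pi0 := @pi_gt0 R; have p2 : 0 < 2 * pi :> R by rewrite mulr_gt0.
under eq_integral do rewrite E.
have fin : (\int[mu]_(x in `[0%R, (2 * pi)%R]) (g x)%:E)%E \is a fin_num.
  by apply: integrable_fin_num => //; exact: integrable_itv.
rewrite -(fineK fin) -EFinM lee_fin => le.
by rewrite mulrC ler_pdivlMr // mulrC.
Qed.

End SubMeanIntegral.

(** * Places and values of rational functions *)

Section AlgebraicOver.
Variables (A : idomainType) (K : fieldType) (f : {rmorphism A -> K}).
Implicit Types (x y u : K) (p : {poly K}).

(** Algebraicity over the fraction field of the image of [A], expressed as integrality after
    clearing a denominator: sums and products are inherited from integral elements and no fraction
    field has to be formed. *)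
Definition algOver x := exists2 d, f d != 0 & integralOver f (f d * x).

Lemma algOver_int x : integralOver f x -> algOver x.
Proof. by exists 1; rewrite rmorph1 ?oner_eq0 ?mul1r. Qed.

Lemma algOver_id d : algOver (f d).
Proof. exact/algOver_int/integral_id. Qed.

Lemma algOver_add x y : algOver x -> algOver y -> algOver (x + y).
Proof.
move=> [d d0 hx] [e e0 hy]; exists (d * e); first by rewrite rmorphM mulf_neq0.
have -> : f (d * e) * (x + y) = f e * (f d * x) + f d * (f e * y) by rewrite rmorphM; ring.
by apply: integral_add; apply: integral_mul => //; exact: integral_id.
Qed.

Lemma algOver_mul x y : algOver x -> algOver y -> algOver (x * y).
Proof.
move=> [d d0 hx] [e e0 hy]; exists (d * e); first by rewrite rmorphM mulf_neq0.
have -> : f (d * e) * (x * y) = (f d * x) * (f e * y) by rewrite rmorphM; ring.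
exact: integral_mul.
Qed.

Lemma integral_exp x n : integralOver f x -> integralOver f (x ^+ n).
Proof.
move=> hx; elim: n => [|n IH]; first by rewrite expr0; exact: integral1.
by rewrite exprS; exact: integral_mul.
Qed.

(** In an equation q(y) y + c = 0 with c nonzero, c / y = - q(y) is integral. If c vanishes, y is
    cancelled and the induction continues with q. *)
Lemma algOver_inv_int y : y != 0 -> integralOver f y -> algOver y^-1.
Proof.
move=> y0 [p]; elim/poly_ind: p => [|q c IH]; first by rewrite monicE lead_coef0 eq_sym oner_eq0.
move=> mp; have [q0|q0] := eqVneq q 0.
  move: mp; rewrite q0 mul0r add0r monicE lead_coefC => /eqP ->.
  by rewrite rmorph1 /root hornerC oner_eq0.
have mq : q \is monic.
  move: mp; rewrite !monicE lead_coefDl ?lead_coefMX // size_polyC size_mulX //.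
  by rewrite (leq_ltn_trans (leq_b1 _)) // ltnS size_poly_gt0.
rewrite /root rmorphD rmorphM /= map_polyX map_polyC /= hornerMXaddC => /eqP E.
have [c0|c0] := eqVneq (f c) 0.
  by apply: IH => //; move/eqP: E; rewrite c0 addr0 mulf_eq0 (negPf y0) orbF.
exists c => //.
have -> : f c * y^-1 = - (map_poly f q).[y].
  apply: (mulIf y0); rewrite mulfVK // mulNr.
  by apply/eqP; rewrite -subr_eq0 opprK addrC E.
apply: integral_opp; apply: integral_horner; last first.
  exists (q * 'X + c%:P) => //; rewrite /root rmorphD rmorphM /= map_polyX map_polyC /=.
  by rewrite hornerMXaddC E.
apply/integral_poly => i; rewrite coef_map; exact: integral_id.
Qed.

(** Multiplying p(u) = 0 by l^(n-1), with l the leading coefficient and n the degree, gives a monic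
    equation for l u with coefficients p_i l^(n-1-i). *)
Lemma integral_lead p u : (forall i, integralOver f p`_i) -> root p u ->
  integralOver f (lead_coef p * u).
Proof.
move=> hp pu; set l := lead_coef p; set n := (size p).-1.
have [sp|sp] := leqP (size p) 1.
  have pc := size1_polyC sp; move: pu; rewrite pc /root hornerC => /eqP p0.
  by rewrite /l pc p0 lead_coef0 mul0r; exact: mxpoly.integral0.
have np : size p = n.+1 by rewrite /n prednK // (ltn_trans _ sp).
have n0 : (0 < n)%N by rewrite -ltnS -np.
pose m : {poly K} := 'X^n + \poly_(i < n) (p`_i * l ^+ (n.-1 - i)).
have mm : m \is monic.
  rewrite monicE lead_coefDl ?lead_coefXn // size_polyXn ltnS; exact: size_poly.
apply: (integral_root_monic mm).
  apply/eqP; rewrite /m hornerD hornerXn horner_poly.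
  transitivity (l ^+ n.-1 * p.[u]); last by rewrite (rootP pu) mulr0.
  rewrite horner_coef np big_ord_recr /= -/n mulrDr addrC; congr (_ + _).
    rewrite mulr_sumr; apply: eq_bigr => i _; rewrite exprMn.
    have -> : l ^+ n.-1 = l ^+ (n.-1 - i) * l ^+ i by rewrite -exprD subnK // -ltnS prednK.
    ring.
  by rewrite -[p`_n]/(lead_coef p) -/l exprMn mulrA -exprSr prednK.
apply/integral_poly => i; rewrite coefD coefXn coef_poly; apply: integral_add.
  exact: integral_nat.
case: ifP => _; last exact: mxpoly.integral0.
by apply: integral_mul => //; apply: integral_exp; exact: hp.
Qed.

Lemma algOver_common (s : seq K) : {in s, forall x, algOver x} ->
  exists2 d, f d != 0 & {in s, forall x, integralOver f (f d * x)}.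
Proof.
elim: s => [|x s IH] h; first by exists 1; rewrite ?rmorph1 ?oner_eq0.
have [|d d0 hd] := IH; first by move=> y ys; apply: h; rewrite inE ys orbT.
have [e e0 he] := h x (mem_head _ _).
exists (d * e); first by rewrite rmorphM mulf_neq0.
move=> y; rewrite inE rmorphM => /orP[/eqP->|ys].
  by rewrite -mulrA; apply: integral_mul => //; exact: integral_id.
by rewrite mulrAC; apply: integral_mul; [exact: hd|exact: integral_id].
Qed.

Lemma algOver_root p u : p != 0 -> (forall i, algOver p`_i) -> root p u -> algOver u.
Proof.
move=> p0 hp pu.
have [|d d0 hd] := @algOver_common p; first by move=> _ /(nthP 0)[i _ <-].
have q0 : f d *: p != 0 by rewrite scaler_eq0 negb_or d0.
have hq i : integralOver f (f d *: p)`_i.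
  rewrite coefZ; have [lt|ge] := ltnP i (size p); first by apply: hd; exact: mem_nth.
  by rewrite nth_default // mulr0; exact: mxpoly.integral0.
have qu : root (f d *: p) u by rewrite rootZ.
have := integral_lead hq qu; set l := lead_coef _ => hl.
have l0 : l != 0 by rewrite lead_coef_eq0.
have -> : u = l^-1 * (l * u) by rewrite mulKf.
apply: algOver_mul; last exact: algOver_int.
by apply: algOver_inv_int => //; exact: hq.
Qed.

Lemma algOver_poly x : injective f -> algOver x ->
  exists2 P : {poly A}, P != 0 & root (map_poly f P) x.
Proof.
move=> fi [d d0 [p mp px]]; have dn : d != 0 by apply: contraNneq d0 => ->; rewrite rmorph0.
exists (p \Po (d%:P * 'X)).
  rewrite comp_poly_eq0 ?monic_neq0 //.
  by rewrite size_Cmul // size_polyX.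
rewrite /root map_comp_poly rmorphM /= map_polyC map_polyX horner_comp hornerM hornerC hornerX.
exact: px.
Qed.

End AlgebraicOver.

(** * Transcendence degree one *)

Section FunctionField.
Context (R : realType) (C : set (R[i] * R[i])) (F : functionField C).
Implicit Types (w x y g : F) (t : place F) (P : {poly {poly R[i]}}).

Lemma ff_comm w : commr_rmorph (ff_const F) w.
Proof. by move=> x; exact: mulrC. Qed.

Definition evF w : {rmorphism {poly R[i]} -> F} := horner_morph (ff_comm w).

Lemma evFE w p : evF w p = (map_poly (ff_const F) p).[w]. Proof. by []. Qed.
Lemma evFC w c : evF w c%:P = ff_const F c. Proof. by rewrite evFE map_polyC hornerC. Qed.
Lemma evFX w : evF w 'X = w. Proof. by rewrite evFE map_polyX hornerX. Qed.

Lemma eval2_ev P x y :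
  eval2 (map_poly (map_poly (ff_const F)) P) x y = (map_poly (evF x) P).[y].
Proof.
rewrite /eval2 -horner2_swapXY horner_swapXY -map_poly_comp.
congr (_.[_]); apply: eq_map_poly => p /=; by rewrite evFE.
Qed.

Lemma ev_swap P x y : (map_poly (evF x) (swapXY P)).[y] = (map_poly (evF y) P).[x].
Proof. by rewrite -!eval2_ev /eval2 -!swapXY_map horner2_swapXY. Qed.

Definition transc w := injective (evF w).

Lemma transcP w : (forall p, evF w p = 0 -> p = 0) -> transc w.
Proof. by move=> h p q /eqP; rewrite -subr_eq0 -rmorphB => /eqP/h/eqP; rewrite subr_eq0 => /eqP. Qed.

Lemma map_ev_neq0 w P : transc w -> P != 0 -> map_poly (evF w) P != 0.
Proof.
move=> tw; apply: contra_neq => h; apply/polyP => i; apply: tw.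
by rewrite coef0 rmorph0 -[LHS]coef_map h coef0.
Qed.

Lemma algOver_dep w x P : transc w -> P != 0 -> (map_poly (evF w) P).[x] = 0 ->
  algOver (evF w) x.
Proof.
move=> tw P0 Px; apply: (algOver_root (map_ev_neq0 tw P0)); last exact/rootP.
by move=> i; rewrite coef_map; exact: algOver_id.
Qed.

Lemma algOver_ev w x p : algOver (evF w) x -> algOver (evF w) (evF x p).
Proof.
move=> hx; elim/poly_ind: p => [|p c IH]; first by rewrite rmorph0 -(rmorph0 (evF w)); exact: algOver_id.
rewrite rmorphD rmorphM /= evFX evFC -(evFC w); apply: algOver_add; last exact: algOver_id.
exact: algOver_mul.
Qed.

Lemma algOver_all w : algOver (evF w) (ff_a F) -> algOver (evF w) (ff_b F) ->
  forall g, algOver (evF w) g.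
Proof.
move=> ha hb g.
have hP P : algOver (evF w) (ff_eval F P).
  rewrite /ff_eval eval2_ev; elim/poly_ind: P => [|P c IH].
    by rewrite rmorph0 horner0 -(rmorph0 (evF w)); exact: algOver_id.
  rewrite rmorphD rmorphM /= map_polyX map_polyC /= hornerMXaddC.
  by apply: algOver_add; [exact: algOver_mul|exact: algOver_ev].
have [P [Q [Q0 gE]]] := ff_gen g.
pose p : {poly F} := (ff_eval F Q)%:P * 'X - (ff_eval F P)%:P.
have pc i : p`_i = if i == 1%N then ff_eval F Q else if i == 0%N then - ff_eval F P else 0.
  rewrite /p coefB coefCM coefX coefC; case: i => [|[|i]] /=; rewrite ?mulr0 ?mulr1 ?sub0r ?subr0 ?oppr0 //.
apply: (@algOver_root _ _ _ p).
- by apply/eqP => /polyP /(_ 1%N); rewrite pc coef0 => /eqP; rewrite (negPf Q0).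
- move=> i; rewrite pc; case: ifP => _ //; case: ifP => _; last first.
    by rewrite -(rmorph0 (evF w)); exact: algOver_id.
  rewrite -mulN1r -(rmorphN1 (evF w)); apply: algOver_mul => //; exact: algOver_id.
- by apply/rootP; rewrite /p !hornerE gE mulrC divfK // subrr.
Qed.

Lemma const_root x p : p != 0 -> evF x p = 0 -> exists c, x = ff_const F c.
Proof.
move=> p0; have [l ->] := closed_field_poly_normal p.
rewrite -mul_polyC rmorphM /= evFC rmorph_prod /= => /eqP.
rewrite mulf_eq0 fmorph_eq0 lead_coef_eq0 (negPf p0) /= prodf_seq_eq0.
move=> /hasP[c _ /=]; rewrite rmorphB /= evFX evFC subr_eq0 => /eqP ->.
by exists c.
Qed.

Lemma const_all x y : x = ff_a F -> y = ff_b F -> (exists c, x = ff_const F c) ->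
  (exists c, y = ff_const F c) -> forall g, exists c, g = ff_const F c.
Proof.
move=> xa yb [c xc] [d yd] g.
have hP P : exists e, ff_eval F P = ff_const F e.
  rewrite /ff_eval eval2_ev -xa -yb xc yd; exists (P.[d%:P].[c]).
  have ec p : evF (ff_const F c) p = ff_const F p.[c] by rewrite evFE horner_map.
  elim/poly_ind: P => [|P p [IH]]; first by rewrite rmorph0 !horner0 rmorph0.
  rewrite rmorphD rmorphM /= map_polyX map_polyC /= !hornerMXaddC IH ec.
  by rewrite hornerD hornerM hornerC rmorphD rmorphM.
have [P [Q [Q0 ->]]] := ff_gen g; have [e1 ->] := hP P; have [e2 ->] := hP Q.
by exists (e1 / e2); rewrite fmorph_div.
Qed.

(** If a is transcendental, the equation of the curve makes b, hence w, algebraic over it, and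
    exchanging the two variables of the relation makes a algebraic over w. Otherwise a is constant;
    then b is transcendental, as the field contains the transcendental w, and the same exchange
    applies to b. *)
Lemma alg_all (hC : irreducible_curve C) w : transc w ->
  forall g, algOver (evF w) g.
Proof.
move=> tw; have [P [[P0 _ _] CE]] := hC.
have Pab : (map_poly (evF (ff_a F)) P).[ff_b F] = 0.
  by rewrite -eval2_ev; apply/ff_eq0 => p; rewrite CE.
have cst x z c : x = ff_const F c -> algOver (evF z) x.
  by move=> ->; rewrite -(evFC z); exact: algOver_id.
have self z : algOver (evF z) z by rewrite -{2}(evFX z); exact: algOver_id.
have back z : transc z -> algOver (evF z) w -> algOver (evF w) z.
  move=> tz /(algOver_poly tz)[Q Q0 /rootP Qw].
  by apply: (@algOver_dep _ _ (swapXY Q) tw); rewrite ?swapXY_eq0 // ev_swap.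
have [ta|nta] := pselect (transc (ff_a F)).
  have hb : algOver (evF (ff_a F)) (ff_b F) by exact: algOver_dep Pab.
  have ha : algOver (evF w) (ff_a F) by apply: back => //; exact: algOver_all.
  apply: algOver_all => //.
  apply: (algOver_root (map_ev_neq0 ta P0)); last exact/rootP.
  by move=> i; rewrite coef_map; exact: algOver_ev.
have ntransc z : ~ transc z -> exists c, z = ff_const F c.
  move=> nt; apply: contrapT => nc'; apply: nt; apply: transcP => p pz.
  by apply/eqP; apply: contrapT => /negP p0; apply: nc'; exact: const_root pz.
have [c ac] := ntransc _ nta.
have [tb|ntb] := pselect (transc (ff_b F)); last first.
  have [d bd] := ntransc _ ntb.
  have [e we] := const_all erefl erefl (ex_intro _ c ac) (ex_intro _ d bd) w.
  have := tw 'X e%:P; rewrite evFX evFC => /(_ we) /(congr1 (size \o val)) /=.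
  by rewrite size_polyX size_polyC; case: (e != 0).
have ha z : algOver (evF z) (ff_a F) by exact: cst ac.
by apply: algOver_all => //; apply: back => //; apply: algOver_all.
Qed.

End FunctionField.

(** * Orders and residues at a place *)

Section Places.
Context (R : realType) (C : set (R[i] * R[i])) (F : functionField C).
Implicit Types (t s : place F) (g h u x y : F) (c d : R[i]) (m n k : int).
Local Notation K := (ff_const F).
Local Open Scope ereal_scope.

Lemma ord0 t : ord t 0%R = +oo.
Proof. exact/ord_eqy. Qed.

Lemma ord1 t : ord t 1%R = 0.
Proof. by rewrite -(rmorph1 K) ord_const ?oner_eq0. Qed.

Lemma ord_fin t g : g != 0%R -> exists m, ord t g = m%:E.
Proof.
move=> g0; have := ordM t g g^-1; rewrite mulfV // ord1.
have : ord t g <> +oo by move/ord_eqy => E; rewrite E eqxx in g0.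
case: (ord t g) => [m _ _|//|_]; first by exists m.
by case: (ord t g^-1).
Qed.

Lemma ord_inj_fin t g m : ord t g = m%:E -> g != 0%R.
Proof. by move=> E; apply/negP => /eqP g0; move: E; rewrite g0 ord0. Qed.

(** Lower bounds on the order hold for the zero function too, so this calculus needs no case
    distinction on infinite orders. *)
Definition vge t m g : Prop := m%:E <= ord t g.

Lemma vge0 t m : vge t m 0%R.
Proof. by rewrite /vge ord0 leey. Qed.

Lemma vgeD t m g h : vge t m g -> vge t m h -> vge t m (g + h)%R.
Proof. by move=> a b; apply: le_trans (ordD t g h); rewrite le_min; apply/andP. Qed.

Lemma vgeM t m n g h : vge t m g -> vge t n h -> vge t (m + n)%R (g * h)%R.
Proof. by move=> a b; rewrite /vge ordM EFinD; exact: leeD. Qed.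

Lemma vge_const t c : vge t 0%R (K c).
Proof.
have [->|c0] := eqVneq c 0%R; first by rewrite rmorph0; exact: vge0.
by rewrite /vge ord_const.
Qed.

Lemma vgeN t m g : vge t m g -> vge t m (- g)%R.
Proof. by move=> h; have := vgeM (vge_const t (-1)%R) h; rewrite add0r rmorphN1 mulN1r. Qed.

Lemma vgeB t m g h : vge t m g -> vge t m h -> vge t m (g - h)%R.
Proof. by move=> a /vgeN; exact: vgeD. Qed.

Lemma vge_le t m n g : (m <= n)%R -> vge t n g -> vge t m g.
Proof. by move=> mn; apply: le_trans; rewrite lee_fin. Qed.

Lemma vge_ord t m g : ord t g = m%:E -> vge t m g.
Proof. by rewrite /vge => ->. Qed.

Lemma vge1P t g : vge t 1%R g <-> 0 < ord t g.
Proof.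
rewrite /vge; case: (ord t g) => [m||] //=; rewrite ?lee_fin ?lte_fin ?ltry ?leey //.
Qed.

Lemma ordX t g m (n : nat) : ord t g = m%:E -> ord t (g ^+ n)%R = (m * n%:Z)%R%:E.
Proof.
move=> gm; elim: n => [|n IH]; first by rewrite expr0 ord1 mulr0.
by rewrite exprS ordM IH gm -EFinD intS mulrDr mulr1.
Qed.

Lemma vgeX t g m (n : nat) : vge t m g -> vge t (m * n%:Z)%R (g ^+ n)%R.
Proof.
move=> gm; elim: n => [|n IH]; first by rewrite expr0 mulr0 -(rmorph1 K); exact: vge_const.
by rewrite exprS intS mulrDr mulr1; exact: vgeM.
Qed.

Lemma ordV t g m : ord t g = m%:E -> ord t g^-1 = (- m)%R%:E.
Proof.
move=> gm; have g0 := ord_inj_fin gm.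
have gi0 : g^-1%R != 0%R by rewrite invr_eq0.
have [n gn] := ord_fin t gi0.
rewrite gn; congr (_%:E); apply/eqP; rewrite -addr_eq0 addrC.
by have := ordM t g g^-1; rewrite mulfV // ord1 gm gn -EFinD => -[<-].
Qed.

Lemma ord_div t g h m n : ord t g = m%:E -> ord t h = n%:E -> ord t (g / h)%R = (m - n)%R%:E.
Proof. by move=> gm hn; rewrite ordM gm (ordV hn) -EFinD. Qed.

Lemma ordN t g : ord t (- g)%R = ord t g.
Proof. by rewrite -mulN1r ordM -(rmorphN1 K) ord_const ?oppr_eq0 ?oner_eq0 // add0e. Qed.

Lemma ord_add_eq t g h m : ord t g = m%:E -> vge t (m + 1)%R h -> ord t (g + h)%R = m%:E.
Proof.
move=> gm hm.
have hm' : vge t m h by apply: vge_le hm; rewrite lerDl.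
have l1 : vge t m (g + h)%R by apply: vgeD => //; exact: vge_ord.
have gh0 : (g + h != 0)%R.
  apply/negP => /eqP E; have gE : g = (- h)%R by apply/eqP; rewrite -subr_eq0 opprK E.
  by move: hm; rewrite /vge -ordN -gE gm lee_fin gerDl.
have [k ghk] := ord_fin t gh0; rewrite ghk; congr (_%:E); apply/eqP; rewrite eq_le.
move: l1; rewrite /vge ghk lee_fin => ->; rewrite andbT leNgt; apply/negP => mk.
have : vge t (m + 1)%R (g + h - h)%R.
  by apply: vgeB => //; rewrite /vge ghk lee_fin -lezD1 in mk *.
by rewrite addrK /vge gm lee_fin gerDl.
Qed.

Lemma vge_div t g u k m : ord t u = k%:E -> vge t m g -> vge t (m - k)%R (g / u)%R.
Proof. by move=> /ordV uk gm; apply: vgeM gm _; exact: vge_ord. Qed.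

Lemma ord_ev_unit t u p c : vge t 1%R (u - K c)%R -> (p.[c] != 0)%R -> ord t (evF u p) = 0.
Proof.
move=> uc pc.
have [q pq] : exists q, p = ((p.[c])%:P + q * ('X - c%:P))%R.
  have /factor_theorem[q hq] : root (p - (p.[c])%:P)%R c by rewrite /root !hornerE subrr.
  by exists q; rewrite -hq addrC subrK.
have reg : forall q, vge t 0%R (evF u q).
  have ur : vge t 0%R u by rewrite -(subrK (K c) u); apply: vgeD (vge_const _ _); apply: vge_le uc.
  elim/poly_ind => [|r e IH]; first by rewrite rmorph0; exact: vge0.
  rewrite rmorphD rmorphM /= evFX evFC; apply: vgeD (vge_const _ _).
  by have := vgeM IH ur; rewrite addr0.
rewrite pq rmorphD rmorphM rmorphB /= evFC evFX evFC.
apply: ord_add_eq; first by rewrite ord_const.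
exact: vgeM (reg q) uc.
Qed.

Lemma vge_ev t u c p : vge t 0%R (u - K c)%R -> vge t 0%R (evF u p).
Proof.
move=> uc; have ur : vge t 0%R u by rewrite -(subrK (K c) u); apply: vgeD (vge_const _ _).
elim/poly_ind: p => [|r e IH]; first by rewrite rmorph0; exact: vge0.
rewrite rmorphD rmorphM /= evFX evFC; apply: vgeD (vge_const _ _).
by have := vgeM IH ur; rewrite addr0.
Qed.

Lemma ord_ev t u p (c : R[i]) k : ord t (u - K c)%R = k%:E -> (0 < k)%R -> p != 0%R ->
  exists (m : nat) q, [/\ p = (q * ('X - c%:P) ^+ m)%R, q.[c] != 0%R &
    ord t (evF u p) = (k * m%:Z)%R%:E].
Proof.
move=> uc k0 p0; have [m [q qc pq]] := multiplicity_XsubC p c.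
rewrite p0 /= in qc; exists m, q; split=> //.
rewrite pq rmorphM ordM rmorphXn rmorphB /= evFX evFC (ordX _ uc).
rewrite (@ord_ev_unit _ _ _ c) ?add0e //.
by apply: vge_le (vge_ord uc); rewrite -gtz0_ge1.
Qed.

Lemma unif_transc t u : uniformizer t u -> transc u.
Proof.
move=> tu; apply: transcP => p E; apply/eqP; apply: contrapT => /negP p0.
have uc : ord t (u - K 0%R)%R = 1%:E by rewrite rmorph0 subr0.
have [m [q [_ _]]] := ord_ev uc ltr01 p0.
by rewrite E ord0.
Qed.

(** A relation between a uniformizer u and g, freed of powers of u, reduces modulo u to a nonzero
    polynomial p with complex coefficients such that p(g) has positive order. As p splits, some
    factor g - c has positive order. *)
Lemma residue_exists (hC : irreducible_curve C) t g : vge t 0%R g ->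
  exists c, vge t 1%R (g - K c)%R.
Proof.
move=> g0; have [u tu] := ord_uniformizer t.
have tr := unif_transc (tu : uniformizer t u).
have [P0 P00 /rootP P0g] := algOver_poly tr (alg_all hC tr g).
(* After the swap u is the outer variable; dividing out its powers leaves a nonzero coefficient of
   index 0. *)
have [k [P Pk PE]] := multiplicity_XsubC (swapXY P0) 0%R.
rewrite swapXY_eq0 P00 /= subr0 in Pk PE.
have u0 : u != 0%R by apply: (@ord_inj_fin t _ 1%R).
have ug : vge t 0%R (g - K 0%R)%R by rewrite rmorph0 subr0.
have Pg : (map_poly (evF g) P).[u] = 0%R.
  have : (map_poly (evF g) (swapXY P0)).[u] = 0%R by rewrite ev_swap.
  rewrite PE rmorphM rmorphXn /= map_polyX !hornerE => /eqP.
  by rewrite mulf_eq0 expf_eq0 (negPf u0) andbF orbF => /eqP.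
pose p := P`_0; have p0 : p != 0%R by rewrite /p -horner_coef0.
have pg : vge t 1%R (evF g p).
  have /factor_theorem[Q QE] : root (P - p%:P)%R 0%R by rewrite /root !hornerE horner_coef0 subrr.
  have -> : evF g p = (- ((map_poly (evF g) Q).[u] * u))%R.
    have := Pg; rewrite -(subrK p%:P P) QE rmorphD rmorphM rmorphB /= !map_polyC map_polyX /= rmorph0.
    rewrite subr0 hornerD hornerM hornerX hornerC => E.
    by apply/eqP; rewrite -addr_eq0 addrC E.
  apply: vgeN; rewrite -[1%R]add0r; apply: vgeM; last exact: vge_ord.
  elim/poly_ind: Q {QE} => [|Q q IH]; first by rewrite rmorph0 horner0; exact: vge0.
  rewrite rmorphD rmorphM /= map_polyX map_polyC /= hornerMXaddC; apply: vgeD; last exact: vge_ev ug.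
  have := vgeM IH (vge_ord tu : vge t 1%R u); apply: vge_le; by rewrite addr_ge0.
have [l pl] := closed_field_poly_normal p.
apply: contrapT => no.
have nol c : ord t (g - K c)%R = 0.
  have := vgeB g0 (vge_const t c); rewrite /vge => h0.
  have h1 : ~ (0 < ord t (g - K c)%R) by move=> /vge1P h; apply: no; exists c.
  by apply/eqP; rewrite eq_le h0 andbT leNgt; apply/negP.
move: pg; rewrite pl -mul_polyC rmorphM rmorph_prod /= evFC /vge ordM ord_const ?lead_coef_eq0 // add0e.
suff -> : ord t (\prod_(i <- l) evF g ('X - i%:P)%R)%R = 0 by [].
elim: l {pl} => [|c l IH]; first by rewrite big_nil ord1.
by rewrite big_cons ordM IH adde0 rmorphB /= evFX evFC nol.
Qed.

End Places.

(** * Values of regular functions and reduction to a simple root *)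

Section Values.
Context (R : realType) (C : set (R[i] * R[i])) (F : functionField C)
  (hC : irreducible_curve C).
Implicit Types (t s : place F) (g h u x y v : F) (c d : R[i]) (k : int) (m n : nat).
Local Notation K := (ff_const F).

Lemma value_atE t g c : vge t 1 (g - K c) -> value_at t g = c.
Proof.
move=> gc; rewrite /value_at; set S := [set _ | _].
have hx0 : S (xget 0 S) by apply: (@xgetPex _ 0 S); exists c; exact/vge1P.
have {hx0} hx : vge t 1 (g - K (xget 0 S)) by exact/vge1P.
apply/eqP; rewrite -subr_eq0; apply: contrapT => /negP ne.
have := vgeB gc hx.
by rewrite opprB addrC addrA subrK -rmorphB /vge ord_const.
Qed.

Lemma valueP t g : vge t 0 g -> vge t 1 (g - K (value_at t g)).
Proof. by move=> /(residue_exists hC)[c gc]; rewrite (value_atE gc). Qed.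

Lemma value_const t c : value_at t (K c) = c.
Proof. by apply: value_atE; rewrite subrr; exact: vge0. Qed.

Lemma value_add t g h : vge t 0 g -> vge t 0 h -> value_at t (g + h) = value_at t g + value_at t h.
Proof.
move=> /valueP g1 /valueP h1; apply: value_atE.
by rewrite rmorphD opprD addrACA; exact: vgeD.
Qed.

Lemma value_mul t g h : vge t 0 g -> vge t 0 h -> value_at t (g * h) = value_at t g * value_at t h.
Proof.
move=> g0 h0; have g1 := valueP g0; have h1 := valueP h0; apply: value_atE.
set c := value_at t g in g1 *; set d := value_at t h in h1 *.
have -> : g * h - K (c * d) = (g - K c) * h + K c * (h - K d) by rewrite rmorphM; ring.
apply: vgeD; first by have := vgeM g1 h0; rewrite addr0.
by have := vgeM (vge_const t c) h1; rewrite add0r.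
Qed.

Lemma value_opp t g : vge t 0 g -> value_at t (- g) = - value_at t g.
Proof. by move=> /valueP g1; apply: value_atE; rewrite rmorphN -opprD; exact: vgeN. Qed.

Lemma value_sub t g h : vge t 0 g -> vge t 0 h -> value_at t (g - h) = value_at t g - value_at t h.
Proof. by move=> g0 h0; rewrite value_add ?value_opp //; exact: vgeN. Qed.

Lemma value_eq0 t g : vge t 0 g -> value_at t g = 0 <-> vge t 1 g.
Proof.
move=> g0; split=> [gv|g1]; last by apply: value_atE; rewrite rmorph0 subr0.
by have := valueP g0; rewrite gv rmorph0 subr0.
Qed.

Lemma value_neq0 t g : vge t 0 g -> value_at t g != 0 <-> ord t g = 0%E.
Proof.
move=> g0; split=> [gv|g1].
  have h1 : ~ vge t 1 g by move/(value_eq0 g0)/eqP; apply/negP.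
  apply/eqP; rewrite eq_le; apply/andP; split; last exact: g0.
  by rewrite leNgt; apply/negP => /vge1P.
apply/eqP => /(value_eq0 g0); rewrite /vge g1 lee_fin; by [].
Qed.

Lemma value_inv t g : ord t g = 0%E -> vge t 0 g^-1 /\ value_at t g^-1 = (value_at t g)^-1.
Proof.
move=> g0; have gi : vge t 0 g^-1 by rewrite /vge (ordV g0) oppr0.
have gr : vge t 0 g by exact: vge_ord.
split=> //; have := value_mul gr gi; rewrite mulfV; last exact: ord_inj_fin g0.
rewrite -(rmorph1 K) value_const => E.
have v0 : value_at t g != 0 by apply/value_neq0.
by apply: (mulfI v0); rewrite -E mulfV.
Qed.

Lemma value_exp t g n : vge t 0 g -> value_at t (g ^+ n) = value_at t g ^+ n.
Proof.
move=> g0; elim: n => [|n IH]; first by rewrite !expr0 -(rmorph1 K) value_const.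
by rewrite !exprS value_mul ?IH //; have := vgeX n g0; rewrite mul0r.
Qed.

Lemma vge_poly t u p : vge t 0 u -> vge t 0 (evF u p).
Proof. by move=> u0; apply: (@vge_ev _ _ _ _ _ 0); rewrite rmorph0 subr0. Qed.

Lemma vge_poly2 t u x (Q : {poly {poly R[i]}}) : vge t 0 u -> vge t 0 x ->
  vge t 0 (map_poly (evF u) Q).[x].
Proof.
move=> u0 x0; elim/poly_ind: Q => [|Q q IH]; first by rewrite rmorph0 horner0; exact: vge0.
rewrite rmorphD rmorphM /= map_polyX map_polyC /= hornerMXaddC.
by apply: vgeD; [have := vgeM IH x0; rewrite addr0|exact: vge_poly].
Qed.

Lemma vge_poly2_sub t u x y (Q : {poly {poly R[i]}}) n : vge t 0 u -> vge t 0 x -> vge t 0 y ->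
  vge t n%:Z (x - y) -> vge t n%:Z ((map_poly (evF u) Q).[x] - (map_poly (evF u) Q).[y]).
Proof.
move=> u0 x0 y0 xy; elim/poly_ind: Q => [|Q q IH].
  by rewrite rmorph0 !horner0 subr0; exact: vge0.
rewrite rmorphD rmorphM /= map_polyX map_polyC /= !hornerMXaddC.
set X := _.[x] in IH *; set Y := _.[y] in IH *.
have -> : X * x + evF u q - (Y * y + evF u q) = (X - Y) * x + Y * (x - y) by ring.
apply: vgeD; first by have := vgeM IH x0; rewrite addr0.
by have := vgeM (vge_poly2 Q u0 y0) xy; rewrite add0r.
Qed.

Lemma value_poly t u p : vge t 0 u -> value_at t (evF u p) = p.[value_at t u].
Proof.
move=> u0; elim/poly_ind: p => [|p c IH].
  by rewrite rmorph0 horner0 -(rmorph0 K) value_const.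
have p0 := vge_poly p u0.
rewrite rmorphD rmorphM /= evFX evFC hornerMXaddC value_add ?value_const ?value_mul ?IH //.
  by have := vgeM p0 u0; rewrite addr0.
exact: vge_const.
Qed.

Definition ev2 (Q : {poly {poly R[i]}}) (z w : R[i]) := (map_poly (horner_eval z) Q).[w].

Lemma ev2_MXaddC Q q z w : ev2 (Q * 'X + q%:P) z w = ev2 Q z w * w + q.[z].
Proof. by rewrite /ev2 rmorphD rmorphM /= map_polyX map_polyC /= hornerMXaddC. Qed.

Lemma value_poly2 t u x Q : vge t 0 u -> vge t 0 x ->
  value_at t (map_poly (evF u) Q).[x] = ev2 Q (value_at t u) (value_at t x).
Proof.
move=> u0 x0; elim/poly_ind: Q => [|Q q IH].
  by rewrite /ev2 !rmorph0 !horner0 -(rmorph0 K) value_const.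
have Q0 := vge_poly2 Q u0 x0; have q0 := vge_poly q u0.
rewrite rmorphD rmorphM /= map_polyX map_polyC /= hornerMXaddC ev2_MXaddC.
rewrite value_add ?value_mul ?IH ?value_poly //.
by have := vgeM Q0 x0; rewrite addr0.
Qed.

Lemma dvd_ev t u c k n p : ord t (u - K c) = k%:E -> 0 < k ->
  vge t (k * n%:Z) (evF u p) -> exists q, p = q * ('X - c%:P) ^+ n.
Proof.
move=> uc k0; have [->|p0] := eqVneq p 0; first by exists 0; rewrite mul0r.
have [m [q [-> _ oE]]] := ord_ev uc k0 p0.
rewrite /vge oE lee_fin ler_pM2l // lez_nat => nm.
by exists (q * ('X - c%:P) ^+ (m - n)); rewrite -mulrA -exprD subnK.
Qed.

(** Power series expansion in u: the next coefficient is the residue of the remainder divided by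
    u^n. *)
Lemma approx_exists t u x n : uniformizer t u -> vge t 0 x ->
  exists p : {poly R[i]}, vge t n%:Z (x - evF u p).
Proof.
move=> tu x0; have u1 : ord t u = 1%:E := tu.
elim: n => [|n [s hs]]; first by exists 0; rewrite (rmorph0 (evF u)) subr0.
have un : ord t (u ^+ n) = n%:Z%:E by rewrite (ordX n u1) mul1r.
have un0 := ord_inj_fin un.
have y0 : vge t 0 ((x - evF u s) / u ^+ n) by have := vge_div un hs; rewrite subrr.
have [c yc] := residue_exists hC y0.
exists (s + c%:P * 'X^n); rewrite rmorphD rmorphM rmorphXn /= evFC evFX.
have -> : x - (evF u s + K c * u ^+ n) = ((x - evF u s) / u ^+ n - K c) * u ^+ n.
  by rewrite mulrBl divfK // opprD addrA.
by have := vgeM yc (vge_ord un); rewrite intS.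
Qed.

(** A relation is differentiated until its derivative no longer vanishes at x. This ends, because in
    characteristic 0 a nonconstant polynomial has a nonzero derivative, and a nonzero constant does
    not vanish at x. *)
Lemma separable_relation u x : transc u ->
  exists P : {poly {poly R[i]}}, (map_poly (evF u) P).[x] = 0 /\ (map_poly (evF u) P^`()).[x] != 0.
Proof.
move=> tu; have [P0 P00 /rootP P0x] := algOver_poly tu (alg_all hC tu x).
elim: {P0}(size P0) {-2}P0 (leqnn (size P0)) P00 P0x => [|n IH] P sP P0 Px.
  by rewrite leqn0 size_poly_eq0 in sP; rewrite sP in P0.
have [dx|dx] := eqVneq (map_poly (evF u) P^`()).[x] 0; last by exists P.
have [s1|s1] := leqP (size P) 1.
  have PE := size1_polyC s1; move: Px; rewrite PE map_polyC /= hornerC => /eqP.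
  rewrite -(rmorph0 (evF u)) (inj_eq tu) => /eqP c0.
  by rewrite PE c0 eqxx in P0.
apply: (IH P^`()) => //; first by rewrite -ltnS; exact: leq_trans (lt_size_deriv P0) sP.
apply/eqP => /polyP /(_ (size P).-2); rewrite coef_deriv coef0.
rewrite prednK; last by case: (size P) s1 => [|[]].
move=> E; have lc : lead_coef P != 0 by rewrite lead_coef_eq0.
move: lc; rewrite -lead_coef_eq0; apply/negP; rewrite negbK.
have := congr1 (fun q : {poly R[i]} => q`_(size (lead_coef P)).-1) E.
rewrite coefMn coef0 => /eqP; rewrite mulrn_eq0.
case/orP => [/eqP E1|//]; by case: (size P) s1 E1 => [|[]].
Qed.

(** With e the order of the derivative at x, let s approximate x to order 2e + 1 and put x = s + u^e
    v. In the Taylor expansion of the relation at s divided by u^(2e), the constant coefficient is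
    still divisible by u, the linear one is nonzero at 0 and the others are polynomials in u: v is a
    simple root vanishing at t. *)
Lemma hensel_form t u x : uniformizer t u -> vge t 0 x ->
  exists (s : {poly R[i]}) (e : nat) (v : F) (P : {poly {poly R[i]}}),
  [/\ x = evF u s + u ^+ e * v, vge t 1 v & [/\ (map_poly (evF u) P).[v] = 0,
      (P`_0).[0] = 0 & (P`_1).[0] != 0]].
Proof.
move=> tu x0; have u1 : ord t u = 1%:E := tu.
have u0 : vge t 0 u by apply: vge_le (vge_ord u1).
have uc : ord t (u - K 0) = 1%:E by rewrite rmorph0 subr0.
have un0 := ord_inj_fin u1.
have [P [Px dPx]] := separable_relation x (unif_transc tu).
have [e' oe'] := ord_fin t dPx.
have e'0 : 0 <= e' by have := vge_poly2 P^`() u0 x0; rewrite /vge oe'.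
have [e ee] : exists e : nat, e' = e%:Z by exists `|e'|%N; rewrite gez0_abs.
rewrite {}ee {e' e'0} in oe'.
have [s hs] := approx_exists (2 * e).+1 tu x0.
have s0 := vge_poly s u0.
pose D j := (P^`N(j)).[s].
have Dev j : (map_poly (evF u) P)^`N(j).[evF u s] = evF u (D j).
  by rewrite nderivn_map horner_map.
pose v := (x - evF u s) / u ^+ e.
have oue : ord t (u ^+ e) = e%:Z%:E by rewrite (ordX e u1) mul1r.
have vE : x = evF u s + u ^+ e * v.
  by rewrite /v mulrCA mulfV ?expf_neq0 // mulr1 addrC subrK.
have v1 : vge t 1 v.
  by apply: vge_le (vge_div oue hs); lia.
have [U UE] : exists U, D 1%N = U * ('X - 0%:P) ^+ e /\ U.[0] != 0.
  have o1 : ord t (evF u (D 1%N)) = e%:Z%:E.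
    rewrite /D nderivn1 -horner_map /=.
    have -> : (map_poly (evF u) P^`()).[evF u s] = (map_poly (evF u) P^`()).[x] +
      ((map_poly (evF u) P^`()).[evF u s] - (map_poly (evF u) P^`()).[x]) by rewrite addrC subrK.
    apply: ord_add_eq => //; apply: vge_le (vge_poly2_sub _ u0 s0 x0 (n := (2 * e).+1) _); first lia.
    by rewrite -opprB; exact: vgeN.
  have D0 : D 1%N != 0.
    apply/negP => /eqP E; move: o1; rewrite E rmorph0 => /ord_inj_fin; by rewrite eqxx.
  have [m [q [qE q0 oq]]] := ord_ev uc ltr01 D0.
  exists q; split=> //; rewrite qE; congr (_ * _ ^+ _).
  by move: oq; rewrite o1 mul1r => -[].
have [A AE] : exists A, D 0%N = A * ('X - 0%:P) ^+ (2 * e).+1.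
  apply: (@dvd_ev t u 0 1 _ _ uc) => //; rewrite mul1r /D nderivn0 -horner_map /=.
  have -> : (map_poly (evF u) P).[evF u s] = (map_poly (evF u) P).[evF u s] - (map_poly (evF u) P).[x].
    by rewrite Px subr0.
  by apply: vge_poly2_sub => //; rewrite -opprB; exact: vgeN.
have {}UE := UE; rewrite subr0 in UE AE; have [{}UE U0] := UE.
(* The coefficients of P(s + u^e Y) / u^(2e): the j-th one is [D j] times u^(ej - 2e). *)
pose Q := \poly_(j < size P) (if j == 0%N then A * 'X else if j == 1%N then U
   else D j * 'X^(e * (j - 2))).
have sP : (1 < size P)%N.
  rewrite ltnNge; apply/negP => s1; have PE := size1_polyC s1.
  by move: dPx; rewrite PE derivC rmorph0 horner0 eqxx.
exists s, e, v, Q; split=> //; split.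
- have h : (map_poly (evF u) P).[evF u s + u ^+ e * v] = 0 by rewrite -vE.
  rewrite nderiv_taylor in h; last exact: mulrC.
  apply: (mulfI (_ : u ^+ (2 * e) != 0)); first by rewrite expf_neq0.
  rewrite mulr0 -h.
  have sQ : (size (map_poly (evF u) Q) <= size P)%N.
    exact: leq_trans (size_poly _ _) (size_poly _ _).
  rewrite (horner_coef_wide _ sQ) mulr_sumr.
  have -> : size (map_poly (evF u) P) = size P.
    by rewrite size_map_inj_poly ?rmorph0 //; exact: unif_transc tu.
  have EM (k : nat) : (u ^+ e * v) ^+ k = u ^+ (e * k) * v ^+ k by rewrite exprMn exprM.
  apply: eq_bigr => j _; rewrite Dev coef_map coef_poly ltn_ord EM.
  case: (nat_of_ord j) => [|[|k]] /=.
  + by rewrite AE !expr0 !mulr1 !rmorphM rmorphXn /= evFX muln0 expr0 mulr1 exprS; ring.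
  + by rewrite UE !expr1 !rmorphM rmorphXn /= evFX muln1 mul2n -addnn exprD; ring.
  + rewrite rmorphM rmorphXn /= evFX.
    have -> : (e * k.+2 = 2 * e + e * (k.+2 - 2))%N by rewrite subn2 /= [(2 * e)%N]mulnC -mulnDr.
    by rewrite exprD; ring.
- by rewrite coef_poly (ltn_trans _ sP) //= hornerM hornerX mulr0.
- by rewrite coef_poly sP.
Qed.

End Values.

(** * Analytic coordinates at a place *)

Section ImplicitFunction.
Context {R : realType}.
Implicit Types (z w y : R[i]) (e r x : R) (P Q : {poly {poly R[i]}}) (T : {poly R[i]}).

Lemma ev2_horner P T z : (P.[T]).[z] = ev2 P z T.[z].
Proof. by rewrite /ev2 -[in RHS]/(horner_eval z T) horner_map. Qed.

Lemma ev2_coef P z y n : (size P <= n)%N -> ev2 P z y = \sum_(i < n) (P`_i).[z] * y ^+ i.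
Proof.
move=> sP; rewrite /ev2 (@horner_coef_wide _ n); last exact: leq_trans (size_poly _ _) sP.
by apply: eq_bigr => i _; rewrite coef_map.
Qed.

(** The divided difference in the outer variable, in polynomial form so that it makes sense at y =
    w, where it is the derivative. *)
Definition divdiff P z y w := \sum_(i < size P) (P`_i).[z] * \sum_(j < i) y ^+ (i.-1 - j) * w ^+ j.

Lemma divdiffE P z y w : ev2 P z y - ev2 P z w = (y - w) * divdiff P z y w.
Proof.
rewrite !(@ev2_coef P z _ _ (leqnn _)) -sumrB mulr_sumr; apply: eq_bigr => i _.
by rewrite -mulrBr subrXX mulrCA; congr (_ * _); congr (_ * _); apply: eq_bigr => j _; rewrite subnS -subn1 subnAC subn1.
Qed.

Lemma divdiff_deriv P z y : divdiff P z y y = ev2 P^`() z y.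
Proof.
rewrite (@ev2_coef _ _ _ (size P)); last first.
  by have [->|/lt_size_deriv/ltnW//] := eqVneq P 0; rewrite deriv0.
rewrite /divdiff; case sP: (size P) => [|n]; first by rewrite !big_ord0.
rewrite big_ord_recl big_ord0 mulr0 add0r [RHS]big_ord_recr /= coef_deriv.
rewrite [P`_n.+1]nth_default ?sP // mul0rn horner0 mul0r addr0.
apply: eq_bigr => i _; rewrite coef_deriv hornerMn /bump /= add1n.
rewrite mulrnAl -mulrnAr; congr (_ * _).
rewrite -[in RHS](card_ord i.+1) -sumr_const; apply: eq_bigr => j _.
by rewrite add0n -exprD subnK // -ltnS.
Qed.

(** Two deviations are each held to a quarter of the linear coefficient at 0: the terms of degree at
    least 2 by the choice of d, the variation of the linear coefficient with z by the choice of
    r. *)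
Lemma divdiff_small P : (1 < size P)%N -> (P`_1).[0] != 0 ->
  exists d, [/\ 0 < d, d <= 1 & exists r, [/\ 0 < r, r <= 1 & forall z y w, nc z <= r -> nc y <= d -> nc w <= d ->
    nc (divdiff P z y w - (P`_1).[0]) <= nc (P`_1).[0] / 2]].
Proof.
move=> sP k0; set k := (P`_1).[0] in k0 *.
have k0' : 0 < nc k by rewrite nc_gt0.
have [B hB] : exists B : nat -> R, forall i, 0 <= B i /\ forall z, nc z <= 1 -> nc (P`_i).[z] <= B i.
  have [i|B hB] := @choice _ _ (fun i b => 0 <= b /\ forall z, nc z <= 1 -> nc (P`_i).[z] <= b).
    exact: poly_bounded.
  by exists B.
have [m sE] : exists m, size P = m.+2 by case: (size P) sP => [|[|m]] // _; exists m.
pose S := \sum_(i < m) B i.+2 * m.+2%:R.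
have S0 : 0 <= S by apply: sumr_ge0 => i _; rewrite mulr_ge0 //; have [] := hB i.+2.
have [L [L0 hL]] := @poly_lipschitz R P`_1 1 ler01.
pose d := Num.min 1 (nc k / (4 * (S + 1))).
pose r := Num.min 1 (nc k / (4 * (L + 1))).
have S4 : 0 < 4 * (S + 1) by rewrite mulr_gt0 // ltr_wpDl.
have L4 : 0 < 4 * (L + 1) by rewrite mulr_gt0 // ltr_wpDl.
have [d1 d2] : d <= 1 /\ d <= nc k / (4 * (S + 1)).
  by have := lexx d; rewrite {2}/d le_min => /andP[].
have [r1 r2] : r <= 1 /\ r <= nc k / (4 * (L + 1)).
  by have := lexx r; rewrite {2}/r le_min => /andP[].
have d0 : 0 < d by rewrite lt_min ltr01 divr_gt0.
have r0 : 0 < r by rewrite lt_min ltr01 divr_gt0.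
exists d; split=> //; exists r; split=> // z y w zr yd wd.
rewrite /divdiff sE big_ord_recl big_ord0 mulr0 add0r big_ord_recl /= big_ord1 /= expr0 expr0 !mulr1.
set X := \sum_(i < m) _.
have z1 : nc z <= 1 by exact: le_trans zr r1.
have Xb : nc X <= S * d.
  rewrite /X /S mulr_suml; apply: le_trans (nc_sum _ _ _) _; apply: ler_sum => i _.
  rewrite ncM -mulrA; apply: ler_pM; rewrite ?nc_ge0 //.
    by have [_] := hB i.+2; apply.
  apply: le_trans (nc_sum _ _ _) _; rewrite /bump /= !add1n.
  apply: le_trans (_ : _ <= \sum_(j < i.+2) d) _; last first.
    rewrite sumr_const card_ord -[d *+ _]mulr_natl ler_wpM2r ?(ltW d0) // ler_nat !ltnS; exact: ltnW.
  apply: ler_sum => j _; rewrite ncM !ncX.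
  have p1 (v : R[i]) n : nc v <= d -> nc v ^+ n <= 1.
    by move=> vd; rewrite exprn_ile1 ?nc_ge0 // (le_trans vd).
  have pd (v : R[i]) n : nc v <= d -> (0 < n)%N -> nc v ^+ n <= d.
    move=> vd; case: n => // n _; rewrite exprS -[leRHS]mulr1.
    by apply: ler_pM; rewrite ?nc_ge0 ?exprn_ge0 ?nc_ge0 ?p1.
  have [j0|j0] := posnP j.
    rewrite j0 expr0 mulr1; apply: pd => //.
  rewrite -[d]mul1r; apply: ler_pM; rewrite ?exprn_ge0 ?nc_ge0 ?p1 ?pd //.
have Lb : nc ((P`_1).[z] - k) <= L * r.
  apply: le_trans (hL z 0 z1 _) _; first by rewrite nc0.
  by rewrite subr0 ler_wpM2l.
rewrite ler_pdivlMr // in d2; rewrite ler_pdivlMr // in r2.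
have -> : (P`_1).[z] + X - k = ((P`_1).[z] - k) + X by ring.
apply: le_trans (ncD _ _) _; nra.
Qed.

(** Newton iteration with the slope frozen at k: the map y - P(z, y) / k contracts by 1/2, since the
    divided differences stay within |k| / 2 of k. Its iterates from 0 are polynomials in z, so the
    fixed point is analytic by construction; the contraction also gives uniqueness. *)
Lemma implicit_function P : (P`_0).[0] = 0 -> (P`_1).[0] != 0 ->
  exists d r f, [/\ 0 < d, 0 < r, holo r f,
    forall z, nc z <= r -> nc (f z) < d /\ ev2 P z (f z) = 0 &
    forall z, nc z <= r -> (forall y, nc y <= d -> ev2 P z y = 0 -> y = f z) /\
      ev2 P^`() z (f z) != 0].
Proof.
move=> P0 P1; have sP : (1 < size P)%N.
  by rewrite ltnNge; apply/negP => sP; rewrite nth_default ?horner0 ?eqxx in P1.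
have [d [d0 d1 [r1 [r10 r11 hdd]]]] := divdiff_small sP P1.
set k := (P`_1).[0] in P1 hdd; have k0 : 0 < nc k by rewrite nc_gt0.
have [L [L0 hL]] := @poly_lipschitz R P`_0 1 ler01.
pose r := Num.min r1 (nc k * d / (4 * (L + 1))).
have L4 : 0 < 4 * (L + 1) by rewrite mulr_gt0 // ltr_wpDl.
have r0 : 0 < r by rewrite lt_min r10 divr_gt0 // mulr_gt0.
have [rr1 rr2] : r <= r1 /\ r <= nc k * d / (4 * (L + 1)).
  by have := lexx r; rewrite {2}/r le_min => /andP[].
pose N z y := y - ev2 P z y / k.
have contr z y w : nc z <= r -> nc y <= d -> nc w <= d -> nc (N z y - N z w) <= nc (y - w) / 2.
  move=> zr yd wd; have -> : N z y - N z w = (y - w) * ((k - divdiff P z y w) / k).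
    have -> : (y - w) * ((k - divdiff P z y w) / k) = (y - w) - ((y - w) * divdiff P z y w) / k by field.
    by rewrite -divdiffE /N; field.
  rewrite ncM ler_wpM2l ?nc_ge0 // ncM ncV ler_pdivrMr // ncC mulrC.
  exact: hdd (le_trans zr rr1) yd wd.
have N0 z : nc z <= r -> nc (N z 0) <= d / 4.
  move=> zr; rewrite /N sub0r ncN ncM ncV (@ev2_coef P z 0 _ (leqnn _)).
  case sE: (size P) sP => [//|n] _; rewrite big_ord_recl expr0 mulr1 big1 ?addr0; last first.
    by move=> i _; rewrite expr0n /= mulr0.
  rewrite ler_pdivrMr //; have z1 : nc z <= 1 by apply: le_trans zr (le_trans rr1 r11).
  have := hL z 0 z1; rewrite nc0 => /(_ ler01); rewrite P0 !subr0 => h.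
  rewrite ler_pdivlMr // in rr2; apply: le_trans h _; nra.
pose v := fix v n := if n is n'.+1 then v n' - (k^-1)%:P * P.[v n'] else 0 : {poly R[i]}.
have vS n z : (v n.+1).[z] = N z (v n).[z].
  by rewrite /= !hornerE ev2_horner /N mulrC.
have p2 n : 0 < 2 ^+ n :> R by rewrite exprn_gt0.
have step n z : nc z <= r -> nc (v n).[z] <= d / 2 * (1 - (2 ^+ n)^-1) /\
    nc ((v n.+1).[z] - (v n).[z]) <= d / 4 / 2 ^+ n.
  move=> zr; elim: n => [|n [IH1 IH2]].
    by rewrite vS /= horner0 nc0 expr0 invr1 subrr mulr0 lexx subr0 mulr1; split=> //; exact: N0.
  have b1 : nc (v n.+1).[z] <= d / 2 * (1 - (2 ^+ n.+1)^-1).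
    apply: le_trans (nc_dist_le _ (v n).[z]) _.
    apply: le_trans (lerD IH1 IH2) _; apply: eqRle; rewrite exprS; field; exact: expf_neq0.
  have q2 m : 0 < (2 ^+ m : R)^-1 by rewrite invr_gt0.
  split=> //; rewrite [in X in nc X]vS [in X in nc (_ - X)]vS.
  apply: le_trans (contr _ _ _ zr _ _) _.
  - by apply: le_trans b1 _; have := q2 n.+1; nra.
  - by apply: le_trans IH1 _; have := q2 n; nra.
  apply: le_trans (_ : _ <= (d / 4 / 2 ^+ n) / 2) _; first by rewrite ler_pM2r ?invr_gt0.
  by apply: eqRle; rewrite exprS; field; exact: expf_neq0.
have [|f [hf lim]] := @holo_cauchy R r v (d / 4).
  by move=> n z zr; have [] := step n z zr.
have fb z : nc z <= r -> nc (f z) <= d / 2.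
  move=> zr; apply/ler_addgt0Pl => e e0.
  have [n hn] := @exp2_small R (4 * (d / 4)) e e0.
  apply: le_trans (nc_dist_le _ (v n).[z]) _; rewrite addrC lerD //.
    by rewrite ncC; apply: le_trans (lim n z zr) hn.
  have [b _] := step n z zr; apply: le_trans b _.
  have q0 : 0 < (2 ^+ n : R)^-1 by rewrite invr_gt0.
  nra.
have fb' z : nc z <= r -> nc (f z) < d.
  by move=> zr; apply: le_lt_trans (fb z zr) _; lra.
have root0 z : nc z <= r -> N z (f z) = f z.
  move=> zr; apply/eqP; rewrite -subr_eq0 -nc_eq0 eq_le nc_ge0 andbT.
  apply/ler_addgt0Pl => e e0; rewrite addr0.
  have [n hn] := @exp2_small R (2 * (4 * (d / 4))) e e0.
  apply: le_trans (nc_triangle _ _ (v n.+1).[z]) _.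
  have [b _] := step n z zr.
  have vd : nc (v n).[z] <= d.
    apply: le_trans b _; have : 0 < (2 ^+ n : R)^-1 by rewrite invr_gt0.
    nra.
  have := contr z (f z) (v n).[z] zr (ltW (fb' z zr)) vd; rewrite -vS => b1.
  have b2 := lim n z zr; have b3 := lim n.+1 z zr; rewrite ncC in b2.
  have h2 : 4 * (d / 4) / 2 ^+ n.+1 <= 4 * (d / 4) / 2 ^+ n.
    by rewrite ler_wpM2l ?mulr_ge0 ?(ltW d0) ?divr_ge0 ?(ltW d0) // lef_pV2 ?posrE // ler_eXn2l ?ltr1n.
  have h3 : 0 <= nc (f z - (v n).[z]) by exact: nc_ge0.
  rewrite -mulrA in hn; lra.
have solve z y : N z y = y -> ev2 P z y = 0.
  move=> /eqP; rewrite /N -subr_eq0 addrC addKr oppr_eq0 mulf_eq0 invr_eq0 (negPf P1) orbF.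
  by move/eqP.
exists d, r, f; split=> //.
  by move=> z zr; split; [exact: fb'|apply: solve; exact: root0].
move=> z zr; split=> [y yd y0|].
  apply/eqP; rewrite -subr_eq0 -nc_eq0 eq_le nc_ge0 andbT.
  have := contr z y (f z) zr yd (ltW (fb' z zr)).
  rewrite (root0 z zr) {1}/N y0 mul0r subr0; have := nc_ge0 (y - f z); lra.
rewrite -divdiff_deriv.
have := hdd z (f z) (f z) (le_trans zr rr1) (ltW (fb' z zr)) (ltW (fb' z zr)).
by apply: contraTneq => ->; rewrite sub0r ncN -ltNge ltr_pdivrMr // ltr_pMr // ltr1n.
Qed.

End ImplicitFunction.

Section PlaceTopology.
Context (R : realType) (C : set (R[i] * R[i])) (F : functionField C)
  (hC : irreducible_curve C).
Implicit Types (s t : place F) (g : F).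

Lemma place_eq s t : (forall g, ord s g = ord t g) -> s = t.
Proof.
case: s t => [v1 a1 b1 c1 d1 e1] [v2 a2 b2 c2 d2 e2] /= h.
have E : v1 = v2 by apply/funext.
subst v2; congr (Place _ _ _ _ _); exact: Prop_irrelevance.
Qed.

Lemma subbase_open g : open (place_subbase g).
Proof.
exists [set (place_subbase g)]; last by rewrite bigcup_set1.
by move=> _ ->; apply: finI_from1; exists g.
Qed.

Lemma cvg_place (T : Type) (Fil : set_system T) (FF : Filter Fil) (phi : T -> place F) s :
  (forall g, place_subbase g s -> \forall x \near Fil, place_subbase g (phi x)) ->
  phi @ Fil --> s.
Proof.
move=> h A; rewrite nbhsE => -[B [[D' D'sub BE] Bs] BA].
move: Bs; rewrite -BE => -[I D'I Is].
have [J Jsub IE] := D'sub I D'I.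
have near_all : Fil (\bigcap_(i in [set` J]) (phi @^-1` (i : set (place F)))).
  apply: filter_bigI => i iJ; have := Jsub i iJ; rewrite inE => -[g _ gE].
  have Js : (i : set (place F)) s by move: Is; rewrite -IE; apply.
  by move: Js; rewrite -gE; exact: h.
apply: (@filterS _ Fil _ _ _ _ near_all) => x hx; apply: BA; rewrite -BE; exists I => //.
have : (I : set (place F)) (phi x) by rewrite -IE => i iJ; exact: hx.
by [].
Qed.

(** The subbase is stated for radius 1 only; scaling [g] by the constant 1 / e reduces to it. *)
Lemma disc_open g (e : R) : 0 < e -> open [set s : place F | vge s 0 g /\ nc (value_at s g) < e].
Proof.
move=> e0; have ec0 : e%:C%C != 0 :> R[i] by rewrite -nc_gt0 nc_real gtr0_norm.
set c := ff_const F (e%:C%C)^-1.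
have c0 : c != 0 by rewrite /c fmorph_eq0 invr_eq0.
rewrite (_ : [set s | _] = place_subbase (c * g)); first exact: subbase_open.
have regE s : vge s 0 (c * g) <-> vge s 0 g.
  by rewrite /vge ordM ord_const ?add0e // invr_eq0.
apply/seteqP; split=> s /=.
  move=> [g0 ge]; split; first exact/regE.
  rewrite value_mul ?value_const //; last exact: vge_const.
  by rewrite ncM ncV nc_real gtr0_norm // mulrC ltr_pdivrMr // mul1r.
move=> [/regE g0]; rewrite value_mul ?value_const //; last exact: vge_const.
by rewrite ncM ncV nc_real gtr0_norm // mulrC ltr_pdivrMr // mul1r.
Qed.

End PlaceTopology.

Section VanishingOrder.
Context {R : realType}.
Implicit Types (p z : R[i]) (f g h : R[i] -> R[i]) (r B eta : R) (m n k : nat) (T : {poly R[i]}).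

(** Order of vanishing at [p], with a cofactor analytic on the whole disc, so that the orders at all
    points of the disc share one radius. *)
Definition vord r p f m := exists h, [/\ holo r h, h p != 0 &
  forall z, nc z < r -> f z = (z - p) ^+ m * h z].

Lemma holo_zero r h p B eta : nc p < r -> holo r h -> 0 < eta ->
  (forall z, nc z < r -> 0 < nc (z - p) <= eta -> nc (h z) <= B * nc (z - p)) -> h p = 0.
Proof.
move=> pr hh eta0 hb.
have d0 : 0 < Num.min eta ((r - nc p) / 2) by rewrite lt_min eta0 divr_gt0 // subr_gt0.
have [|k _ kE] := holo_vanish (m := 1) (B := B) hh pr d0.
  move=> z _ /andP[z0]; rewrite le_min expr1 => /andP[z1 z2]; apply: hb; last by rewrite z0.
  by have := nc_dist_le z p; lra.
by rewrite kE ?(ltW pr) // subrr expr1 mul0r.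
Qed.

Lemma vord_ge r p f m n B eta : nc p < r -> 0 < eta -> vord r p f m ->
  (forall z, nc z < r -> 0 < nc (z - p) <= eta -> nc (f z) <= B * nc (z - p) ^+ n) -> (n <= m)%N.
Proof.
move=> pr eta0 [h [hh hp hE]] fb; rewrite leqNgt; apply/negP => mn.
move: hp; rewrite (@holo_zero r h p `|B| (Num.min eta 1)) ?eqxx //; first by rewrite lt_min eta0 ltr01.
move=> z zr /andP[z0]; rewrite le_min => /andP[z1 z2].
have := fb z zr; rewrite z0 z1 hE // ncM ncX => /(_ isT).
rewrite -(subnK mn) exprD exprS mulrCA mulrA => le1.
have p0 : 0 < nc (z - p) ^+ m by rewrite exprn_gt0.
have e1 : nc (z - p) ^+ (n - m.+1) <= 1 by rewrite exprn_ile1 // ltW.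
have e2 : 0 <= nc (z - p) ^+ (n - m.+1) by rewrite exprn_ge0 // ltW.
have le2 : nc (z - p) ^+ m * nc (h z) <= nc (z - p) ^+ m * (B * nc (z - p) ^+ (n - m.+1) * nc (z - p)).
  by apply: le_trans le1 _; apply: eqRle; ring.
rewrite ler_pM2l // in le2; apply: le_trans le2 _; rewrite ler_wpM2r ?(ltW z0) //.
apply: le_trans (ler_norm _) _; rewrite normrM (ger0_norm e2) ler_piMr //.
Qed.

Lemma vord_bound r p f m : vord r p f m -> exists B, 0 <= B /\
  forall z, nc z < r -> nc (f z) <= B * nc (z - p) ^+ m.
Proof.
move=> [h [hh _ hE]]; have [B [B0 hB]] := holo_bounded hh.
exists B; split=> [|z zr]; first exact: ltW.
by rewrite hE // ncM ncX mulrC ler_wpM2r ?exprn_ge0 ?nc_ge0 // hB // ltW.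
Qed.

Lemma vord_unique r p f m n : nc p < r -> vord r p f m -> vord r p f n -> m = n.
Proof.
move=> pr hm hn; apply/eqP; rewrite eqn_leq; apply/andP; split.
  have [B [_ hB]] := vord_bound hm.
  by apply: (vord_ge pr ltr01 hn) => z zr _; exact: hB.
have [B [_ hB]] := vord_bound hn.
by apply: (vord_ge pr ltr01 hm) => z zr _; exact: hB.
Qed.

Lemma vord_mul r p f g m n : vord r p f m -> vord r p g n -> vord r p (fun z => f z * g z) (m + n).
Proof.
move=> [h [hh hp hE]] [k [hk kp kE]]; exists (fun z => h z * k z); split.
- exact: holo_mul.
- by rewrite mulf_neq0.
- by move=> z zr; rewrite hE // kE // exprD; ring.
Qed.

Lemma vord_ext r p f g m : (forall z, nc z < r -> f z = g z) -> vord r p f m -> vord r p g m.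
Proof. by move=> fg [h [hh hp hE]]; exists h; split=> // z zr; rewrite -fg ?hE. Qed.

Lemma pow_le_min x (m n : nat) : 0 <= x <= 1 -> (m <= n)%N -> x ^+ n <= x ^+ m :> R.
Proof.
move=> /andP[x0 x1] /subnK <-; rewrite exprD ler_piMl ?exprn_ge0 // exprn_ile1 //.
Qed.

Lemma vord_add r p f g m n k : nc p < r -> vord r p f m -> vord r p g n ->
  vord r p (fun z => f z + g z) k -> (minn m n <= k)%N.
Proof.
move=> pr hm hn hk.
have [B [B0 hB]] := vord_bound hm; have [D [D0 hD]] := vord_bound hn.
apply: (@vord_ge r p _ k _ (B + D) 1 pr ltr01 hk) => z zr /andP[z0 z1].
have z01 : 0 <= nc (z - p) <= 1 by rewrite ltW.
apply: le_trans (ncD _ _) _; rewrite mulrDl; apply: lerD.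
  by apply: le_trans (hB z zr) _; rewrite ler_wpM2l // pow_le_min // geq_minl.
by apply: le_trans (hD z zr) _; rewrite ler_wpM2l // pow_le_min // geq_minr.
Qed.

(** One divides by z - p as long as the cofactor vanishes at p. The flat alternative is excluded
    later, for elements of the field, by an algebraic relation. *)
Lemma vord_dichotomy r p f : holo r f -> nc p < r ->
  (exists m, vord r p f m) \/
  (forall m, exists2 h, holo r h & forall z, nc z < r -> f z = (z - p) ^+ m * h z).
Proof.
move=> hf pr; have [ex|nex] := pselect (exists m, vord r p f m); first by left.
right; elim=> [|m [h hh hE]]; first by exists f => // z _; rewrite expr0 mul1r.
have hp : h p = 0.
  by apply/eqP; apply: contrapT => /negP hp; apply: nex; exists m, h; split.
have [k hk kE] := holo_div hh pr; exists k => // z zr.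
by rewrite hE // kE ?(ltW zr) // hp add0r exprSr mulrA.
Qed.

Lemma poly_dvd_bound r T p B eta m : nc p < r -> 0 < eta ->
  (forall z, nc z < r -> 0 < nc (z - p) <= eta -> nc T.[z] <= B * nc (z - p) ^+ m) ->
  exists Q, T = Q * ('X - p%:P) ^+ m.
Proof.
move=> pr eta0; elim: m T => [|m IH] T hb; first by exists T; rewrite expr0 mulr1.
have /factor_theorem[Q QE] : root T p.
  apply/rootP; apply: (@holo_zero r (fun z => T.[z]) p `|B| (Num.min eta 1) pr (holo_poly _ _)).
    by rewrite lt_min eta0 ltr01.
  move=> z zr /andP[z0]; rewrite le_min => /andP[z1 z2].
  have := hb z zr; rewrite z0 z1 => /(_ isT) /le_trans; apply.
  rewrite exprSr mulrA ler_wpM2r ?(ltW z0) // (le_trans (ler_norm _)) // normrM.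
  have e2 : 0 <= nc (z - p) ^+ m by rewrite exprn_ge0 // ltW.
  by rewrite (ger0_norm e2) ler_piMr // exprn_ile1 // ltW.
have [|Q' Q'E] := IH Q; last by exists Q'; rewrite QE Q'E exprSr mulrA.
move=> z zr z01; have /andP[z0 _] := z01; have := hb z zr z01.
by rewrite QE hornerM hornerXsubC ncM exprSr mulrA ler_pM2r.
Qed.

End VanishingOrder.

(** * The places along an analytic branch *)

Section PuiseuxPlaces.
Context (R : realType) (C : set (R[i] * R[i])) (F : functionField C)
  (hC : irreducible_curve C).
Implicit Types (s t : place F) (g x y v w : F) (c p z : R[i]) (f h : R[i] -> R[i]) (m n : nat).
Local Notation K := (ff_const F).

Context (t0 : place F) (u : F) (tu : uniformizer t0 u) (r : R) (r0 : 0 < r).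
Context (v1 v2 : F) (P1 P2 : {poly {poly R[i]}}) (d1 d2 : R) (f1 f2 : R[i] -> R[i]).

(** The last clauses are the output of [implicit_function]: in the closed disc of radius [d] the
    relation has [f z] as its only root, and this root is simple. Uniqueness is what recovers the
    value of v at an arbitrary nearby place. *)
Definition branch v (P : {poly {poly R[i]}}) (d : R) f : Prop :=
  [/\ vge t0 1 v, (map_poly (evF u) P).[v] = 0, 0 < d, holo r f &
   (forall z, nc z <= r -> nc (f z) < d /\ ev2 P z (f z) = 0) /\
   (forall z, nc z <= r -> (forall y : R[i], nc y <= d -> ev2 P z y = 0 -> y = f z) /\
      ev2 P^`() z (f z) != 0)].

Context (br1 : branch v1 P1 d1 f1) (br2 : branch v2 P2 d2 f2).

(* [An x f]: on the branch through [t0], the function [x] is given by [f] in the coordinate [u].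
   Only [v1] and [v2] are needed besides [u], since [ff_a F] and [ff_b F] are quotients of such
   elements. *)
Inductive An : F -> (R[i] -> R[i]) -> Prop :=
| An_const c : An (K c) (fun=> c)
| An_u : An u id
| An_1 : An v1 f1
| An_2 : An v2 f2
| An_add x y f h : An x f -> An y h -> An (x + y) (fun z => f z + h z)
| An_mul x y f h : An x f -> An y h -> An (x * y) (fun z => f z * h z).

Definition fracAn g := exists x y f h, [/\ An x f, An y h, y != 0 & g = x / y].

Lemma An_opp x f : An x f -> An (- x) (fun z => - f z).
Proof.
move=> h; have := An_mul (An_const (-1)) h; rewrite rmorphN1 mulN1r.
by have -> : (fun z => -1 * f z) = (fun z => - f z) by apply/funext => z; rewrite mulN1r.
Qed.

Lemma An_sub x y f h : An x f -> An y h -> An (x - y) (fun z => f z - h z).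
Proof. by move=> a /An_opp; exact: An_add. Qed.

Lemma An_poly x f (q : {poly R[i]}) : An x f -> An (evF x q) (fun z => q.[f z]).
Proof.
move=> h; elim/poly_ind: q => [|q c IH].
  have := An_const 0; rewrite !rmorph0.
  by have -> : (fun z => (0 : {poly R[i]}).[f z]) = fun=> 0 by apply/funext => z; rewrite horner0.
rewrite rmorphD rmorphM /= evFX evFC; have := An_add (An_mul IH h) (An_const c).
by under eq_fun do rewrite -hornerMXaddC.
Qed.

Lemma An_poly2 x f (Q : {poly {poly R[i]}}) : An x f ->
  An (map_poly (evF u) Q).[x] (fun z => ev2 Q z (f z)).
Proof.
move=> h; elim/poly_ind: Q => [|Q q IH].
  have := An_const 0; rewrite !rmorph0 horner0.
  by have -> : (fun z => ev2 0 z (f z)) = fun=> 0 by apply/funext => z; rewrite /ev2 rmorph0 horner0.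
rewrite rmorphD rmorphM /= map_polyX map_polyC /= hornerMXaddC.
have := An_add (An_mul IH h) (An_poly q An_u).
by have -> : (fun z => ev2 (Q * 'X + q%:P) z (f z)) = (fun z => ev2 Q z (f z) * f z + q.[z])
  by apply/funext => z; rewrite ev2_MXaddC.
Qed.

Lemma An_holo x f : An x f -> holo r f.
Proof.
elim=> [c| | | |x' y f' h _ hf _ hh|x' y f' h _ hf _ hh].
- exact: holo_cst.
- exact: holo_id.
- by case: br1.
- by case: br2.
- exact: holo_add.
- exact: holo_mul.
Qed.

(** An open condition meant to describe the disc around [t0]. The bounds [d1] and [d2] single out
    the branch among the places with a given value of u. *)
Definition good s := [/\ vge s 0 u, nc (value_at s u) < r,
  vge s 0 v1 /\ nc (value_at s v1) < d1 & vge s 0 v2 /\ nc (value_at s v2) < d2].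

Lemma good_t0 : good t0.
Proof.
have zero x d : 0 < d -> vge t0 1 x -> vge t0 0 x /\ nc (value_at t0 x) < d.
  move=> d0 x1; have x0 : vge t0 0 x by apply: vge_le x1.
  by split=> //; have /(value_eq0 hC x0) -> := x1; rewrite nc0.
have [u0 ur] := zero u r r0 (vge_ord tu).
by case: br1 br2 => [a1 _ a2 _ _] [b1 _ b2 _ _]; split=> //; exact: zero.
Qed.

Lemma value_u_t0 : value_at t0 u = 0.
Proof.
have u1 : vge t0 1 u := vge_ord tu.
by apply/(value_eq0 hC _) => //; apply: vge_le u1.
Qed.

(* [x] and [f] have the same Taylor polynomials in [u - p] at [s] and in [z - p] at [p]. *)
Definition taylor s p x f := forall m, exists (T : {poly R[i]}) w (B : R),
  [/\ vge s 0 w, x = evF u T + (u - K p) ^+ m * w, 0 <= B &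
   forall z, nc z <= r -> nc (f z - T.[z]) <= B * nc (z - p) ^+ m].

(** By uniqueness of the root, v has the value f p at s. For a Taylor polynomial T of f at p, write
    P = Q (X - T) + P(T), where P(T) is divisible by (u - p)^m. At s the value of Q(v) is the
    derivative at a simple root, so Q(v) is a unit and v - T is divisible by (u - p)^m. *)
Lemma taylor_branch s p v P d f : vge s 0 u -> p = value_at s u -> nc p < r ->
  vge s 0 v -> nc (value_at s v) < d -> branch v P d f -> taylor s p v f.
Proof.
move=> u0 pE pr v0 vd [_ Pv d0 hf [fz fu]] m.
have vf : value_at s v = f p.
  have [uni _] := fu p (ltW pr); apply: uni; first exact: ltW.
  have := value_poly2 hC P u0 v0; rewrite Pv -pE => <-.
  by have := value_const s (0 : R[i]); rewrite rmorph0.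
case: m => [|m].
  have [B [B0 hB]] := holo_bounded hf.
  exists 0, v, B; split=> //.
  - by rewrite rmorph0 add0r expr0 mul1r.
  - exact: ltW.
  - by move=> z zr; rewrite horner0 subr0 expr0 mulr1; exact: hB.
have [T [h [hh hE]]] := holo_taylor m.+1 hf pr.
have Tp : T.[p] = f p by rewrite hE ?(ltW pr) // subrr expr0n mul0r addr0.
have [B [B0 hB]] := holo_bounded hh.
have fT z : nc z <= r -> nc (f z - T.[z]) <= B * nc (z - p) ^+ m.+1.
  by move=> zr; rewrite hE // addrC addKr ncM ncX mulrC ler_wpM2r ?exprn_ge0 ?nc_ge0 ?hB.
have /factor_theorem[Q QE] : root (P - (P.[T])%:P) T by rewrite /root !hornerE subrr.
have PE : P = Q * ('X - T%:P) + (P.[T])%:P by rewrite -QE subrK.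
have evPE z (y : R[i]) : ev2 P z y = ev2 Q z y * (y - T.[z]) + (P.[T]).[z].
  rewrite {1}PE /ev2 rmorphD rmorphM rmorphB /= map_polyX !map_polyC /=.
  by rewrite !hornerE.
have [D DE] : exists D, P.[T] = D * ('X - p%:P) ^+ m.+1.
  have [A [A0 hA]] : exists A : R, 0 < A /\ forall z, nc z <= r -> nc (ev2 Q z (f z)) <= A.
    have hq : holo r (fun z => ev2 Q z (f z)).
      have E z : nc z <= r -> \sum_(i < size Q) (Q`_i).[z] * f z ^+ i = ev2 Q z (f z).
        by move=> _; rewrite (@ev2_coef R Q z (f z) _ (leqnn _)).
      apply: holo_ext E _; apply: (@holo_sum _ _ _ (fun i z => (Q`_i).[z] * f z ^+ i)) => i.
      by apply: holo_mul (holo_poly _ _) (holo_exp _ hf).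
    exact: holo_bounded hq.
  apply: (@poly_dvd_bound R r _ p (A * B) 1 _ pr ltr01) => z zr _.
  have [_ Pz] := fz z (ltW zr).
  have -> : (P.[T]).[z] = - (ev2 Q z (f z) * (f z - T.[z])).
    by apply/eqP; rewrite -addr_eq0 addrC -evPE Pz.
  rewrite ncN ncM -mulrA; apply: ler_pM; rewrite ?nc_ge0 ?hA ?fT //; exact: ltW.
have Qv0 : ord s (map_poly (evF u) Q).[v] = 0%E.
  apply/(value_neq0 hC (vge_poly2 Q u0 v0)); rewrite (value_poly2 hC) // -pE vf.
  have [_] := fu p (ltW pr).
  have -> : P^`() = Q^`() * ('X - T%:P) + Q.
    by rewrite {1}PE derivD derivM derivB derivX !derivC subr0 mulr1 addr0.
  rewrite /ev2 rmorphD rmorphM rmorphB /= map_polyX map_polyC /=.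
  have -> : horner_eval p T = f p by exact: Tp.
  by rewrite !hornerE subrr mulr0 add0r.
exists T, (- evF u D / (map_poly (evF u) Q).[v]), B; split=> //.
- rewrite mulNr; apply: vgeN; rewrite -[0]subr0; apply: vge_div Qv0 _; exact: vge_poly.
- have Qn := ord_inj_fin Qv0.
  have : (map_poly (evF u) Q).[v] * (v - evF u T) + evF u D * (u - K p) ^+ m.+1 = 0.
    rewrite -Pv {1}PE rmorphD rmorphM rmorphB /= map_polyX !map_polyC /= DE rmorphM rmorphXn rmorphB /= evFX evFC.
    by rewrite !hornerE.
  set q := _.[v] in Qn *; move=> E; apply: (mulfI Qn); apply/eqP; rewrite -subr_eq0 -E; apply/eqP; field.
  exact: Qn.
- exact: ltW.
Qed.

Lemma taylor_An s p x f : good s -> p = value_at s u -> An x f -> taylor s p x f.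
Proof.
move=> [u0 pr [a1 a2] [b1 b2]] pE; rewrite -pE in pr.
have up0 : vge s 0 (u - K p) by apply: vgeB => //; exact: vge_const.
elim=> [c| | | |x' y f' h _ IH1 _ IH2|x' y f' h _ IH1 hy IH2] m.
- exists c%:P, 0, 0; split=> //; first exact: vge0.
    by rewrite evFC mulr0 addr0.
  by move=> z _; rewrite hornerC subrr nc0 mul0r.
- exists 'X, 0, 0; split=> //; first exact: vge0.
    by rewrite evFX mulr0 addr0.
  by move=> z _; rewrite hornerX subrr nc0 mul0r.
- exact: taylor_branch u0 pE pr a1 a2 br1 m.
- exact: taylor_branch u0 pE pr b1 b2 br2 m.
- have [T [w [B [w0 xE B0 fB]]]] := IH1 m; have [S [e [D [e0 yE D0 hD]]]] := IH2 m.
  exists (T + S), (w + e), (B + D); split=> //; last 2 first.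
  + exact: addr_ge0.
  + move=> z zr; rewrite hornerD opprD addrACA mulrDl; apply: le_trans (ncD _ _) _.
    by rewrite lerD ?fB ?hD.
  + exact: vgeD.
  + by rewrite xE yE rmorphD; ring.
- have [T [w [B [w0 xE B0 fB]]]] := IH1 m; have [S [e [D [e0 yE D0 hD]]]] := IH2 m.
  have [A [A0 hA]] := poly_bounded T r; have [G [G0 hG]] := holo_bounded (An_holo hy).
  have T0 := vge_poly T u0; have S0 := vge_poly S u0.
  have y0 : vge s 0 y.
    rewrite yE; apply: vgeD => //; rewrite -[0]addr0; apply: vgeM => //.
    by have := vgeX m up0; rewrite mul0r.
  exists (T * S), (evF u T * e + w * y), (A * D + B * G); split=> //; last 2 first.
  + by rewrite addr_ge0 // mulr_ge0 // ltW.
  + move=> z zr; rewrite hornerM.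
    have -> : f' z * h z - T.[z] * S.[z] = T.[z] * (h z - S.[z]) + (f' z - T.[z]) * h z by ring.
    apply: le_trans (ncD _ _) _; rewrite !ncM mulrDl; apply: lerD.
      by rewrite -mulrA; apply: ler_pM; rewrite ?nc_ge0 ?hA ?hD.
    by rewrite mulrAC; apply: ler_pM; rewrite ?nc_ge0 ?hG ?fB.
  + apply: vgeD; rewrite -[0]addr0; exact: vgeM.
  + by rewrite {1}xE rmorphM mulrDl {1}yE; ring.
Qed.

(** At [t0] the Taylor polynomials of 0 are divisible by all powers of u, so a function representing
    0 is flat at 0 and vanishes. Hence the function that [An] attaches to an element does not depend
    on the expression chosen. *)
Lemma An0 f : An 0 f -> forall z, nc z < r -> f z = 0.
Proof.
move=> h; apply: (holo_identity (An_holo h)) => m.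
have [T [w [B [w0 E B0 fB]]]] := taylor_An good_t0 (esym value_u_t0) h m.
have uc : ord t0 (u - K 0) = 1%:E by rewrite rmorph0 subr0.
have u1 : vge t0 1 (u - K 0) by exact: vge_ord.
have Tm : vge t0 (1 * m%:Z) (evF u T).
  have -> : evF u T = - ((u - K 0) ^+ m * w) by apply/eqP; rewrite -addr_eq0 -E.
  by apply: vgeN; rewrite -[1 * _]addr0; apply: vgeM => //; exact: vgeX.
have [Q QE] := dvd_ev uc ltr01 Tm.
have [A [A0 hA]] := poly_bounded Q r.
exists (B + A) => z zr; have := fB z zr; rewrite !subr0 => b.
apply: le_trans (nc_dist_le _ T.[z]) _; rewrite mulrDl addrC lerD //.
by rewrite QE subr0 hornerM hornerXn ncM ncX ler_wpM2r ?exprn_ge0 ?nc_ge0 ?hA.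
Qed.

Lemma An_fun x f h : An x f -> An x h -> forall z, nc z < r -> f z = h z.
Proof.
move=> a b z zr; have := An_sub a b; rewrite subrr => /An0/(_ z zr)/eqP.
by rewrite subr_eq0 => /eqP.
Qed.

(** A relation between u and x with nonzero constant coefficient b(u) reads b = - S(u, x) x. If f
    were divisible by all powers of z - p, so would be the nonzero polynomial b. *)
Lemma An_vord p x f : nc p < r -> An x f -> x != 0 -> exists m, vord r p f m.
Proof.
move=> pr xf x0; have tr := unif_transc tu.
have [//|div] := vord_dichotomy (An_holo xf) pr.
have [Q0 Q00 /rootP Q0x] := algOver_poly tr (alg_all hC tr x).
have [k [Q Qk QE]] := multiplicity_XsubC Q0 0.
rewrite Q00 /= subr0 in Qk QE.
have Qx : (map_poly (evF u) Q).[x] = 0.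
  move: Q0x; rewrite QE rmorphM rmorphXn /= map_polyX !hornerE => /eqP.
  by rewrite mulf_eq0 expf_eq0 (negPf x0) andbF orbF => /eqP.
have b0 : Q`_0 != 0 by rewrite -horner_coef0.
have /factor_theorem[S SE] : root (Q - (Q`_0)%:P) 0 by rewrite /root !hornerE horner_coef0 subrr.
rewrite subr0 in SE.
have hS := An_holo (An_poly2 S xf); have [B [B0 hB]] := holo_bounded hS.
have bE z : nc z < r -> (Q`_0).[z] = - (ev2 S z (f z) * f z).
  move=> zr; have := An_poly2 Q xf; rewrite Qx => /An0/(_ z zr).
  rewrite -(subrK (Q`_0)%:P Q) SE ev2_MXaddC => /eqP.
  rewrite coefD coefMX coefC /= add0r addrC addr_eq0 => /eqP ->; by [].
have [h hh hE] := div (size Q`_0); have [D [D0 hD]] := holo_bounded hh.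
have [|S' S'E] := @poly_dvd_bound R r Q`_0 p (B * D) 1 (size Q`_0) pr ltr01.
  move=> z zr _; rewrite bE // ncN ncM [in X in _ * X]hE // ncM ncX mulrCA -[leRHS]mulrC.
  by rewrite ler_wpM2l ?exprn_ge0 ?nc_ge0 //; apply: ler_pM; rewrite ?nc_ge0 ?hB ?hD ?ltW.
have S'0 : S' != 0 by apply: contraNneq b0 => E; rewrite S'E E mul0r.
have : (size (Q`_0)%R < size (Q`_0)%R)%N.
  rewrite {2}S'E size_Mmonic ?monic_exp ?monicXsubC // size_exp_XsubC addnS /=.
  by rewrite -[X in (X < _)%N]add0n ltn_add2r size_poly_gt0.
by rewrite ltnn.
Qed.

Lemma u_neq_const p : u - K p != 0.
Proof.
apply/negP; rewrite subr_eq0 => /eqP E; move: tu; rewrite /uniformizer E.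
by have [->|p0] := eqVneq p 0; rewrite ?rmorph0 ?ord0 // ord_const.
Qed.

Lemma u_neq0 : u != 0.
Proof. by have := u_neq_const 0; rewrite rmorph0 subr0. Qed.

Lemma fracAn_An x f : An x f -> fracAn x.
Proof.
move=> h; exists x, 1, f, (fun=> 1); split=> //; rewrite ?oner_eq0 ?divr1 //.
by have := An_const 1; rewrite rmorph1.
Qed.

Lemma fracAnD x y : fracAn x -> fracAn y -> fracAn (x + y).
Proof.
move=> [a [b [fa [fb [ha hb b0 ->]]]]] [c [d [fc [fd [hc hd d0 ->]]]]].
exists (a * d + c * b), (b * d), (fun z => fa z * fd z + fc z * fb z), (fun z => fb z * fd z).
split; [exact: An_add (An_mul ha hd) (An_mul hc hb)|exact: An_mul|exact: mulf_neq0|].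
by field; rewrite ?b0 ?d0.
Qed.

Lemma fracAnM x y : fracAn x -> fracAn y -> fracAn (x * y).
Proof.
move=> [a [b [fa [fb [ha hb b0 ->]]]]] [c [d [fc [fd [hc hd d0 ->]]]]].
exists (a * c), (b * d), (fun z => fa z * fc z), (fun z => fb z * fd z).
split; [exact: An_mul|exact: An_mul|exact: mulf_neq0|].
by field; rewrite ?b0 ?d0.
Qed.

Lemma fracAnV x : fracAn x -> fracAn x^-1.
Proof.
have [->|x0] := eqVneq x 0; first by rewrite invr0.
move=> [a [b [fa [fb [ha hb b0 E]]]]]; exists b, a, fb, fa; split=> //.
  by apply: contraNneq x0 => a0; rewrite E a0 mul0r.
by rewrite E invf_div.
Qed.

Context (gen_a : fracAn (ff_a F)) (gen_b : fracAn (ff_b F)).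

Lemma fracAn_all g : fracAn g.
Proof.
have base (q : {poly R[i]}) : fracAn (map_poly K q).[ff_a F].
  elim/poly_ind: q => [|q c IH].
    by rewrite rmorph0 horner0 -(rmorph0 K); exact: fracAn_An (An_const 0).
  rewrite rmorphD rmorphM /= map_polyX map_polyC /= hornerMXaddC.
  exact: fracAnD (fracAnM IH gen_a) (fracAn_An (An_const c)).
have ev (P : {poly {poly R[i]}}) : fracAn (ff_eval F P).
  rewrite /ff_eval /eval2; elim/poly_ind: P => [|P q IH].
    by rewrite rmorph0 !horner0 -(rmorph0 K); exact: fracAn_An (An_const 0).
  rewrite rmorphD rmorphM /= map_polyX map_polyC /= hornerMXaddC hornerD hornerM hornerC.
  exact: fracAnD (fracAnM IH gen_b) (base q).
by have [P [Q [_ ->]]] := ff_gen g; exact: fracAnM (ev P) (fracAnV (ev Q)).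
Qed.

Definition frac_order p g (k : int) := exists x y f h m n,
  [/\ An x f /\ An y h, x != 0 /\ y != 0, g = x / y, vord r p f m /\ vord r p h n & k = m%:Z - n%:Z].

Lemma frac_order_fun p g k k' : nc p < r -> frac_order p g k -> frac_order p g k' -> k = k'.
Proof.
move=> pr [x [y [f [h [m [n [[xf yh] [x0 y0] -> [fm hn] ->]]]]]]].
move=> [x' [y' [f' [h' [m' [n' [[xf' yh'] [x0' y0'] /eqP E [fm' hn'] ->]]]]]]].
move: E; rewrite eqr_div // => /eqP E.
have a1 := An_mul xf yh'; have a2 := An_mul xf' yh; rewrite -E in a2.
have o1 := vord_ext (An_fun a1 a2) (vord_mul fm hn').
have := vord_unique pr o1 (vord_mul fm' hn); lia.
Qed.

Lemma frac_order_ex p g : nc p < r -> g != 0 -> exists k, frac_order p g k.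
Proof.
move=> pr g0; have [x [y [f [h [xf yh y0 E]]]]] := fracAn_all g.
have x0 : x != 0 by apply: contraNneq g0 => x0; rewrite E x0 mul0r.
have [m fm] := An_vord pr xf x0; have [n hn] := An_vord pr yh y0.
by exists (m%:Z - n%:Z), x, y, f, h, m, n.
Qed.

Lemma frac_orderM p g g' k k' : frac_order p g k -> frac_order p g' k' ->
  frac_order p (g * g') (k + k').
Proof.
move=> [x [y [f [h [m [n [[xf yh] [x0 y0] -> [fm hn] ->]]]]]]].
move=> [x' [y' [f' [h' [m' [n' [[xf' yh'] [x0' y0'] -> [fm' hn'] ->]]]]]]].
exists (x * x'), (y * y'), (fun z => f z * f' z), (fun z => h z * h' z), (m + m')%N, (n + n')%N.
split; [by split; exact: An_mul|by rewrite !mulf_neq0| |by split; exact: vord_mul|lia].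
by field; rewrite ?y0 ?y0'.
Qed.

Lemma frac_orderD p g g' k k' l : nc p < r -> frac_order p g k -> frac_order p g' k' ->
  frac_order p (g + g') l -> Num.min k k' <= l.
Proof.
move=> pr [x [y [f [h [m [n [[xf yh] [x0 y0] gE [fm hn] ->]]]]]]].
move=> [x' [y' [f' [h' [m' [n' [[xf' yh'] [x0' y0'] gE' [fm' hn'] ->]]]]]]] hl.
have g0 : g + g' != 0.
  move: hl => [a [b [? [? [? [? [_ [a0 b0] -> _ _]]]]]]].
  by rewrite mulf_neq0 // invr_eq0.
have xy := An_add (An_mul xf yh') (An_mul xf' yh).
have E : g + g' = (x * y' + x' * y) / (y * y') by rewrite gE gE'; field; rewrite ?y0 ?y0'.
have s0 : x * y' + x' * y != 0 by apply: contraNneq g0 => s0; rewrite E s0 mul0r.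
have [j hj] := An_vord pr xy s0.
have lE : l = j%:Z - (n + n')%:Z.
  apply: frac_order_fun pr hl _; exists (x * y' + x' * y), (y * y').
  exists (fun z => f z * h' z + f' z * h z), (fun z => h z * h' z), j, (n + n')%N.
  by split=> //; [split=> //; exact: An_mul|rewrite mulf_neq0|split=> //; exact: vord_mul].
have := vord_add pr (vord_mul fm hn') (vord_mul fm' hn) hj.
rewrite lE; lia.
Qed.

Lemma frac_order_An p x f m : An x f -> x != 0 -> vord r p f m -> frac_order p x m%:Z.
Proof.
move=> xf x0 fm; exists x, 1, f, (fun=> 1), m, 0%N; split=> //.
- by split=> //; have := An_const 1; rewrite rmorph1.
- by rewrite oner_eq0.
- by rewrite divr1.
- split=> //; exists (fun=> 1); split; [exact: holo_cst|exact: oner_neq0|].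
  by move=> z _; rewrite expr0 mulr1.
- by rewrite subr0.
Qed.

Definition order_at p g : \bar int :=
  if g == 0 then +oo%E else (xget 0 [set k | frac_order p g k])%:E.

Lemma order_atE p g k : nc p < r -> frac_order p g k -> order_at p g = k%:E.
Proof.
move=> pr gk; rewrite /order_at; case: ifPn => [/eqP g0|_].
  move: gk => [x [y [? [? [? [? [_ [x0 y0] gE _ _]]]]]]].
  by have : x / y != 0; [rewrite mulf_neq0 // invr_eq0|rewrite -gE g0 eqxx].
congr EFin; apply: (frac_order_fun pr _ gk).
by apply: (@xgetPex _ 0 [set k | frac_order p g k]); exists k.
Qed.

Lemma vord_const p c : c != 0 -> vord r p (fun=> c) 0.
Proof.
by move=> c0; exists (fun=> c); split=> //; [exact: holo_cst|move=> z _; rewrite expr0 mul1r].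
Qed.

(** Vanishing order at p along the branch is a valuation trivial on constants, normalized because u
    - p has order 1. *)
Lemma place_at p : nc p < r -> exists s : place F, ord s = order_at p.
Proof.
move=> pr; have key g : g != 0 -> exists2 k, frac_order p g k & order_at p g = k%:E.
  by move=> /(frac_order_ex pr)[k gk]; exists k => //; exact: order_atE.
have o0 : order_at p 0 = +oo%E by rewrite /order_at eqxx.
have e1 g : order_at p g = +oo%E <-> g = 0.
  split=> [|->] //; have [//|/key[k _ ->]] := eqVneq g 0; by [].
have e2 g w : order_at p (g * w) = (order_at p g + order_at p w)%E.
  have [->|g0] := eqVneq g 0; have [->|w0] := eqVneq w 0; rewrite ?mul0r ?mulr0 ?o0 //.
  - by have [k _ ->] := key w w0.
  - by have [k _ ->] := key g g0.
  - have [k gk ->] := key g g0; have [l hl ->] := key w w0.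
    by rewrite (order_atE pr (frac_orderM gk hl)) EFinD.
have e3 g w : (Order.min (order_at p g) (order_at p w) <= order_at p (g + w))%E.
  have [->|g0] := eqVneq g 0; first by rewrite add0r ge_min lexx orbT.
  have [->|w0] := eqVneq w 0; first by rewrite addr0 ge_min lexx.
  have [->|s0] := eqVneq (g + w) 0; first by rewrite o0 leey.
  have [k gk ->] := key g g0; have [l hl ->] := key w w0; have [j hj ->] := key _ s0.
  by have := frac_orderD pr gk hl hj; rewrite ge_min !ge_min !lee_fin.
have e4 c : c != 0 -> order_at p (K c) = 0%E.
  move=> c0; apply: order_atE pr _; apply: (frac_order_An (An_const c)).
    by rewrite fmorph_eq0.
  exact: vord_const.
have e5 : exists w, order_at p w = 1%E.
  exists (u - K p); apply: (order_atE pr).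
  apply: (@frac_order_An _ _ _ 1 (An_sub An_u (An_const p)) (u_neq_const p)).
  exists (fun=> 1); split; [exact: holo_cst|exact: oner_neq0|].
  by move=> z _; rewrite expr1 mulr1.
by exists (Place e1 e2 e3 e4 e5).
Qed.

Definition Psi p := xget t0 [set s | ord s = order_at p].

Lemma ord_Psi p g : nc p < r -> ord (Psi p) g = order_at p g.
Proof.
move=> pr; have [s hs] := place_at pr.
by have -> : ord (Psi p) = order_at p by apply: (@xgetPex _ t0 [set s | ord s = order_at p]); exists s.
Qed.

Lemma Psi_vge p x y f h h1 n k : nc p < r -> An x f -> An y h -> y != 0 -> vord r p h n ->
  holo r h1 -> (forall z, nc z < r -> f z = (z - p) ^+ (n + k) * h1 z) ->
  vge (Psi p) k%:Z (x / y).
Proof.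
move=> pr xf yh y0 hn hh1 fE; have [->|x0] := eqVneq x 0; first by rewrite mul0r; exact: vge0.
have [m fm] := An_vord pr xf x0.
have [B [B0 hB]] := holo_bounded hh1.
have nm : (n + k <= m)%N.
  apply: (@vord_ge R r p f m (n + k) B 1 pr ltr01 fm) => z zr _.
  by rewrite fE // ncM ncX mulrC ler_wpM2r ?exprn_ge0 ?nc_ge0 // hB // ltW.
have xo : ord (Psi p) x = m%:Z%:E by rewrite ord_Psi // (order_atE pr (frac_order_An xf x0 fm)).
have yo : ord (Psi p) y = n%:Z%:E by rewrite ord_Psi // (order_atE pr (frac_order_An yh y0 hn)).
by rewrite /vge (ord_div xo yo) lee_fin; lia.
Qed.

Lemma Psi_frac p x y f h h1 h2 n : nc p < r -> An x f -> An y h -> y != 0 ->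
  holo r h1 -> (forall z, nc z < r -> f z = (z - p) ^+ n * h1 z) ->
  holo r h2 -> (forall z, nc z < r -> h z = (z - p) ^+ n * h2 z) -> h2 p != 0 ->
  vge (Psi p) 0 (x / y) /\ value_at (Psi p) (x / y) = h1 p / h2 p.
Proof.
move=> pr xf yh y0 hh1 fE hh2 hE h2p.
have hn : vord r p h n by exists h2.
split; first by apply: (@Psi_vge p x y f h h1 n 0) => //; rewrite addn0.
apply: value_atE; set c := h1 p / h2 p.
have hk : holo r (fun z => h1 z - c * h2 z) by apply: holo_subr => //; apply: holo_mul => //; exact: holo_cst.
have [k kh kE] := holo_div hk pr.
have -> : x / y - K c = (x - K c * y) / y by field.
apply: (@Psi_vge p _ y _ h k n 1 pr (An_sub xf (An_mul (An_const c) yh)) yh y0 hn kh) => z zr.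
have : h1 z - c * h2 z = (z - p) * k z.
  by rewrite kE ?(ltW zr) // /c mulfVK // subrr add0r.
rewrite fE // hE // addn1 exprSr => E; rewrite -mulrA -E; ring.
Qed.

Lemma Psi_frac0 p x y f h : nc p < r -> An x f -> An y h -> y != 0 -> h p != 0 ->
  vge (Psi p) 0 (x / y) /\ value_at (Psi p) (x / y) = f p / h p.
Proof.
move=> pr xf yh y0 hp.
by apply: (@Psi_frac p x y f h f h 0 pr xf yh y0 (An_holo xf) _ (An_holo yh) _ hp) => z _;
  rewrite expr0 mul1r.
Qed.

Lemma Psi_An p x f : nc p < r -> An x f -> vge (Psi p) 0 x /\ value_at (Psi p) x = f p.
Proof.
move=> pr xf; have y1 : An 1 (fun=> 1) by have := An_const 1; rewrite rmorph1.
by have := Psi_frac0 pr xf y1 (oner_neq0 _) (oner_neq0 _); rewrite !divr1.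
Qed.

Lemma Psi_u p : nc p < r -> vge (Psi p) 0 u /\ value_at (Psi p) u = p.
Proof. by move=> pr; exact: (Psi_An pr An_u). Qed.

Lemma good_Psi p : nc p < r -> good (Psi p).
Proof.
move=> pr; have [u0 uE] := Psi_u pr; have [a0 aE] := Psi_An pr An_1.
have [b0 bE] := Psi_An pr An_2; split=> //; rewrite ?uE ?aE ?bE //.
  by case: br1 => _ _ _ _ [hf _]; have [] := hf p (ltW pr).
by case: br2 => _ _ _ _ [hf _]; have [] := hf p (ltW pr).
Qed.

(** Taylor polynomials at s and at p are the same, so the order at s is the vanishing order at p
    scaled by the order k of u - p. *)
Lemma good_order s p k x f m : good s -> p = value_at s u -> ord s (u - K p) = k%:E -> 0 < k ->
  An x f -> vord r p f m -> ord s x = (k * m%:Z)%:E.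
Proof.
move=> gs pE uk k0 xf fm; have [u0 pr _ _] := gs; rewrite -pE in pr.
have [T [w [B [w0 xE B0 fB]]]] := taylor_An gs pE xf m.+1.
have [D [D0 hD]] := vord_bound fm.
have [Q TE] : exists Q, T = Q * ('X - p%:P) ^+ m.
  apply: (@poly_dvd_bound R r T p (B + D) 1 m pr ltr01) => z zr /andP[z0 z1].
  have := nc_dist_le T.[z] (f z); rewrite ncC => /le_trans; apply; rewrite addrC mulrDl.
  apply: lerD; last exact: hD.
  apply: le_trans (fB z (ltW zr)) _; rewrite ler_wpM2l // pow_le_min //.
  by rewrite nc_ge0.
have [h [hh hp hE]] := fm.
have Qp : Q.[p] != 0.
  apply: contraNneq hp => Qp; apply/eqP.
  have : h p - Q.[p] = 0.
    apply: (@holo_zero R r (fun z => h z - Q.[z]) p B 1 pr _ ltr01).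
      by apply: holo_subr => //; exact: holo_poly.
    move=> z zr /andP[z0 z1]; have := fB z (ltW zr).
    rewrite hE // TE hornerM horner_exp hornerXsubC [Q.[z] * _]mulrC -mulrBr ncM ncX exprS.
    have e0 : 0 < nc (z - p) ^+ m by rewrite exprn_gt0.
    by rewrite mulrA [leRHS]mulrC ler_pM2l.
  by rewrite Qp subr0.
have uk1 : vge s 1 (u - K p) by rewrite /vge uk lee_fin; lia.
rewrite xE TE rmorphM rmorphXn rmorphB /= evFX evFC; apply: ord_add_eq.
  by rewrite ordM (ord_ev_unit uk1 Qp) add0e (ordX m uk).
apply: (@vge_le _ _ _ _ _ (k * m.+1%:Z + 0)); first by rewrite -addn1 PoszD mulrDr; lia.
by apply: vgeM => //; apply: vgeX; exact: vge_ord.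
Qed.

(** All orders at s are multiples of the order k of u - p; since some element has order 1, k = 1 and
    the two valuations coincide. So the points of the disc exhaust the good places. *)
Lemma good_eq_Psi s : good s -> s = Psi (value_at s u).
Proof.
move=> gs; have [u0 pr _ _] := gs; set p := value_at s u in pr *.
have [k uk] := ord_fin s (u_neq_const p).
have k0 : 0 < k by have := valueP hC u0; rewrite /vge uk lee_fin; lia.
have key g j : frac_order p g j -> ord s g = (k * j)%:E.
  move=> [x [y [f [h [m [n [[xf yh] [x0 y0] -> [fm hn] ->]]]]]]].
  rewrite (ord_div (good_order gs (erefl _) uk k0 xf fm) (good_order gs (erefl _) uk k0 yh hn)).
  by rewrite mulrBr.
have k1 : k = 1.
  have [w w1] := ord_uniformizer s; have w0 := ord_inj_fin w1.
  have [j wj] := frac_order_ex pr w0; have := key w j wj; rewrite w1 => -[E].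
  have j0 : 0 < j by rewrite -(pmulr_rgt0 _ k0) -E.
  have : k <= 1 by rewrite E ler_peMr // ?ltW //; lia.
  by lia.
apply: place_eq => g; have [->|g0] := eqVneq g 0; first by rewrite !ord0.
have [j gj] := frac_order_ex pr g0.
by rewrite (key g j gj) ord_Psi // (order_atE pr gj) k1 mul1r.
Qed.

Lemma Psi0 : Psi 0 = t0.
Proof. by rewrite (good_eq_Psi good_t0) value_u_t0. Qed.

(** Continuity of [Psi], tested on a function vanishing at p: off p its value is a positive power of
    q - p times a quotient whose denominator stays away from 0. *)
Lemma Psi_small p g e : nc p < r -> vge (Psi p) 1 g -> 0 < e ->
  exists2 eta, 0 < eta & forall q, nc q < r -> nc (q - p) < eta ->
    vge (Psi q) 0 g /\ nc (value_at (Psi q) g) < e.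
Proof.
move=> pr g1 e0; have [g0|g0] := eqVneq g 0.
  exists 1; first exact: ltr01.
  move=> q _ _; rewrite g0; split; first exact: vge0.
  by have := value_const (Psi q) 0; rewrite rmorph0 => ->; rewrite nc0.
have [_ [x [y [f [h [m [n [[xf yh] [x0 y0] gE [fm hn] _]]]]]]]] := frac_order_ex pr g0.
have mn : (n < m)%N.
  move: g1; rewrite /vge ord_Psi // (@order_atE p g (m%:Z - n%:Z)) ?lee_fin //; first by lia.
  by exists x, y, f, h, m, n.
have [h1 [hh1 h1p h1E]] := fm; have [h2 [hh2 h2p h2E]] := hn.
have [B [B0 hB]] := holo_bounded hh1.
have c0 : 0 < nc (h2 p) by rewrite nc_gt0.
have c2 : 0 < nc (h2 p) / 2 by rewrite divr_gt0.
have [eta [eta0 _ heta]] := holo_cont hh2 pr c2.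
pose del := Num.min (Num.min eta 1) (e * (nc (h2 p) / 2) / (B *+ 2)).
have del0 : 0 < del by rewrite /del !lt_min eta0 ltr01 /= divr_gt0 ?mulr_gt0 ?pmulrn_lgt0.
exists del; first exact: del0.
move=> q qr; rewrite /del !lt_min => /andP[/andP[q1 q2] q3].
have [->|qp] := eqVneq q p.
  split; first exact: vge_le g1.
  by have /(value_eq0 hC) -> // := g1; rewrite ?nc0 //; exact: vge_le g1.
have qp0 : q - p != 0 by rewrite subr_eq0.
have h2q : nc (h2 p) / 2 <= nc (h2 q).
  have := nc_dist_le (h2 p) (h2 q); rewrite ncC.
  have := heta q (ltW q1); lra.
have h2q0 : h2 q != 0 by rewrite -nc_gt0; exact: lt_le_trans h2q.
have hq : h q != 0 by rewrite h2E // mulf_neq0 // expf_neq0.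
have [v0 vE] := Psi_frac0 qr xf yh y0 hq.
rewrite gE; split=> //; rewrite vE ncM ncV h1E // h2E // !ncM !ncX.
have [k ->] : exists k, m = (n + k.+1)%N by exists (m - n).-1; rewrite prednK ?subn_gt0 // subnKC // ltnW.
have w0 : 0 < nc (q - p) by rewrite nc_gt0.
have w1 : nc (q - p) ^+ k <= 1 by apply: exprn_ile1; rewrite ?ltW.
rewrite exprD exprSr ltr_pdivrMr; last by rewrite mulr_gt0 ?exprn_gt0 // nc_gt0.
rewrite -!mulrA [ltRHS]mulrCA ltr_pM2l ?exprn_gt0 //.
have b1 : nc (h1 q) <= B by apply: hB; exact: ltW.
move: q3; rewrite ltr_pdivlMr ?pmulrn_lgt0 // => q3.
have b2 : nc (q - p) ^+ k * (nc (q - p) * nc (h1 q)) <= nc (q - p) * B.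
  rewrite -[leRHS]mul1r; apply: ler_pM => //; rewrite ?exprn_ge0 ?mulr_ge0 ?nc_ge0 //.
  by rewrite ler_wpM2l // nc_ge0.
have b3 : e * (nc (h2 p) / 2) <= e * nc (h2 q) by rewrite ler_wpM2l // ltW.
have b4 : 0 < nc (q - p) * B by rewrite mulr_gt0.
move: q3; rewrite -mulr_natr; nra.
Qed.

Lemma Psi_coordinate rho : 0 < rho -> rho <= r -> coordinate_disc t0 u rho (Psi \o @toC R).
Proof.
move=> rho0 rhor; split=> //.
- by rewrite /= -[RHS]Psi0.
- by move=> p /(disc_nc rho0) pr; apply: Psi_u; exact: lt_le_trans rhor.
- move=> p /(disc_nc rho0) pr; have {}pr : nc (toC p) < r by exact: lt_le_trans rhor.
  apply: cvg_place => g [g0 g1].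
  have /(valueP hC) gv : vge (Psi (toC p)) 0 g by [].
  set c := value_at _ g in g1 gv.
  have e0 : 0 < 1 - nc c by rewrite subr_gt0.
  have [eta eta0 heta] := Psi_small pr gv e0.
  apply: (@near_plane R p _ (Num.min eta (r - nc (toC p)))).
    by rewrite lt_min eta0 subr_gt0.
  move=> q; rewrite lt_min => /andP[q1 q2].
  have qr : nc (toC q) < r by have := nc_dist_le (toC q) (toC p); lra.
  have [v0 v1'] := heta _ qr q1.
  have gE : g = (g - K c) + K c by rewrite subrK.
  have gr : vge (Psi (toC q)) 0 g by rewrite gE; apply: vgeD => //; exact: vge_const.
  have vE : value_at (Psi (toC q)) g = value_at (Psi (toC q)) (g - K c) + c.
    by rewrite {1}gE (value_add hC v0 (vge_const _ _)) value_const.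
  split; first exact: gr.
  rewrite [_ q]/(Psi (toC q)) vE.
  apply: le_lt_trans (ncD _ _) _; lra.
- pose D x e := [set s : place F | vge s 0 x /\ nc (value_at s x) < e].
  have d10 : 0 < d1 by case: br1.
  have d20 : 0 < d2 by case: br2.
  (* By [good_eq_Psi] the image of the disc is cut out by three open conditions. *)
  have -> : (Psi \o @toC R) @` disc rho = D u rho `&` (D v1 d1 `&` D v2 d2).
    apply/seteqP; split=> [s [p /(disc_nc rho0) pr <-]|s [[u0 ur] [[a1 a2] [b1 b2]]]].
      have pr' : nc (toC p) < r by exact: lt_le_trans rhor.
      have [g1 _ g3 g4] := good_Psi pr'; have [_ uE] := Psi_u pr'.
      by split; [split=> //=; rewrite uE|split].
    have gs : good s by split=> //; exact: lt_le_trans rhor.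
    exists (Re (value_at s u), Im (value_at s u)).
      by apply: nc_disc; rewrite toC_ReIm.
    by rewrite /= toC_ReIm -good_eq_Psi.
  by apply: openI; [exact: disc_open|apply: openI; exact: disc_open].
Qed.

Lemma Psi_regular g : vge t0 0 g -> exists r1 f, [/\ 0 < r1, r1 <= r, holo r1 f &
  forall z, nc z < r1 -> vge (Psi z) 0 g /\ value_at (Psi z) g = f z].
Proof.
move=> g0; have p0 : nc (0 : R[i]) < r by rewrite nc0.
have [->|gn] := eqVneq g 0.
  exists r, (fun=> 0); split=> //; first exact: holo_cst.
  by move=> z _; split; [exact: vge0|have := value_const (Psi z) 0; rewrite rmorph0].
have [_ [x [y [f [h [m [n [[xf yh] [x0 y0] gE [fm hn] _]]]]]]]] := frac_order_ex p0 gn.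
have mn : (n <= m)%N.
  move: g0; rewrite /vge -Psi0 ord_Psi // (@order_atE 0 g (m%:Z - n%:Z)) ?lee_fin //; first by lia.
  by exists x, y, f, h, m, n.
have [h1 [hh1 h1p h1E]] := fm; have [h2 [hh2 h2p h2E]] := hn.
have [r1 [r10 r1r hi hnz]] := holo_inv r0 hh2 h2p.
exists r1, (fun z => z ^+ (m - n) * h1 z * (h2 z)^-1); split=> //.
  apply: holo_mul hi; apply: (@holo_sub _ r) => //; apply: holo_mul => //.
  by apply: holo_exp; exact: holo_id.
move=> z z1; have zr : nc z < r by exact: lt_le_trans r1r.
have [h2z _] := hnz z (ltW z1); rewrite gE.
have [->|z0] := eqVneq z 0.
  apply: (@Psi_frac 0 x y f h (fun z => z ^+ (m - n) * h1 z) h2 n) => //.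
    by apply: holo_mul => //; apply: holo_exp; exact: holo_id.
  by move=> z' z'r; rewrite h1E // mulrA subr0 -exprD subnKC.
have hz : h z != 0 by rewrite h2E // subr0 mulf_neq0 // expf_neq0.
have [v0 vE] := Psi_frac0 zr xf yh y0 hz.
split=> //; rewrite vE h1E // h2E // subr0 -{1}(subnKC mn) exprD.
have zn : z ^+ n != 0 by rewrite expf_neq0.
by field; rewrite zn h2z.
Qed.

End PuiseuxPlaces.

Section LocalParameter.
Context (R : realType) (C : set (R[i] * R[i])) (F : functionField C)
  (hC : irreducible_curve C).
Implicit Types (t : place F) (g u : F) (z : R[i]) (f : R[i] -> R[i]).
Local Notation K := (ff_const F).

Lemma ord_pole t u g : uniformizer t u -> exists n, vge t 0 (u ^+ n * g).
Proof.
move=> tu; have [->|g0] := eqVneq g 0; first by exists 0%N; rewrite mulr0; exact: vge0.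
have [m gm] := ord_fin t g0; exists `|m|%N.
rewrite /vge ordM (ordX _ tu) gm -EFinD lee_fin; lia.
Qed.

(** All that is used of Puiseux expansions from here on. In the last clause the radius depends on g,
    so a common radius for all c_n needs a further argument. *)
Definition parametrizes t u (r : R) (psi : R[i] -> place F) : Prop :=
  [/\ 0 < r, forall rho, 0 < rho -> rho <= r -> coordinate_disc t u rho (psi \o @toC R),
      forall z, nc z < r -> vge (psi z) 0 u /\ value_at (psi z) u = z &
      forall g, vge t 0 g -> exists r1 f, [/\ 0 < r1, r1 <= r, holo r1 f &
        forall z, nc z < r1 -> vge (psi z) 0 g /\ value_at (psi z) g = f z]].

(* The discs come from Puiseux expansions: up to a polynomial in [u] and powers of
   [u], both coordinate functions are simple roots vanishing at [t], hence analytic in [u]. *)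
Lemma local_parameter t u : uniformizer t u -> exists r psi, parametrizes t u r psi.
Proof.
move=> tu.
have [na ha] := ord_pole (ff_a F) tu; have [nb hb] := ord_pole (ff_b F) tu.
have [sa [ea [v1 [P1 [aE v11 [P1v P10 P11]]]]]] := hensel_form hC tu ha.
have [sb [eb [v2 [P2 [bE v21 [P2v P20 P21]]]]]] := hensel_form hC tu hb.
have [d1 [r1 [f1 [d10 r10 hf1 f1z f1u]]]] := implicit_function P10 P11.
have [d2 [r2 [f2 [d20 r20 hf2 f2z f2u]]]] := implicit_function P20 P21.
pose r := Num.min r1 r2.
have r0 : 0 < r by rewrite lt_min r10.
have rr1 : r <= r1 by rewrite ge_min lexx.
have rr2 : r <= r2 by rewrite ge_min lexx orbT.
have br1 : branch t u r v1 P1 d1 f1.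
  split=> //; first exact: holo_sub rr1 hf1.
  by split=> z zr; [apply: f1z|apply: f1u]; exact: le_trans rr1.
have br2 : branch t u r v2 P2 d2 f2.
  split=> //; first exact: holo_sub rr2 hf2.
  by split=> z zr; [apply: f2z|apply: f2u]; exact: le_trans rr2.
have frac x n (s : {poly R[i]}) e v f : u ^+ n * x = evF u s + u ^+ e * v ->
    An u v1 v2 f1 f2 v f -> fracAn u v1 v2 f1 f2 x.
  move=> E vf; have un : u ^+ n != 0 by rewrite expf_neq0 // (u_neq0 tu).
  have uX j : An u v1 v2 f1 f2 (u ^+ j) (fun z => ('X^j).[z]).
    by have := An_poly 'X^j (An_u u v1 v2 f1 f2); rewrite rmorphXn /= evFX.
  have num := An_add (An_poly s (An_u u v1 v2 f1 f2)) (An_mul (uX e) vf).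
  by do 4 eexists; split; [exact: num|exact: uX n|exact: un|rewrite -E mulrC mulKf].
have ga := frac _ _ _ _ _ _ aE (An_1 u v1 v2 f1 f2).
have gb := frac _ _ _ _ _ _ bE (An_2 u v1 v2 f1 f2).
exists r, (Psi t u r v1 v2 f1 f2); split=> //.
- by move=> rho; apply: (Psi_coordinate hC tu r0 br1 br2 ga gb).
- by move=> z zr; apply: (Psi_u hC tu r0 br1 br2 ga gb).
- by move=> g; apply: (Psi_regular hC tu r0 br1 br2 ga gb).
Qed.

(** The quotient g / u^m is a unit at t, and its analytic expression stays nonzero on a smaller
    disc. *)
Lemma parametrizes_order t u r psi g m : parametrizes t u r psi -> uniformizer t u ->
  ord t g = m%:E -> exists r1 f, [/\ 0 < r1, r1 <= r, holo r1 f,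
    forall z, nc z <= r1 -> f z != 0 /\ nc (f z - f 0) <= nc (f 0) / 2 &
    forall z, z != 0 -> nc z < r1 ->
      ord (psi z) g = 0%E /\ value_at (psi z) g = z ^ m * f z].
Proof.
move=> [r0 co pu reg] tu gm; have u0 : u != 0 by exact: ord_inj_fin tu.
have um : ord t (u ^ m) = m%:E.
  case: m {gm} => n; first by rewrite -exprnP (ordX n tu) mul1r.
  by rewrite NegzE -exprnN (ordV (ordX _ tu)) mul1r.
have g1 : ord t (g / u ^ m) = 0%E by rewrite (ord_div gm um) subrr.
have [r1 [f [r10 r1r hf fE]]] := reg _ (vge_ord g1).
have psi0 : psi 0 = t by have [_ + _ _ _] := co r r0 (lexx _).
have f0 : f 0 != 0.
  have l0 : nc (0 : R[i]) < r1 by rewrite nc0.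
  have [v0 <-] := fE 0 l0.
  by rewrite psi0; apply/(value_neq0 hC (vge_ord g1)).
have [r2 [r20 r2r _ h2]] := holo_inv r10 hf f0.
exists r2, f; split=> //; [exact: le_trans r1r|exact: holo_sub hf|].
move=> z z0 zr; have zr1 : nc z < r1 by exact: lt_le_trans r2r.
have [ur uz] := pu z (lt_le_trans zr1 r1r); have [gr gz] := fE z zr1.
have ou : ord (psi z) u = 0%E by apply/(value_neq0 hC ur); rewrite uz.
have [fz _] := h2 z (ltW zr).
have og : ord (psi z) (g / u ^ m) = 0%E by apply/(value_neq0 hC gr); rewrite gz.
have [oum vum] : ord (psi z) (u ^ m) = 0%E /\ value_at (psi z) (u ^ m) = z ^ m.
  case: (m) => n.
    by rewrite -!exprnP (ordX n ou) mul0r (value_exp hC n ur) uz.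
  have on := ordX n.+1 ou; rewrite mul0r in on.
  rewrite NegzE -!exprnN (ordV on) oppr0; split=> //.
  by have [_ ->] := value_inv hC on; rewrite (value_exp hC _ ur) uz.
have -> : g = u ^ m * (g / u ^ m) by rewrite mulrCA mulfV ?mulr1 // expfz_neq0.
by rewrite ordM oum og add0e (value_mul hC (vge_ord oum) gr) vum gz.
Qed.

Lemma psi_open t u r psi (U : set (place F)) : parametrizes t u r psi -> open U -> U t ->
  exists2 r1, 0 < r1 <= r & forall z, nc z < r1 -> U (psi z).
Proof.
move=> [r0 co _ _] oU Ut; have [_ p0 _ cp _] := co r r0 (lexx _).
have d0 : disc r (0, 0) by rewrite /disc /= !expr0n addr0 exprn_gt0.
have := cp _ d0 U; rewrite p0 => /(_ (open_nbhs_nbhs (conj oU Ut))).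
move=> /nbhs_ballP[e /= e0 he].
exists (Num.min r (e / 2)); first by rewrite lt_min r0 divr_gt0 // ge_min lexx.
move=> z; rewrite lt_min => /andP[_ ze].
have := he (Re z, Im z); rewrite /= toC_ReIm; apply; split => /=.
  rewrite /ball /= sub0r normrN; apply: le_lt_trans (nc_Re z) _; lra.
rewrite /ball /= sub0r normrN; apply: le_lt_trans (nc_Im z) _; lra.
Qed.

End LocalParameter.

(** * Escape rates *)

Section EscapeRate.
Context (R : realType).
Implicit Types (a b z : R[i]) (y l : nat -> R) (M c : R) (n : nat).

Lemma pow3_gt0 n : 0 < 3 ^+ n :> R. Proof. by rewrite exprn_gt0. Qed.

Lemma pow3V_small (B e : R) : 0 < e -> exists N, forall n, (N <= n)%N -> (3 ^+ n)^-1 * B <= e.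
Proof.
move=> e0; have h : 0 <= (3^-1 : R) < 1 by rewrite invr_ge0 ler0n invf_lt1 ?ltr1n.
have [N hN] := pow_small `|B| h e0; exists N => n Nn.
apply: le_trans hN; rewrite mulrC -exprVn; apply: le_trans (_ : `|B| * 3^-1 ^+ n <= _).
  by rewrite ler_wpM2r ?ler_norm // exprn_ge0 // invr_ge0.
rewrite ler_wpM2l // -(subnK Nn) exprD ler_piMl ?exprn_ge0 ?invr_ge0 // exprn_ile1 ?invr_ge0 //.
by rewrite invf_le1 ?ler1n.
Qed.

(* [3^-n (y n + 1/2)] decreases, and [3^-n (y n - 1/2)] increases after the escape. *)
Lemma tripling_limit y c : 0 <= c -> (forall n, c <= y n) ->
  (forall n, y n.+1 <= 3 * y n + 1) ->
  (forall n, c < y n -> c < y n.+1 /\ 3 * y n - 1 <= y n.+1) ->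
  exists G, [/\ (fun n => (3 ^+ n)^-1 * y n) @ \oo --> G, 0 <= G,
    forall n, G <= (3 ^+ n)^-1 * (y n + 1) &
    forall n, c < y n -> (3 ^+ n)^-1 * (y n - 1) <= G].
Proof.
move=> c0 yc yu yl; pose s n := (3 ^+ n)^-1 * (y n + 2^-1).
have p0 n : 0 < (3 ^+ n)^-1 :> R by rewrite invr_gt0 pow3_gt0.
have pS n : (3 ^+ n.+1)^-1 = (3 ^+ n)^-1 / 3 :> R by rewrite exprS invfM mulrC.
have sS n : s n.+1 <= s n.
  rewrite /s pS -mulrA ler_pM2l //; have := yu n; lra.
have s0 n : 0 <= s n.
  by apply: mulr_ge0; [exact: ltW|have := yc n; lra].
have ds : nonincreasing_seq s by apply/nonincreasing_seqP.
have cs : cvgn s by apply: nonincreasing_is_cvgn ds _; exists 0 => _ [n _ <-].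
have p_cvg : (fun n => (3 ^+ n)^-1 / 2) @ \oo --> (0 : R).
  apply/cvgrPdist_le => e e0; have [N hN] := pow3V_small 2^-1 e0.
  exists N => // n /= Nn; rewrite sub0r normrN ger0_norm ?hN // ?divr_ge0 ?ltW.
have yE : (fun n => (3 ^+ n)^-1 * y n) = (fun n => s n - (3 ^+ n)^-1 / 2).
  by apply/funext => n; rewrite /s mulrDr addrK.
have cy : (fun n => (3 ^+ n)^-1 * y n) @ \oo --> limn s.
  by rewrite yE -[limn s]subr0; exact: cvgB.
have up n : limn s <= s n by apply: nonincreasing_cvgn_ge.
exists (limn s); split=> //.
- by apply: limr_ge cs _; apply: nearW.
- move=> n; apply: le_trans (up n) _; rewrite /s ler_pM2l //; lra.
move=> n cn.
have low m : c < y (n + m)%N /\ (3 ^+ n)^-1 * (y n - 2^-1) <= (3 ^+ (n + m))^-1 * (y (n + m)%N - 2^-1).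
  elim: m => [|m [cm IH]]; first by rewrite addn0.
  rewrite addnS; have [cm1 ym] := yl _ cm; split=> //; apply: le_trans IH _.
  rewrite pS -mulrA ler_pM2l //; lra.
apply: (@le_trans _ _ ((3 ^+ n)^-1 * (y n - 2^-1))); first by rewrite ler_pM2l //; lra.
apply: limr_ge cs _; exists n => // m /= nm; have [_] := low (m - n)%N.
rewrite subnKC // => /le_trans; apply; rewrite /s ler_pM2l //; lra.
Qed.

Definition orbit a b n : R[i] := iter n (cubic a b) a.

Definition escape a b : R := limn (fun n => (3 ^+ n)^-1 * logplus (nc (orbit a b n))).

(** Truncating the modulus at 4 M makes the recurrence y(n+1) <= 3 y(n) + 1 valid for bounded orbits
    as well; it changes log+ by at most ln (4 M), which 3^-n removes in the limit. *)
Definition log_size a b M n : R := ln (Num.max (nc (orbit a b n)) (4 * M)).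

Context (a b : R[i]) (M : R) (M1 : 1 <= M) (aM : nc a <= M) (bM : nc b <= M ^+ 3).

Local Notation y := (log_size a b M).

Let M0 : 0 < M. Proof. exact: lt_le_trans ltr01 M1. Qed.
Let L0 : 0 < 4 * M. Proof. by rewrite mulr_gt0. Qed.

Let nc_mid z : nc (3%:R * a ^+ 2 * z) = 3 * (nc a ^+ 2 * nc z).
Proof. by rewrite -mulrA (ncM 3%:R) nc_nat (ncM (a ^+ 2)) (ncX a). Qed.

Lemma cubic_upper z (X : R) : nc z <= X -> 4 * M <= X -> nc (cubic a b z) <= 2 * X ^+ 3.
Proof.
move=> zX LX; have X0 : 0 < X by exact: lt_le_trans LX.
rewrite /cubic; apply: le_trans (ncD _ _) _.
have := ncB (z ^+ 3) (3%:R * a ^+ 2 * z); rewrite nc_mid ncX => h.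
have z3 : nc z ^+ 3 <= X ^+ 3 by rewrite lerXn2r ?nnegrE ?nc_ge0 // ltW.
have a2 : nc a ^+ 2 <= M ^+ 2 by rewrite lerXn2r ?nnegrE ?nc_ge0 // ltW.
have az : nc a ^+ 2 * nc z <= M ^+ 2 * X by apply: ler_pM; rewrite ?exprn_ge0 ?nc_ge0.
have m2 : 16 * M ^+ 2 <= X ^+ 2.
  by have -> : 16 * M ^+ 2 = (4 * M) ^+ 2; [ring|rewrite lerXn2r ?nnegrE // ltW].
have m3 : 64 * M ^+ 3 <= X ^+ 3.
  by have -> : 64 * M ^+ 3 = (4 * M) ^+ 3; [ring|rewrite lerXn2r ?nnegrE // ltW].
have m4 : 16 * (M ^+ 2 * X) <= X ^+ 3.
  by rewrite mulrA [X ^+ 3]exprSr ler_pM2r.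
have X3 : 0 < X ^+ 3 by rewrite exprn_gt0.
move: bM; lra.
Qed.

(** Beyond 4 M the terms 3 a^2 z and b are at most 3/16 and 1/64 of |z|^3, together less than a
    quarter; the image then lies beyond 4 M again. *)
Lemma cubic_lower z : 4 * M < nc z ->
  3 / 4 * nc z ^+ 3 <= nc (cubic a b z) /\ 4 * M < nc (cubic a b z).
Proof.
move=> zL; have z0 : 0 < nc z by exact: lt_trans zL.
have h1 : nc z ^+ 3 <= nc (cubic a b z) + (3 * (nc a ^+ 2 * nc z) + nc b).
  have -> : nc z ^+ 3 = nc (cubic a b z + (3%:R * a ^+ 2 * z - b)).
    by rewrite -ncX; congr nc; rewrite /cubic; ring.
  apply: le_trans (ncD _ _) _; rewrite lerD2l; apply: le_trans (ncB _ _) _.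
  by rewrite nc_mid.
have a2 : nc a ^+ 2 <= M ^+ 2 by rewrite lerXn2r ?nnegrE ?nc_ge0 // ltW.
have az : nc a ^+ 2 * nc z <= M ^+ 2 * nc z by rewrite ler_wpM2r ?nc_ge0.
have m2 : 16 * M ^+ 2 <= nc z ^+ 2.
  by have -> : 16 * M ^+ 2 = (4 * M) ^+ 2; [ring|rewrite lerXn2r ?nnegrE // ltW].
have m3 : 64 * M ^+ 3 <= nc z ^+ 3.
  by have -> : 64 * M ^+ 3 = (4 * M) ^+ 3; [ring|rewrite lerXn2r ?nnegrE // ltW].
have m4 : 16 * (M ^+ 2 * nc z) <= nc z ^+ 3.
  by rewrite mulrA [nc z ^+ 3]exprSr ler_pM2r.
have X3 : 0 < nc z ^+ 3 by rewrite exprn_gt0.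
have key : 3 / 4 * nc z ^+ 3 <= nc (cubic a b z) by move: bM; lra.
split=> //; apply: lt_le_trans key.
have M2 : 1 <= M ^+ 2 by exact: exprn_ege1.
have : 16 * nc z <= nc z ^+ 3 by apply: le_trans m4; rewrite ler_pM2l // ler_peMl // ltW.
lra.
Qed.

Let yc n : ln (4 * M) <= y n.
Proof. by rewrite /log_size ler_ln ?posrE ?lt_max ?L0 ?orbT // le_max lexx orbT. Qed.

Let yE n : 4 * M < nc (orbit a b n) -> y n = ln (nc (orbit a b n)).
Proof. by move=> h; rewrite /log_size max_l // ltW. Qed.

Let ylt n : (ln (4 * M) < y n) = (4 * M < nc (orbit a b n)).
Proof. by rewrite /log_size ltr_ln ?posrE ?lt_max ?L0 ?orbT // ltxx orbF. Qed.

Lemma escape_facts : exists G,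
  [/\ (fun n => (3 ^+ n)^-1 * y n) @ \oo --> G, 0 <= G,
    forall n, G <= (3 ^+ n)^-1 * (y n + 1) &
    forall n, 4 * M < nc (orbit a b n) -> (3 ^+ n)^-1 * (ln (nc (orbit a b n)) - 1) <= G].
Proof.
have [||n|n|G [h1 h2 h3 h4]] := @tripling_limit y (ln (4 * M)).
- by apply: ln_ge0; move: M1; lra.
- exact: yc.
- rewrite /log_size; set X := Num.max (nc (orbit a b n)) (4 * M).
  have X0 : 0 < X by rewrite lt_max L0 orbT.
  have X3 : 0 < X ^+ 3 by rewrite exprn_gt0.
  (* The additive 1 of the recurrence absorbs the factor 2, as ln 2 <= 1; in the lower recurrence it
     absorbs 3/4, as ln (4/3) <= 1/3. *)
  apply: (@le_trans _ _ (ln (2 * X ^+ 3))); last first.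
    have l3 : ln (X ^+ 3) = 3 * ln X by rewrite lnXn // [RHS]mulr_natl.
    have l2 : ln (2 : R) <= 1 by apply: (@le_ln1Dx R 1); lra.
    by rewrite lnM ?posrE // l3; lra.
  rewrite ler_ln ?posrE ?mulr_gt0 // ?lt_max ?L0 ?orbT // ge_max; apply/andP; split.
    by rewrite /orbit iterS; apply: cubic_upper; rewrite /X le_max lexx ?orbT.
    have XL : 4 * M <= X by rewrite /X le_max lexx orbT.
  have X1 : 1 <= X by move: M1; lra.
  have : 1 <= X ^+ 2 by exact: exprn_ege1.
  rewrite exprSr; nra.
- rewrite !ylt => zL; have [k1 k2] := cubic_lower zL; rewrite !yE ?[orbit a b n.+1]iterS //.
  split=> //; have z0 : 0 < nc (orbit a b n) by exact: lt_trans zL.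
  apply: (@le_trans _ _ (ln (3 / 4 * nc (orbit a b n) ^+ 3))); last first.
    by rewrite ler_ln ?posrE // ?(lt_trans L0 k2) // mulr_gt0 ?exprn_gt0 // divr_gt0.
  have l3 : ln (nc (orbit a b n) ^+ 3) = 3 * ln (nc (orbit a b n)) by rewrite lnXn // [RHS]mulr_natl.
  have l4 : ln (3 / 4 : R) = - ln (4 / 3) by rewrite -lnV ?posrE ?divr_gt0 // invf_div.
  have l5 : ln (4 / 3 : R) <= 1 / 3.
    have -> : 4 / 3 = 1 + 1 / 3 :> R by field.
    by apply: le_ln1Dx; lra.
  by rewrite lnM ?posrE ?exprn_gt0 ?divr_gt0 // l3 l4; lra.
exists G; split=> // n zL; by have := h4 n; rewrite ylt yE //; apply.
Qed.

Let y_logplus n : logplus (nc (orbit a b n)) <= y n <= logplus (nc (orbit a b n)) + ln (4 * M).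
Proof.
have lL : 0 <= ln (4 * M) by rewrite ln_ge0 //; move: M1; lra.
have [zL|zL] := ltP (4 * M) (nc (orbit a b n)).
  rewrite yE // /logplus max_r ?lexx ?lerDl //.
  by apply: ln_ge0; move: M1; lra.
rewrite /log_size max_r // lerDr logplus_ge0 andbT /logplus ge_max lL /=.
have [z0|z0] := ltP 0 (nc (orbit a b n)); first by rewrite ler_ln ?posrE.
by rewrite ln0.
Qed.

Lemma escape_cvg : (fun n => (3 ^+ n)^-1 * logplus (nc (orbit a b n))) @ \oo --> escape a b.
Proof.
have [G [h1 _ _ _]] := escape_facts.
suff h : (fun n => (3 ^+ n)^-1 * logplus (nc (orbit a b n))) @ \oo --> G.
  by rewrite /escape (cvg_lim _ h).
apply/cvgrPdist_le => e e0; have e2 : 0 < e / 2 by rewrite divr_gt0.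
have [N hN] := pow3V_small (ln (4 * M)) e2.
move/cvgrPdist_le : h1 => /(_ _ e2)[N' _ hN'].
exists (N + N')%N => // n /= nN.
have n1 : (N <= n)%N by exact: leq_trans (leq_addr _ _) nN.
have n2 : (N' <= n)%N by exact: leq_trans (leq_addl _ _) nN.
have := hN' n n2; have := hN n n1; have /andP[y1 y2] := y_logplus n.
have p0 : 0 < (3 ^+ n)^-1 :> R by rewrite invr_gt0 pow3_gt0.
move: y1 y2; rewrite -(ler_pM2l p0) => {}y1; rewrite -(ler_pM2l p0) mulrDr => {}y2.
move: y1 y2; rewrite !ler_distl; lra.
Qed.

Lemma escape_bounds : [/\ 0 <= escape a b,
    forall n, escape a b <= (3 ^+ n)^-1 * (y n + 1) &
    forall n, 4 * M < nc (orbit a b n) -> (3 ^+ n)^-1 * (ln (nc (orbit a b n)) - 1) <= escape a b].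
Proof.
have [G [h1 h2 h3 h4]] := escape_facts.
suff -> : escape a b = G by [].
suff h : (fun n => (3 ^+ n)^-1 * y n) @ \oo --> escape a b by exact: cvg_unique h h1.
have p_cvg : (fun n => (3 ^+ n)^-1 * y n - (3 ^+ n)^-1 * logplus (nc (orbit a b n))) @ \oo --> (0 : R).
  apply/cvgrPdist_le => e e0; have [N hN] := pow3V_small (ln (4 * M)) e0.
  exists N => // n /= Nn; have := hN n Nn; have /andP[y1 y2] := y_logplus n.
  have p0 : 0 < (3 ^+ n)^-1 :> R by rewrite invr_gt0 pow3_gt0.
  move: y1 y2; rewrite -(ler_pM2l p0) => {}y1; rewrite -(ler_pM2l p0) mulrDr => {}y2.
  move: y1 y2; rewrite sub0r normrN ler_norml; lra.
rewrite -[escape a b]add0r.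
have -> : (fun n => (3 ^+ n)^-1 * y n) = (fun n => ((3 ^+ n)^-1 * y n -
    (3 ^+ n)^-1 * logplus (nc (orbit a b n))) + (3 ^+ n)^-1 * logplus (nc (orbit a b n))).
  by apply/funext => n; rewrite subrK.
exact: cvgD p_cvg escape_cvg.
Qed.

Lemma escape_approx n :
  `|escape a b - (3 ^+ n)^-1 * logplus (nc (orbit a b n))| <= (3 ^+ n)^-1 * (ln (4 * M) + 1).
Proof.
have [g0 g1 g2] := escape_bounds; have /andP[y1 y2] := y_logplus n.
have p0 : 0 < (3 ^+ n)^-1 :> R by rewrite invr_gt0 pow3_gt0.
have lL : 0 <= ln (4 * M) by rewrite ln_ge0 //; move: M1; lra.
have up := g1 n; move: y1 y2; rewrite -(ler_pM2l p0) => y1; rewrite -(ler_pM2l p0) => y2.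
rewrite !mulrDr in up y1 y2 *.
have pl : 0 <= (3 ^+ n)^-1 * ln (4 * M) by rewrite mulr_ge0 // ltW.
rewrite ler_distl; apply/andP; split; last by lra.
have [zL|zL] := ltP (4 * M) (nc (orbit a b n)).
  have := g2 n zL; rewrite mulrBr.
  have -> : ln (nc (orbit a b n)) = logplus (nc (orbit a b n)).
    by rewrite /logplus max_r //; apply: ln_ge0; move: M1; lra.
  lra.
have l1 : (3 ^+ n)^-1 * logplus (nc (orbit a b n)) <= (3 ^+ n)^-1 * ln (4 * M).
  by rewrite ler_pM2l //; move: y1; rewrite ler_pM2l // /log_size max_r.
lra.
Qed.

End EscapeRate.

(** * Orders of the orbit at a pole *)

Section Poles.
Context (R : realType) (C : set (R[i] * R[i])) (F : functionField C)
  (hC : irreducible_curve C).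
Implicit Types (s t : place F) (g u v w x y : F) (z : R[i]) (f : R[i] -> R[i]) (m n k : nat).
Local Notation K := (ff_const F).
Local Notation a := (ff_a F).
Local Notation b := (ff_b F).

Lemma vge_cubic t x y w : vge t 0 x -> vge t 0 y -> vge t 0 w ->
  vge t 0 (cubic x y w) /\
  value_at t (cubic x y w) = cubic (value_at t x) (value_at t y) (value_at t w).
Proof.
move=> x0 y0 w0; rewrite /cubic -(rmorph_nat K).
have x2 : vge t 0 (x ^+ 2) by have := vgeX 2 x0; rewrite mul0r.
have w3 : vge t 0 (w ^+ 3) by have := vgeX 3 w0; rewrite mul0r.
have k3 := vge_const t (3%:R : R[i]).
have p1 : vge t 0 (K 3%:R * x ^+ 2) by rewrite -[0]addr0; exact: vgeM.
have p2 : vge t 0 (K 3%:R * x ^+ 2 * w) by rewrite -[0]addr0; exact: vgeM.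
have p3 := vgeB w3 p2; split; first exact: vgeD.
rewrite (value_add hC p3 y0) (value_sub hC w3 p2) (value_mul hC p1 w0).
by rewrite (value_mul hC k3 x2) value_const !(value_exp hC).
Qed.

Lemma c_S n : c_ F n.+1 = cubic a b (c_ F n). Proof. by rewrite /c_ iterS. Qed.

Lemma regular_orbit t n : vge t 0 a -> vge t 0 b ->
  vge t 0 (c_ F n) /\ value_at t (c_ F n) = orbit (value_at t a) (value_at t b) n.
Proof.
move=> a0 b0; elim: n => [|n [c0 cE]] //.
by rewrite c_S /orbit iterS -/(orbit _ _ n) -cE; exact: vge_cubic.
Qed.

Lemma ord_cases t g : g = 0 \/ exists m : int, ord t g = m%:E.
Proof. by have [->|/(ord_fin t)] := eqVneq g 0; [left|right]. Qed.

Lemma SplusP t : Splus t <-> ~ (vge t 0 a /\ vge t 0 b).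
Proof.
rewrite /Splus /= /gamma_max /gamma_a /gamma_b lt_max /vge.
have E g : (0 < - ord t g)%E = ~~ (0%:E <= ord t g)%E by rewrite oppe_gt0 ltNge.
have E3 : (0 < 3%:E * - ord t a)%E = (0 < - ord t a)%E.
  have [->|[m ->]] := ord_cases t a.
    have -> : (- ord t 0 = -oo)%E by rewrite ord0.
    by rewrite gt0_muleNy // lte_fin.
  by rewrite -!EFinN -EFinM !lte_fin pmulr_rgt0.
rewrite E3 !E -negb_and; split; first by move=> /negP h [h1 h2]; apply: h; rewrite h1 h2.
by move=> h; apply/negP => /andP.
Qed.

(** When the pole of c_n exceeds that of a and, tripled, that of b, the cube dominates and the order
    of the pole triples at each step. *)
Lemma orbit_growth t n (m : int) : 0 < m -> ord t (c_ F n) = (- m)%:E ->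
  vge t (1 - m) a -> vge t (1 - 3 * m) b -> S0plus t.
Proof.
move=> m0 cm am bm.
have key j : ord t (c_ F (n + j)) = (- (m * 3 ^+ j))%:E.
  elim: j => [|j IH]; first by rewrite addn0 expr0 mulr1.
  have j1 : 1 <= 3 ^+ j :> int by exact: exprn_ege1.
  have mj : m <= m * 3 ^+ j by rewrite ler_peMr // ltW.
  set l := m * 3 ^+ j in IH mj.
  rewrite addnS c_S /cubic -addrA; have -> : - (m * 3 ^+ j.+1) = - l * 3%:Z by rewrite /l exprSr; ring.
  apply: ord_add_eq; first exact: ordX IH.
  apply: vgeD; last by apply: vge_le bm; lia.
  apply: vgeN; rewrite -(rmorph_nat K); apply: (@vge_le _ _ _ _ _ (0 + (1 - m) * 2%:Z + - l)); first lia.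
  by apply: vgeM (vge_ord IH); apply: vgeM (vge_const _ _) _; exact: vgeX.
move=> M; exists (n + `|M|)%N => k nk; rewrite /gamma -(subnKC nk) -addnA key -EFinN lee_fin opprK.
have h j : j%:Z <= 3 ^+ j.
  by elim: j => // j IH; rewrite exprS; lia.
have := h (`|M| + (k - (n + `|M|)))%N; set X := 3 ^+ _ => hX.
have X0 : 0 <= X by rewrite exprn_ge0.
have : X <= m * X by rewrite ler_peMl //; lia.
lia.
Qed.

Lemma S0plus_Splus t : S0plus t -> Splus t.
Proof.
move=> h; apply/SplusP => -[a0 b0]; have [N hN] := h 1.
have [c0 _] := regular_orbit N a0 b0; have := hN N (leqnn _); rewrite /gamma.
have [->|[m cm]] := ord_cases t (c_ F N); first by rewrite ord0.
by move: c0; rewrite /vge cm -EFinN !lee_fin; lia.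
Qed.

Lemma c1E : c_ F 1 = b - 2%:R * a ^+ 3.
Proof. by rewrite c_S /cubic /c_ /=; ring. Qed.

(** By [orbit_growth], outside [S0plus] no c_n has a larger pole than a, and b has at most three
    times its order, for otherwise c_1 = b - 2 a^3 has the pole of b and escapes. With k = 0 off
    [Splus], regular points and bounded poles share the later statements. *)
Lemma bounded_poles t : ~ S0plus t -> exists k,
  [/\ (Splus t -> (0 < k)%N /\ ord t a = (- k%:Z)%:E), (~ Splus t -> k = 0%N),
    vge t (- k%:Z) a, vge t (- (3 * k)%N%:Z) b & forall n, vge t (- k%:Z) (c_ F n)].
Proof.
move=> nS; have [St|nSt] := pselect (Splus t); last first.
  have [a0 b0] : vge t 0 a /\ vge t 0 b by apply: contrapT => /SplusP.
  by exists 0%N; split=> // n; have [] := regular_orbit n a0 b0.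
have /SplusP nab := St.
have [aE|[al aal]] := ord_cases t a.
  have [bE|[be bbe]] := ord_cases t b.
    by case: nab; rewrite aE bE; split; exact: vge0.
  have be0 : be < 0.
    by rewrite ltNge; apply/negP => h; apply: nab; rewrite aE /vge ord0 bbe leey lee_fin.
  case: nS; apply: (@orbit_growth t 1 (- be)); first lia.
  - by rewrite c1E aE expr0n mulr0 subr0 bbe opprK.
  - by rewrite aE; exact: vge0.
  - by rewrite /vge bbe lee_fin; lia.
have [b3|nb3] := pselect (vge t (3 * al) b); last first.
  have [bE|[be bbe]] := ord_cases t b; first by case: nb3; rewrite bE; exact: vge0.
  have be3 : be < 3 * al by rewrite ltNge; apply/negP => h; apply: nb3; rewrite /vge bbe lee_fin.
  have be0 : be < 0.
    rewrite ltNge; apply/negP => h; apply: nab; rewrite /vge aal bbe !lee_fin; split=> //; lia.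
  case: nS; apply: (@orbit_growth t 1 (- be)); first lia.
  - rewrite opprK c1E; apply: ord_add_eq => //; apply: vgeN; rewrite -(rmorph_nat K).
    apply: (@vge_le _ _ _ _ _ (0 + al * 3%:Z)); first lia.
    by apply: vgeM (vge_const _ _) _; exact: vgeX (vge_ord aal).
  - by rewrite /vge aal lee_fin; lia.
  - by rewrite /vge bbe lee_fin; lia.
have al0 : al < 0.
  rewrite ltNge; apply/negP => h; apply: nab; split; first by rewrite /vge aal lee_fin.
  by apply: vge_le b3; lia.
exists `|al|%N; have alE : - (`|al|%N)%:Z = al by lia.
split=> //; rewrite ?alE.
- by move=> _; split=> //; lia.
- exact: vge_ord.
- by apply: vge_le b3; lia.
move=> n; apply: contrapT => nc_n; case: nS.
have [cE|[ga cga]] := ord_cases t (c_ F n); first by case: nc_n; rewrite cE; exact: vge0.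
have gal : ga < al by rewrite ltNge; apply/negP => h; apply: nc_n; rewrite /vge cga lee_fin.
apply: (@orbit_growth t n (- ga)); first lia.
- by rewrite cga opprK.
- by rewrite /vge aal lee_fin; lia.
- by apply: vge_le b3; lia.
Qed.

(** The factors x - s and x + s differ by the nonzero constant 2 s, so they cannot both vanish at t;
    the one of order at most 0 leaves order k to the other. *)
Lemma square_root_split t x (s : R[i]) k : s != 0 -> (0 < k)%N -> vge t 0 x ->
  vge t k%:Z (x ^+ 2 - K (s ^+ 2)) -> vge t k%:Z (x - K s) \/ vge t k%:Z (x + K s).
Proof.
move=> s0 k0 x0 h.
have E : x ^+ 2 - K (s ^+ 2) = (x - K s) * (x + K s) by rewrite rmorphXn; ring.
have ks := vge_const t s; rewrite E /vge ordM in h.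
have m0 := vgeB x0 ks; have p0 := vgeD x0 ks.
have [|[p hp]] := ord_cases t (x - K s); first by move=> ->; left; exact: vge0.
have [|[q hq]] := ord_cases t (x + K s); first by move=> ->; right; exact: vge0.
move: m0 p0; rewrite /vge hp hq -EFinD !lee_fin in h * => m0 p0.
have pq : Num.min p q <= 0.
  have two : ord t (K (2%:R * s)) = 0%E by rewrite ord_const // mulf_neq0 // pnatr_eq0.
  rewrite leNgt; apply/negP; rewrite lt_min => /andP[p1 q1].
  have : vge t 1 (K (2%:R * s)).
    have -> : K (2%:R * s) = (x + K s) - (x - K s) by rewrite rmorphM rmorph_nat; ring.
    by apply: vgeB; rewrite /vge ?hp ?hq lee_fin; lia.
  by rewrite /vge two lee_fin.
lia.
Qed.

(* [(c_n - a)^2 (c_n + 2 a) = c_(n+1) - c_1] has a pole of order at most [k], so either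
   [c_n + 2 a] vanishes to order [k], or [c_n - a] is regular and its square is close to 0 or to
   [+-1], according to the first alternative for [c_(n+1)] and [c_1]. *)
Lemma pole_expansion t k : (0 < k)%N -> ord t a = (- k%:Z)%:E ->
  (forall n, vge t (- k%:Z) (c_ F n)) ->
  forall n, exists2 e, vge t (uphalf k)%:Z (c_ F n - e) &
    e = - 2%:R * a \/ exists2 c : R[i], nc c <= 1 & e = a + K c.
Proof.
move=> k0 ak ck.
have a3 : ord t (3%:R * a) = (- k%:Z)%:E.
  by rewrite ordM -(rmorph_nat K) ord_const ?pnatr_eq0 // add0e.
have uk : (uphalf k)%:Z <= k%:Z by rewrite lez_nat uphalf_half; have := odd_double_half k; lia.
have idn n : (c_ F n - a) ^+ 2 * (c_ F n + 2%:R * a) = c_ F n.+1 - c_ F 1.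
  by rewrite c1E c_S /cubic; ring.
have ordy n : vge t (1 - k%:Z) (c_ F n - a) -> ord t (c_ F n + 2%:R * a) = (- k%:Z)%:E.
  have -> : c_ F n + 2%:R * a = 3%:R * a + (c_ F n - a) by ring.
  by move=> h; apply: ord_add_eq => //; apply: vge_le h; lia.
(* If c_n - a has order - k, the identity gives c_n + 2 a order at least k. If the order is larger,
   c_n + 2 a has order exactly - k, and (c_n - a)^2 has to be regular. *)
have types n : vge t 0 (c_ F n - a) \/ vge t k%:Z (c_ F n + 2%:R * a).
  have dk : vge t (- k%:Z) ((c_ F n - a) ^+ 2 * (c_ F n + 2%:R * a)) by rewrite idn; exact: vgeB.
  have [->|[p xp]] := ord_cases t (c_ F n - a); first by left; exact: vge0.
  have [->|[q yq]] := ord_cases t (c_ F n + 2%:R * a); first by right; exact: vge0.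
  have pk : - k%:Z <= p.
    have : vge t (- k%:Z) (c_ F n - a) by apply: vgeB => //; exact: vge_ord.
    by rewrite /vge xp lee_fin.
  move: dk; rewrite /vge ordM (ordX 2 xp) yq -EFinD lee_fin => dk.
  have [pE|pn] := eqVneq p (- k%:Z); first by right; rewrite lee_fin; lia.
  have : ord t (c_ F n + 2%:R * a) = (- k%:Z)%:E by apply: ordy; rewrite /vge xp lee_fin; lia.
  by rewrite yq => -[qE]; left; rewrite xp lee_fin; lia.
move=> n; have [x0|y0] := types n; last first.
  exists (- 2%:R * a); last by left.
  by rewrite mulNr opprK; exact: vge_le y0.
have yk := ordy n (vge_le (_ : 1 - k%:Z <= 0) x0); have {}yk := yk ltac:(lia).
have y0 := ord_inj_fin yk.
set x := c_ F n - a in x0 *; set y := c_ F n + 2%:R * a in yk y0.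
have yE : y = 3%:R * a + x by rewrite /x /y; ring.
have over v : vge t 0 v -> vge t k%:Z (v / y).
  by move=> v0; have := vge_div yk v0; rewrite sub0r opprK.
(* Taking the square root of an order k is what limits the expansion to [uphalf k]. *)
have near0 : vge t k%:Z (x ^+ 2) -> exists2 e, vge t (uphalf k)%:Z (c_ F n - e) &
    e = - 2%:R * a \/ exists2 c : R[i], nc c <= 1 & e = a + K c.
  move=> x2; exists a; last by right; exists 0; rewrite ?nc0 // rmorph0 addr0.
  have [xE|[p xp]] := ord_cases t x; first by rewrite -/x xE; exact: vge0.
  move: x2; rewrite -/x /vge (ordX 2 xp) xp !lee_fin uphalf_half.
  have := odd_double_half k; lia.
have nears (s : R[i]) : nc s = 1 -> vge t k%:Z (x ^+ 2 - K (s ^+ 2)) ->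
    exists2 e, vge t (uphalf k)%:Z (c_ F n - e) &
    e = - 2%:R * a \/ exists2 c : R[i], nc c <= 1 & e = a + K c.
  move=> s1 x2; have s0 : s != 0 by rewrite -nc_gt0 s1.
  have [h|h] := square_root_split s0 k0 x0 x2.
    exists (a + K s); last by right; exists s => //; rewrite s1.
    by rewrite opprD addrA; exact: vge_le h.
  exists (a + K (- s)); last by right; exists (- s) => //; rewrite ncN s1.
  by rewrite rmorphN opprD addrA opprK; exact: vge_le h.
have xd : x ^+ 2 = (c_ F n.+1 - c_ F 1) / y by rewrite -idn -/x -/y mulfK.
have [p0|p1] := types n.+1; have [q0|q1] := types 1%N.
- apply: near0; rewrite xd; apply: over.
  have -> : c_ F n.+1 - c_ F 1 = (c_ F n.+1 - a) - (c_ F 1 - a) by ring.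
  exact: vgeB.
(* Here c_(n+1) is close to a and c_1 to - 2 a, so their difference is 3 a up to a regular term, as
   is y: the quotient x^2 is close to 1. In the mirror case that follows it is close to -1, whence
   the root i. *)
- apply: (nears 1); first exact: nc1.
  have -> : x ^+ 2 - K (1 ^+ 2) = ((c_ F n.+1 - a) - (c_ F 1 + 2%:R * a) - x) / y.
    by rewrite expr1n rmorph1; apply: (mulIf y0); rewrite mulrBl mul1r xd !divfK // yE; ring.
  apply: over; apply: vgeB => //; apply: vgeB => //; exact: vge_le q1.
- pose i0 : R[i] := (0 +i* 1)%C.
  have i2 : i0 ^+ 2 = -1.
    by rewrite expr2; apply/eqP; rewrite eq_complex /= !mul0r !mulr0 mulr1 sub0r addr0 oppr0 !eqxx.
  apply: (nears i0); first by rewrite /i0 /Normc.normc expr0n expr1n add0r sqrtr1.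
  have -> : x ^+ 2 - K (i0 ^+ 2) = ((c_ F n.+1 + 2%:R * a) - (c_ F 1 - a) + x) / y.
    by rewrite i2 rmorphN1 opprK; apply: (mulIf y0); rewrite mulrDl mul1r xd !divfK // yE; ring.
  apply: over; apply: vgeD => //; apply: vgeB => //; exact: vge_le p1.
- apply: near0; rewrite xd; apply: over.
  have -> : c_ F n.+1 - c_ F 1 = (c_ F n.+1 + 2%:R * a) - (c_ F 1 + 2%:R * a) by ring.
  by apply: vgeB; [exact: vge_le p1|exact: vge_le q1].
Qed.

End Poles.

(** * One disc on which the whole orbit is analytic *)

Section LocalModel.
Context (R : realType) (C : set (R[i] * R[i])) (F : functionField C)
  (hC : irreducible_curve C).
Implicit Types (s t : place F) (g h v w : F) (z : R[i]) (m n k : nat).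
Local Notation K := (ff_const F).
Local Notation a := (ff_a F).
Local Notation b := (ff_b F).
Context (t : place F) (u : F) (r : R) (psi : R[i] -> place F)
  (par : parametrizes t u r psi) (tu : uniformizer t u).

(** Meromorphy at the centre with a prescribed radius. It is stable under ring operations at that
    radius, so a disc that serves a and b serves every c_n. *)
Definition mero (r1 : R) g := exists k f, holo r1 f /\
  forall z, z != 0 -> nc z < r1 -> vge (psi z) 0 g /\ z ^+ k * value_at (psi z) g = f z.

Lemma mero_sub r1 r2 g : r2 <= r1 -> mero r1 g -> mero r2 g.
Proof.
move=> r21 [k [f [hf fE]]]; exists k, f; split; first exact: holo_sub hf.
by move=> z z0 zr; apply: fE => //; exact: lt_le_trans r21.
Qed.

Lemma mero_const r1 c : mero r1 (K c).
Proof.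
exists 0%N, (fun=> c); split; first exact: holo_cst.
by move=> z _ _; split; [exact: vge_const|rewrite expr0 mul1r value_const].
Qed.

Lemma mero_mul r1 g h : mero r1 g -> mero r1 h -> mero r1 (g * h).
Proof.
move=> [k [f [hf fE]]] [m [e [he eE]]]; exists (k + m)%N, (fun z => f z * e z).
split; first exact: holo_mul.
move=> z z0 zr; have [g0 gE] := fE z z0 zr; have [h0 hE] := eE z z0 zr.
split; first by rewrite -[0]addr0; exact: vgeM.
by rewrite (value_mul hC g0 h0) exprD -gE -hE; ring.
Qed.

Lemma mero_add r1 g h : mero r1 g -> mero r1 h -> mero r1 (g + h).
Proof.
move=> [k [f [hf fE]]] [m [e [he eE]]].
exists (k + m)%N, (fun z => z ^+ m * f z + z ^+ k * e z); split.
  by apply: holo_add; apply: holo_mul => //; apply: holo_exp; exact: holo_id.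
move=> z z0 zr; have [g0 gE] := fE z z0 zr; have [h0 hE] := eE z z0 zr.
split; first exact: vgeD.
by rewrite (value_add hC g0 h0) exprD -gE -hE; ring.
Qed.

Lemma mero_opp r1 g : mero r1 g -> mero r1 (- g).
Proof. by move=> h; have := mero_mul (mero_const r1 (-1)) h; rewrite rmorphN1 mulN1r. Qed.

Lemma mero_exp r1 g n : mero r1 g -> mero r1 (g ^+ n).
Proof.
move=> h; elim: n => [|n IH]; last by rewrite exprS; exact: mero_mul.
by rewrite expr0 -(rmorph1 K); exact: mero_const.
Qed.

Lemma mero_u r1 : r1 <= r -> mero r1 u.
Proof.
move=> r1r; case: par => _ _ pu _; exists 0%N, id; split; first exact: holo_id.
move=> z _ zr; rewrite expr0 mul1r; apply: pu; exact: lt_le_trans r1r.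
Qed.

Lemma mero_uV r1 : r1 <= r -> mero r1 u^-1.
Proof.
move=> r1r; case: par => _ _ pu _; exists 1%N, (fun=> 1); split; first exact: holo_cst.
move=> z z0 zr; have [u0 uz] := pu z (lt_le_trans zr r1r).
have ou : ord (psi z) u = 0%E by apply/(value_neq0 hC u0); rewrite uz.
by have [v0 ->] := value_inv hC ou; split=> //; rewrite uz expr1 mulfV.
Qed.

Lemma mero_exists g : exists r1, [/\ 0 < r1, r1 <= r & mero r1 g].
Proof.
have r0 : 0 < r by case: par.
have [->|[m gm]] := ord_cases t g.
  by exists r; split=> //; rewrite -(rmorph0 K); exact: mero_const.
have [r1 [f [r10 r1r hf _ fE]]] := parametrizes_order hC par tu gm.
exists r1; split=> //; case: m gm fE => n gm fE.
  exists 0%N, (fun z => z ^+ n * f z); split.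
    by apply: holo_mul => //; apply: holo_exp; exact: holo_id.
  by move=> z z0 zr; have [og ->] := fE z z0 zr; split; [exact: vge_ord|rewrite expr0 mul1r].
exists n.+1, f; split=> // z z0 zr; have [og ->] := fE z z0 zr; split; first exact: vge_ord.
by rewrite NegzE -exprnN mulrA mulfV ?mul1r // expf_neq0.
Qed.

Lemma mero_orbit r1 n : mero r1 a -> mero r1 b -> mero r1 (c_ F n).
Proof.
move=> ha hb; elim: n => [|n IH] //; rewrite c_S /cubic -(rmorph_nat K).
apply: mero_add => //; apply: mero_add; first exact: mero_exp.
apply: mero_opp; apply: mero_mul => //; apply: mero_mul; [exact: mero_const|exact: mero_exp].
Qed.

Lemma psi0 : psi 0 = t.
Proof. by case: par => r0 co _ _; have [_ + _ _ _] := co r r0 (lexx _). Qed.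

(** Removable singularity without loss of radius: near 0 the value is bounded, by its expansion on
    some smaller disc, so z^k divides the analytic numerator on the given one. *)
Lemma mero_regular r1 g : 0 < r1 -> r1 <= r -> mero r1 g -> vge t 0 g ->
  exists2 f, holo r1 f & forall z, nc z < r1 -> vge (psi z) 0 g /\ value_at (psi z) g = f z.
Proof.
move=> r10 r1r [k [e [he eE]]] g0; case: par => r0 _ _ reg.
have [r2 [f2 [r20 r2r hf2 f2E]]] := reg g g0; have [B [B0 hB]] := holo_bounded hf2.
have n0 : nc (0 : R[i]) < r1 by rewrite nc0.
have m0 : 0 < Num.min r1 r2 / 2 by rewrite divr_gt0 // lt_min r10.
have small z : nc z <= Num.min r1 r2 / 2 -> nc z < r1 /\ nc z < r2.
  have : Num.min r1 r2 / 2 < Num.min r1 r2 by rewrite ltr_pdivrMr // ltr_pMr ?ltr1n // lt_min r10.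
  by move=> h zr; have := le_lt_trans zr h; rewrite lt_min => /andP.
have [|f hf fE] := @holo_vanish R r1 e 0 k B _ he n0 m0.
  move=> z _; rewrite subr0 nc_gt0 => /andP[z0 /small[z1 z2]].
  have [_ <-] := eE z z0 z1; have [_ ->] := f2E z z2.
  by rewrite ncM ncX mulrC ler_wpM2r ?exprn_ge0 ?nc_ge0 // hB // ltW.
have agree z : z != 0 -> nc z < r1 -> value_at (psi z) g = f z.
  move=> z0 zr; have [_] := eE z z0 zr; rewrite (fE z (ltW zr)) subr0.
  by apply: mulfI; rewrite expf_neq0.
exists f => // z zr; have [->|z0] := eqVneq z 0; last first.
  by split; [have [] := eE z z0 zr|exact: agree].
have n2 : nc (0 : R[i]) < r2 by rewrite nc0.
have [v0 v2] := f2E 0 n2; split=> //; rewrite v2.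
pose r3 := Num.min r1 r2; have r30 : 0 < r3 by rewrite lt_min r10.
have n3 : nc (0 : R[i]) < r3 by rewrite nc0.
have hd : holo r3 (fun z => f2 z - f z).
  by apply: holo_subr; [apply: holo_sub hf2|apply: holo_sub hf]; rewrite ge_min lexx ?orbT.
have := @holo_zero R r3 _ 0 0 1 n3 hd ltr01; move=> h0.
apply/eqP; rewrite -subr_eq0; apply/eqP; apply: h0 => w wr /andP[w0 _].
rewrite subr0 nc_gt0 in w0; move: wr; rewrite lt_min => /andP[w1 w2].
by have [_ <-] := f2E w w2; rewrite agree // subrr nc0 mul0r.
Qed.

(** The condition [z ^+ k != 0] excludes the centre when k > 0 and nothing when k = 0, so poles and
    regular points are treated together. The quotient c / |z|^k is the M of the escape estimates. *)
Definition local_model (r1 : R) k (c : R) (f : nat -> R[i] -> R[i]) : Prop :=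
  [/\ 0 < r1 <= r, r1 <= 1, 1 <= c,
    forall z, z ^+ k != 0 -> nc z < r1 -> [/\ vge (psi z) 0 a, vge (psi z) 0 b,
      nc (value_at (psi z) a) <= c / nc z ^+ k & nc (value_at (psi z) b) <= (c / nc z ^+ k) ^+ 3] &
    forall n, holo r1 (f n) /\ forall z, z ^+ k != 0 -> nc z < r1 ->
      value_at (psi z) (c_ F n) * z ^+ k = f n z].

Lemma unit_scale z k g : z ^+ k != 0 -> nc z < r -> vge (psi z) 0 (u ^+ k * g) ->
  vge (psi z) 0 g /\ value_at (psi z) (u ^+ k * g) = z ^+ k * value_at (psi z) g.
Proof.
move=> zk zr ug; case: par => _ _ pu _; have [u0 uz] := pu z zr.
have uk : vge (psi z) 0 (u ^+ k) by have := vgeX k u0; rewrite mul0r.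
have vk : value_at (psi z) (u ^+ k) = z ^+ k by rewrite (value_exp hC k u0) uz.
have ok : ord (psi z) (u ^+ k) = 0%E by apply/(value_neq0 hC uk); rewrite vk.
have un := ord_inj_fin ok.
have g0 : vge (psi z) 0 g.
  have -> : g = (u ^+ k * g) / u ^+ k by rewrite mulrAC mulfV // mul1r.
  by have := vge_div ok ug; rewrite subr0.
by split=> //; rewrite (value_mul hC uk g0) vk.
Qed.

Lemma scale_regular k g : vge t (- k%:Z) g -> vge t 0 (u ^+ k * g).
Proof.
move=> gk; have := vgeM (vgeX k (vge_ord tu)) gk; apply: vge_le; lia.
Qed.

Lemma local_model_exists k : vge t (- k%:Z) a -> vge t (- (3 * k)%N%:Z) b ->
  (forall n, vge t (- k%:Z) (c_ F n)) ->
  exists r1 c f, local_model r1 k c f /\ (mero r1 a /\ mero r1 b).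
Proof.
move=> ak bk ck; have [ra [ra0 rar ma]] := mero_exists a; have [rb [rb0 rbr mb]] := mero_exists b.
pose r1 := Num.min 1 (Num.min ra rb).
have r10 : 0 < r1 by rewrite !lt_min ltr01 ra0.
have r1a : r1 <= ra by rewrite !ge_min lexx orbT.
have r1b : r1 <= rb by rewrite !ge_min lexx !orbT.
have r11 : r1 <= 1 by rewrite ge_min lexx.
have r1r : r1 <= r := le_trans r1a rar.
have {}ma := mero_sub r1a ma; have {}mb := mero_sub r1b mb.
have reg j g : mero r1 g -> vge t (- j%:Z) g -> exists2 f, holo r1 f &
    forall z, z ^+ j != 0 -> nc z < r1 -> vge (psi z) 0 g /\ value_at (psi z) g * z ^+ j = f z.
  move=> mg gj; have [f hf fE] := mero_regular r10 r1r (mero_mul (mero_exp j (mero_u r1r)) mg) (scale_regular gj).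
  exists f => // z zj zr; have [v0 <-] := fE z zr.
  by have [g0 ->] := unit_scale zj (lt_le_trans zr r1r) v0; rewrite mulrC.
have [fa hfa faE] := reg k a ma ak; have [fb hfb fbE] := reg (3 * k)%N b mb bk.
have [A [A0 hA]] := holo_bounded hfa; have [B [B0 hB]] := holo_bounded hfb.
have [f fP] := @choice _ _ (fun n f => holo r1 f /\ forall z, z ^+ k != 0 -> nc z < r1 ->
      value_at (psi z) (c_ F n) * z ^+ k = f z) (fun n => let: ex_intro2 f hf fE :=
        reg k (c_ F n) (mero_orbit n ma mb) (ck n) in
        ex_intro _ f (conj hf (fun z zk zr => (fE z zk zr).2))).
(* One constant for both coordinates: A <= c, and B <= c <= c^3 because c >= 1. *)
pose c := 1 + A + B; have c1 : 1 <= c by rewrite /c; lra.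
exists r1, c, f; split=> //; split=> //; first by rewrite r10.
move=> z zk zr; have zk3 : z ^+ (3 * k) != 0 by rewrite mulnC exprM expf_neq0.
have [a0 az] := faE z zk zr; have [b0 bz] := fbE z zk3 zr.
have w0 : 0 < nc z ^+ k by rewrite -ncX nc_gt0.
split=> //.
  rewrite ler_pdivlMr // -ncX -ncM az; apply: le_trans (hA z (ltW zr)) _; rewrite /c; lra.
have -> : (c / nc z ^+ k) ^+ 3 = c ^+ 3 / nc z ^+ (3 * k) by rewrite exprMn exprVn mulnC exprM.
rewrite ler_pdivlMr; last by rewrite -ncX nc_gt0.
rewrite -ncX -ncM bz.
apply: le_trans (hB z (ltW zr)) _; apply: (@le_trans _ _ c); first by rewrite /c; lra.
by rewrite exprS ler_peMr ?exprn_ege1 //; lra.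
Qed.

End LocalModel.

(** * The extension across bounded poles *)

Section PoleLimit.
Context (R : realType) (C : set (R[i] * R[i])) (F : functionField C)
  (hC : irreducible_curve C).
Implicit Types (z : R[i]) (m n : nat).
Local Notation K := (ff_const F).
Local Notation a := (ff_a F).
Local Notation b := (ff_b F).
Context (t : place F) (u : F) (r : R) (psi : R[i] -> place F)
  (par : parametrizes t u r psi) (tu : uniformizer t u).
Context (r1 : R) (k : nat) (c : R) (f : nat -> R[i] -> R[i]) (lm : local_model r psi r1 k c f).

Local Notation G z := (Gplus (psi z)).
Local Notation X n z := (nc (value_at (psi z) (c_ F n))).
Local Notation M z := (c / nc z ^+ k).

Lemma model_bounds z : z ^+ k != 0 -> nc z < r1 -> [/\ 1 <= M z, 0 <= G z,
  forall n, G z <= (3 ^+ n)^-1 * (ln (Num.max (X n z) (4 * M z)) + 1),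
  forall n, 4 * M z < X n z -> (3 ^+ n)^-1 * (ln (X n z) - 1) <= G z &
  forall n, `|G z - (3 ^+ n)^-1 * logplus (X n z)| <= (3 ^+ n)^-1 * (ln (4 * M z) + 1)].
Proof.
case: lm => r1r r11 c1 hab _ zk zr; have [a0 b0 aM bM] := hab z zk zr.
have zk0 : 0 < nc z ^+ k by rewrite -ncX nc_gt0.
have M1 : 1 <= M z.
  rewrite ler_pdivlMr // mul1r; apply: le_trans c1; apply: exprn_ile1; first exact: nc_ge0.
  by apply: ltW; exact: lt_le_trans r11.
have [g0 g1 g2] := escape_bounds M1 aM bM; have g3 := escape_approx M1 aM bM.
have E n : X n z = nc (orbit (value_at (psi z) a) (value_at (psi z) b) n).
  by have [_ ->] := regular_orbit hC n a0 b0.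
by split=> // n; rewrite ?E; [exact: g1|exact: g2|exact: g3].
Qed.

Context (k0 : (0 < k)%N) (ak : ord t a = (- k%:Z)%:E) (ck : forall n, vge t (- k%:Z) (c_ F n))
  (ma : mero psi r1 a) (mb : mero psi r1 b).

Let r10 : 0 < r1. Proof. by case: lm => /andP[]. Qed.
Let r1r : r1 <= r. Proof. by case: lm => /andP[]. Qed.
Let c1 : 1 <= c. Proof. by case: lm. Qed.

(** [chi] is (c_n - e) / u^(uphalf k), with e from [pole_expansion]. As e is - 2 a or a plus a
    constant of modulus at most 1, its modulus is at most 3 M, the price for exchanging c_n and
    chi. *)
Lemma orbit_expansion n : exists2 chi, holo r1 chi & forall z, z != 0 -> nc z < r1 ->
  X n z <= 3 * M z + nc z ^+ uphalf k * nc (chi z) /\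
  nc z ^+ uphalf k * nc (chi z) <= X n z + 3 * M z.
Proof.
have [e ve eE] := pole_expansion k0 ak ck n; set j := uphalf k in ve *.
have mc := mero_orbit hC n ma mb.
have me : mero psi r1 e.
  case: eE => [|[d _]] ->.
    have -> : - 2%:R * a = K (- 2%:R) * a by rewrite rmorphN rmorph_nat.
    by apply: mero_mul => //; exact: mero_const.
  by apply: mero_add => //; exact: mero_const.
have uj := mero_exp hC j (mero_uV hC par r1r).
have md := mero_mul hC uj (mero_add hC mc (mero_opp hC me)).
have v0 : vge t 0 (u^-1 ^+ j * (c_ F n - e)).
  have := vgeM (vge_ord (ordX j (ordV tu))) ve; apply: vge_le; lia.
have [chi hchi chiE] := mero_regular par r10 r1r md v0; exists chi => // z z0 zr.
have [c0 _] : vge (psi z) 0 (c_ F n) /\ True.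
  by have [? [? [_ h]]] := mc; have [] := h z z0 zr.
have [e0 _] : vge (psi z) 0 e /\ True.
  by have [? [? [_ h]]] := me; have [] := h z z0 zr.
have zk : z ^+ k != 0 by rewrite expf_neq0.
have [M1 _ _ _ _] := model_bounds zk zr.
have eM : nc (value_at (psi z) e) <= 3 * M z.
  case: lm => _ _ _ hab _; have [a0 _ aM _] := hab z zk zr.
  case: eE => [|[d d1]] ->.
    have -> : - 2%:R * a = K (- 2%:R) * a by rewrite rmorphN rmorph_nat.
    rewrite (value_mul hC (vge_const _ _) a0) value_const ncM ncN nc_nat; lra.
  rewrite (value_add hC a0 (vge_const _ _)) value_const.
  by apply: le_trans (ncD _ _) _; lra.
have cE : value_at (psi z) (c_ F n) - value_at (psi z) e = z ^+ j * chi z.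
  have [_ <-] := chiE z zr; case: par => _ _ pu _.
  have [u0 uz] := pu z (lt_le_trans zr r1r).
  have ou : ord (psi z) u = 0%E by apply/(value_neq0 hC u0); rewrite uz.
  have [uV uVz] := value_inv hC ou.
  have uVj : vge (psi z) 0 (u^-1 ^+ j) by have := vgeX j uV; rewrite mul0r.
  rewrite (value_mul hC uVj (vgeB c0 e0)) (value_exp hC j uV) uVz uz (value_sub hC c0 e0).
  by rewrite mulrA -exprMn mulfV // expr1n mul1r.
have <- : nc (value_at (psi z) (c_ F n) - value_at (psi z) e) = nc z ^+ j * nc (chi z) by rewrite cE ncM ncX.
split.
  by have := nc_dist_le (value_at (psi z) (c_ F n)) (value_at (psi z) e); lra.
by have := ncB (value_at (psi z) (c_ F n)) (value_at (psi z) e); lra.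
Qed.

(** On the circle c_n is at most max (4 M, e^(3^n bd + 1)) in modulus; this bounds chi there, hence
    inside by [holo_schwarz]. The condition on |z| says e^(3^n bd) |z|^(k + uphalf k) <= 1, which
    turns the bound into |c_n| <= D / |z|^k with [D] independent of n. *)
Lemma circle_estimate rho bd : 0 < rho -> rho < r1 -> (forall z, nc z = rho -> G z <= bd) ->
  exists2 D, 0 <= D & forall n z, 0 < nc z -> nc z <= 2^-1 * rho ->
    3 ^+ n * bd <= (k + uphalf k)%N%:R * - ln (nc z) ->
    G z <= (3 ^+ n)^-1 * (k%:R * - ln (nc z) + D).
Proof.
move=> rho0 rhor hm; set j := uphalf k.
have rj : 0 < rho ^+ j by rewrite exprn_gt0.
have rk : 0 < rho ^+ k by rewrite exprn_gt0.
(* 4 c covers the truncation at 4 M and the 3 M of the expansion at z; 7 = 4 + 3 combines the same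
   two on the circle, and 2 is 1 / (1 - 1/2). *)
pose D := 4 * c + 2 / rho ^+ j * (7 * (c / rho ^+ k) + expR 1).
have cr : 0 < c / rho ^+ k by rewrite divr_gt0 //; move: c1; lra.
have rj2 : 0 < 2 / rho ^+ j by rewrite divr_gt0.
have e1 : 0 < expR (1 : R) := expR_gt0 _.
have D4 : 4 * c <= D by rewrite /D lerDl mulr_ge0 ?ltW //; lra.
have D0 : 0 < D by move: c1; lra.
exists (ln D + 1); first by rewrite addr_ge0 // ln_ge0 //; move: c1; lra.
move=> n z z0 zr hz; have zn : z != 0 by rewrite -nc_gt0.
have zr1 : nc z < r1 by apply: le_lt_trans zr _; lra.
have [chi hchi chiE] := orbit_expansion n.
have circ w : nc w = rho -> nc (chi w) <= (7 * (c / rho ^+ k) + expR (3 ^+ n * bd + 1)) / rho ^+ j.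
  move=> wr; have wn : w != 0 by rewrite -nc_gt0 wr.
  have wr1 : nc w < r1 by rewrite wr.
  have [_] := chiE w wn wr1; have wk : w ^+ k != 0 by rewrite expf_neq0.
  have [M1 _ _ up _] := model_bounds wk wr1; rewrite wr in M1 up *.
  rewrite ler_pdivlMr // mulrC => h; apply: le_trans h _.
  have [xM|xM] := ltP (4 * (c / rho ^+ k)) (X n w); last first.
    by have := expR_gt0 (3 ^+ n * bd + 1); lra.
  have := up n xM; rewrite mulrC ler_pdivrMr ?pow3_gt0 // => h.
  have x0 : 0 < X n w by apply: lt_trans xM; lra.
  have : X n w <= expR (3 ^+ n * bd + 1).
    rewrite -{1}(lnK x0) ler_expR; have := hm w wr; have := pow3_gt0 R n; nra.
  lra.
have sch := holo_schwarz rho0 (holo_sub (ltW rhor) hchi) (_ : 0 <= 2^-1 < 1) circ zr.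
have {}sch := sch ltac:(lra).
have [zX _] := chiE z zn zr1; have zk : z ^+ k != 0 by rewrite expf_neq0.
have [M1 _ up _ _] := model_bounds zk zr1.
have zk0 : 0 < nc z ^+ k by rewrite exprn_gt0.
have zj0 : 0 < nc z ^+ j by rewrite exprn_gt0.
have z1 : nc z <= 1 by case: lm => _ r11 _ _ _; lra.
have zj1 : nc z ^+ j <= 1 by rewrite exprn_ile1 // nc_ge0.
have zk1 : nc z ^+ k <= 1 by rewrite exprn_ile1 // nc_ge0.
have E1 : expR (3 ^+ n * bd) * (nc z ^+ j * nc z ^+ k) <= 1.
  have -> : nc z ^+ j * nc z ^+ k = expR ((k + j)%N%:R * ln (nc z)).
    by rewrite expRM_natl lnK // -exprD addnC.
  apply: (@le_trans _ _ (expR 0)); last by rewrite expR0.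
  by rewrite -expRD ler_expR; move: hz; rewrite mulrN; lra.
have XD : X n z <= D / nc z ^+ k.
  rewrite ler_pdivlMr //; apply: le_trans (ler_wpM2r (ltW zk0) zX) _.
  rewrite mulrDl -mulrA divfK ?gt_eqF //.
  have : nc z ^+ j * nc (chi z) * nc z ^+ k <= 2 / rho ^+ j * (7 * (c / rho ^+ k) + expR 1).
    have s2 : nc (chi z) <= 2 / rho ^+ j * (7 * (c / rho ^+ k) + expR (3 ^+ n * bd + 1)).
      have e2 : (1 - 2^-1 : R) = 2^-1 by field.
      by apply: le_trans sch _; apply: eqRle; rewrite e2 invrK; ring.
    rewrite mulrAC mulrC; apply: le_trans (ler_wpM2r _ s2) _; first by rewrite mulr_ge0 // ltW.
    rewrite -[leLHS]mulrA ler_pM2l // mulrDl expRD.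
    have p1 : 7 * (c / rho ^+ k) * (nc z ^+ j * nc z ^+ k) <= 7 * (c / rho ^+ k).
      apply: ler_piMr; first by lra.
      by apply: mulr_ile1 => //; exact: ltW.
    rewrite mulrAC; have := ler_wpM2r (ltW e1) E1; lra.
  rewrite /D -/j; move: c1; lra.
apply: le_trans (up n) _; rewrite ler_pM2l ?invr_gt0 ?pow3_gt0 // addrA lerD2r.
have -> : k%:R * - ln (nc z) + ln D = ln (D / nc z ^+ k).
  by rewrite ln_div ?posrE // lnXn // -mulr_natl; ring.
have Dz : 0 < D / nc z ^+ k by rewrite divr_gt0.
have m0 : 0 < Num.max (X n z) (4 * M z) by rewrite lt_max; apply/orP; right; lra.
by rewrite ler_ln ?posrE // ge_max XD /= mulrA ler_pM2r ?invr_gt0.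
Qed.

Let q0 : 0 < (k + uphalf k)%N%:R :> R. Proof. by rewrite ltr0n addn_gt0 k0. Qed.

(** The ratio k / (k + uphalf k) <= 2/3 is the gain over the trivial bound. *)
Let kq : 3 * k%:R <= 2 * (k + uphalf k)%N%:R :> R.
Proof.
rewrite -!natrM ler_nat uphalf_half; have := odd_double_half k; lia.
Qed.

Lemma circle_step rho bd : 0 < rho -> rho < r1 -> 0 < bd -> (forall z, nc z = rho -> G z <= bd) ->
  exists rho', [/\ 0 < rho', rho' < r1 & forall z, nc z = rho' -> G z <= 3 / 4 * bd].
Proof.
move=> rho0 rhor bd0 hm; have [D D0 hD] := circle_estimate rho0 rhor hm.
have q0' := q0; have kq' := kq; set q : R := (k + uphalf k)%N%:R in q0' kq' hD.
(* As 2/3 + 1/12 = 3/4, the term 3^-n D may cost bd / 12. *)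
have m12 : 0 < bd / 12 by rewrite divr_gt0.
have [N1 h1] := pow3V_small D m12; have [N2 h2] := pow3V_small (q * - ln (2^-1 * rho)) bd0.
pose n := (N1 + N2)%N; have := h1 n (leq_addr _ _); have := h2 n (leq_addl _ _).
have p0 : 0 < 3 ^+ n :> R := pow3_gt0 R n.
rewrite mulrC ler_pdivrMr // => h3 h4.
have E : ln (expR (- (3 ^+ n * bd / q))) = - (3 ^+ n * bd / q) by rewrite expRK.
have small : expR (- (3 ^+ n * bd / q)) <= 2^-1 * rho.
  have r2 : 0 < 2^-1 * rho by rewrite mulr_gt0.
  rewrite -(lnK r2) ler_expR lerNl ler_pdivlMr //; lra.
(* The radius at which the condition of [circle_estimate] becomes an equality. *)
exists (expR (- (3 ^+ n * bd / q))); split; first exact: expR_gt0.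
  by apply: le_lt_trans small _; lra.
move=> z zE; have := hD n z; rewrite zE E opprK expR_gt0 small => /(_ isT isT).
have -> : q * (3 ^+ n * bd / q) = 3 ^+ n * bd by rewrite mulrC divfK // gt_eqF.
move=> /(_ (lexx _)) h; apply: le_trans h _.
have -> : (3 ^+ n)^-1 * (k%:R * (3 ^+ n * bd / q) + D) = k%:R * bd / q + (3 ^+ n)^-1 * D.
  rewrite mulrDr; congr (_ + _); have -> : k%:R * (3 ^+ n * bd / q) = 3 ^+ n * (k%:R * bd / q) by ring.
  by rewrite mulKf // gt_eqF.
have : k%:R * bd / q <= 2 / 3 * bd.
  rewrite ler_pdivrMr //; have : 3 * k%:R * bd <= 2 * q * bd by rewrite ler_pM2r.
  lra.
lra.
Qed.

Lemma small_circle e : 0 < e ->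
  exists rho, [/\ 0 < rho, rho < r1 & forall z, nc z = rho -> G z <= e].
Proof.
move=> e0.
have [bd [bd0 [rho [h1 h2 h3]]]] : exists bd, 0 < bd /\
    exists rho, [/\ 0 < rho, rho < r1 & forall z, nc z = rho -> G z <= bd].
  (* For n = 0 the orbit point is a itself, so ln (4 M) + 1 is a first bound on the circle. *)
  pose L := ln (4 * (c / (r1 / 2) ^+ k)) + 1.
  have rk : 0 < (r1 / 2) ^+ k by rewrite exprn_gt0 // divr_gt0.
  have hL z : nc z = r1 / 2 -> G z <= L /\ 0 < L.
    move=> zE; have z0 : z != 0 by rewrite -nc_gt0 zE divr_gt0.
    have zr : nc z < r1 by rewrite zE ltr_pdivrMr // ltr_pMr // ltr1n.
    have zk : z ^+ k != 0 by rewrite expf_neq0.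
    have [M1 _ up _ _] := model_bounds zk zr; case: lm => _ _ _ hab _.
    have [_ _ aM _] := hab z zk zr; have := up 0%N; rewrite expr0 invr1 mul1r max_r.
      by rewrite /L -zE; split=> //; rewrite ltr_wpDl // ln_ge0 //; lra.
    by rewrite /c_ /=; lra.
  have hr : nc ((r1 / 2)%:C%C : R[i]) = r1 / 2 by rewrite nc_real gtr0_norm // divr_gt0.
  exists L; split; first by have [] := hL _ hr.
  exists (r1 / 2); split; [by rewrite divr_gt0|by rewrite ltr_pdivrMr // ltr_pMr // ltr1n|].
  by move=> z /hL[].
have x01 : 0 <= (3 / 4 : R) < 1 by apply/andP; split; lra.
have [N hN] := pow_small bd x01 e0.
have [rho' [g1 g2 g3]] : exists rho', [/\ 0 < rho', rho' < r1 &
    forall z, nc z = rho' -> G z <= bd * (3 / 4) ^+ N].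
  elim: (N) => [|n [p [p1 p2 p3]]]; first by exists rho; split=> //; rewrite expr0 mulr1.
  have mn : 0 < bd * (3 / 4) ^+ n by rewrite mulr_gt0 // exprn_gt0 // divr_gt0.
  have [p' [q1 q2 q3]] := circle_step p1 p2 mn p3; exists p'; split=> // z zp.
  by rewrite exprS mulrCA; exact: q3.
by exists rho'; split=> // z /g3 /le_trans; exact.
Qed.

(** From one circle to a punctured disc. With l = - ln |z| and q = k + uphalf k, take the last n
    such that 3^n bd <= q l; then the bound 3^-n (k l + D) is at most 3^-n q l, which is less than 3
    bd = e by the choice of n. *)
Lemma Gplus_pole_limit e : 0 < e ->
  exists2 d, 0 < d <= r1 & forall z, 0 < nc z -> nc z < d -> G z <= e.
Proof.
move=> e0; have bd0 : 0 < e / 3 by rewrite divr_gt0.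
have [rho [rho0 rhor hm]] := small_circle bd0; set bd := e / 3 in bd0 hm.
have [D D0 hD] := circle_estimate rho0 rhor hm.
have eD := expR_gt0 (- (D + bd)).
(* Then l >= D + bd, so D is absorbed by (uphalf k) l, and n = 0 satisfies bd <= q l. *)
exists (Num.min (2^-1 * rho) (expR (- (D + bd)))).
  by rewrite lt_min mulr_gt0 ?eD // ge_min; apply/orP; left; lra.
move=> z z0; rewrite lt_min => /andP[z1 z2].
have l1 : D + bd <= - ln (nc z).
  by rewrite lerNr -ler_expR lnK //; exact: ltW.
set l := - ln (nc z) in l1 hD *; have q0' := q0; set q : R := (k + uphalf k)%N%:R in hD q0'.
have qk : q = k%:R + (uphalf k)%:R by rewrite /q natrD.
have j1 : 1 <= (uphalf k)%:R :> R by rewrite ler1n; move: k0; case: (k).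
have k1 : 1 <= k%:R :> R by rewrite ler1n.
have ex : exists n, q * l < 3 ^+ n * bd.
  have m2 : 0 < bd / 2 by rewrite divr_gt0.
  have [N hN] := pow3V_small (q * l) m2; exists N; have := hN N (leqnn _).
  rewrite mulrC ler_pdivrMr ?pow3_gt0 // => h; apply: le_lt_trans h _.
  by rewrite mulrC ltr_pM2l ?pow3_gt0 // ltr_pdivrMr // ltr_pMr // ltr1n.
have [n' hn' mn'] := ex_minnP ex.
have ql : bd <= q * l by rewrite qk; nra.
case: n' hn' mn' => [|n] hn mn; first by move: hn; rewrite expr0 mul1r ltNge ql.
have nl : 3 ^+ n * bd <= q * l.
  by rewrite leNgt; apply/negP => /mn; rewrite ltnn.
apply: le_trans (hD n z z0 (ltW z1) nl) _.
rewrite mulrC ler_pdivrMr ?pow3_gt0 //.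
rewrite -/l; have : k%:R * l + D <= q * l by rewrite qk; nra.
move: hn; rewrite exprS /bd; lra.
Qed.

End PoleLimit.

(** * Continuity and subharmonicity of the extension *)

Section Extension.
Context (R : realType) (C : set (R[i] * R[i])) (F : functionField C)
  (hC : irreducible_curve C).
Implicit Types (s : place F) (z p w : R[i]) (m n : nat).
Local Notation a := (ff_a F).
Local Notation b := (ff_b F).

(** At a pole [value_at] returns a default value and [Gplus] carries no information; 0 is the limit
    given by [Gplus_pole_limit] at poles outside [S0plus]. *)
Definition Gext s : R := if pselect (Splus s) then 0 else Gplus s.

Lemma Gext_regular s : ~ Splus s -> Gext s = Gplus s.
Proof. by rewrite /Gext; case: pselect. Qed.

Lemma Gext_pole s : Splus s -> Gext s = 0.
Proof. by rewrite /Gext; case: pselect. Qed.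

Context (t : place F) (u : F) (r : R) (psi : R[i] -> place F)
  (par : parametrizes t u r psi) (tu : uniformizer t u) (nS : ~ S0plus t).

Section Model.
Context (r1 : R) (k : nat) (c : R) (f : nat -> R[i] -> R[i]) (lm : local_model r psi r1 k c f)
  (kpos : Splus t -> (0 < k)%N /\ ord t a = (- k%:Z)%:E) (kzero : ~ Splus t -> k = 0%N)
  (ck : forall n, vge t (- k%:Z) (c_ F n)) (ma : mero psi r1 a) (mb : mero psi r1 b).

Local Notation H z := (Gext (psi z)).
Local Notation X n z := (nc (value_at (psi z) (c_ F n))).
Local Notation M z := (c / nc z ^+ k).

Let r10 : 0 < r1. Proof. by case: lm => /andP[]. Qed.
Let r1r : r1 <= r. Proof. by case: lm => /andP[]. Qed.
Let r11 : r1 <= 1. Proof. by case: lm. Qed.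
Let c1 : 1 <= c. Proof. by case: lm. Qed.
Let hf n : holo r1 (f n). Proof. by case: lm => _ _ _ _ /(_ n)[]. Qed.
Let fE n z : z ^+ k != 0 -> nc z < r1 -> value_at (psi z) (c_ F n) * z ^+ k = f n z.
Proof. by case: lm => _ _ _ _ /(_ n)[_]; apply. Qed.

Lemma not_Splus_model z : z ^+ k != 0 -> nc z < r1 -> ~ Splus (psi z).
Proof. by case: lm => _ _ _ h _ zk zr /SplusP; apply; have [] := h z zk zr. Qed.

Let HE z : z ^+ k != 0 -> nc z < r1 -> H z = Gplus (psi z).
Proof. by move=> zk zr; apply: Gext_regular; exact: not_Splus_model. Qed.

Lemma model_centre z : z ^+ k = 0 -> [/\ z = 0, Splus t, H z = 0 & (0 < k)%N].
Proof.
move=> /eqP; rewrite expf_eq0 => /andP[k0 /eqP ->]; have St : Splus t.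
  by apply: contrapT => /kzero kE; rewrite kE in k0.
by split=> //; rewrite (psi0 par) Gext_pole.
Qed.

Lemma model_limit e : 0 < e -> (0 < k)%N ->
  exists2 d, 0 < d <= r1 & forall z, nc z < d -> 0 <= H z <= e.
Proof.
move=> e0 k0; have St : Splus t by apply: contrapT => /kzero kE; rewrite kE in k0.
have [_ ak] := kpos St.
have [d /andP[d0 dr] hd] := Gplus_pole_limit hC par tu lm k0 ak ck ma mb e0.
exists d; first by rewrite d0.
move=> z zd; have [->|z0] := eqVneq z 0.
  by rewrite (psi0 par) Gext_pole // lexx ltW.
have zk : z ^+ k != 0 by rewrite expf_neq0.
have zr := lt_le_trans zd dr; have [_ g0 _ _ _] := model_bounds hC lm zk zr.
by rewrite HE // g0 hd // nc_gt0.
Qed.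

(** Away from a pole, 3^-n log+ |c_n| approximates [Gext] uniformly on a neighbourhood where |w|^k
    is bounded below, and it is continuous there. At the pole [model_limit] applies. *)
Lemma model_continuous z e : nc z < r1 -> 0 < e ->
  exists2 d, 0 < d & forall w, nc w < r1 -> nc (w - z) <= d -> `|H w - H z| <= e.
Proof.
move=> zr e0; have [zk|zk] := eqVneq (z ^+ k) 0.
  have [-> St H0 k0] := model_centre zk; have [d /andP[d0 dr] hd] := model_limit e0 k0.
  exists (d / 2); first by rewrite divr_gt0.
  move=> w wr; rewrite subr0 => wd; have -> : H 0 = 0 by rewrite (psi0 par) Gext_pole.
  have /andP[h1 h2] : 0 <= H w <= e by apply: hd; apply: le_lt_trans wd _; rewrite ltr_pdivrMr // ltr_pMr // ltr1n.
  by rewrite subr0 ger0_norm.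
have z0 : 0 < nc (z ^+ k) by rewrite nc_gt0.
set mz := nc (z ^+ k) / 2; have mz0 : 0 < mz by rewrite divr_gt0.
have hk : holo r1 (fun w => w ^+ k) by apply: holo_exp; exact: holo_id.
have [d1 [d10 _ hd1]] := holo_cont hk zr mz0.
have wlow w : nc (w - z) <= d1 -> mz <= nc w ^+ k.
  move=> /hd1 h; rewrite -ncX; have := nc_dist_le (z ^+ k) (w ^+ k); rewrite ncC /mz in h *; lra.
have e3 : 0 < e / 3 by rewrite divr_gt0.
have [n hn] := pow3V_small (ln (4 * (c / mz)) + 1) e3; have {}hn := hn n (leqnn _).
have ez : 0 < e / 3 * (nc (z ^+ k) * mz) by rewrite !mulr_gt0.
(* The difference c_n(w) - c_n(z) multiplied by z^k w^k, which avoids a quotient. *)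
have hg : holo r1 (fun w => f n w * z ^+ k - f n z * w ^+ k).
  by apply: holo_subr; apply: holo_mul => //; exact: holo_cst.
have [d2 [d20 _ hd2]] := holo_cont hg zr ez.
have p0 : 0 < (3 ^+ n)^-1 :> R by rewrite invr_gt0 pow3_gt0.
have p1 : (3 ^+ n)^-1 <= 1 :> R by rewrite invf_le1 ?pow3_gt0 // exprn_ege1 // ler1n.
have appr w : nc w < r1 -> nc (w - z) <= d1 -> w ^+ k != 0 /\
    `|H w - (3 ^+ n)^-1 * logplus (X n w)| <= e / 3.
  move=> wr wd; have wl := wlow w wd; have w0 : 0 < nc w ^+ k by exact: lt_le_trans wl.
  have wk : w ^+ k != 0 by rewrite -nc_gt0 ncX.
  split=> //; rewrite HE //; have [M1 _ _ _ ap] := model_bounds hC lm wk wr.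
  apply: le_trans (ap n) _; apply: le_trans hn; rewrite ler_pM2l // lerD2r.
  have c0 : 0 < c by move: c1; lra.
  have h : 4 * M w <= 4 * (c / mz).
    by apply: ler_wpM2l => //; apply: ler_wpM2l; [exact: ltW|rewrite lef_pV2 ?posrE].
  have h0 : 0 < 4 * M w by move: M1; lra.
  by rewrite ler_ln ?posrE //; exact: lt_le_trans h.
exists (Num.min d1 d2); first by rewrite lt_min d10.
move=> w wr; rewrite le_min => /andP[w1 w2].
have [wk hw] := appr w wr w1; have zd : nc (z - z) <= d1 by rewrite subrr nc0 ltW.
have [_ hz] := appr z zr zd.
have near : nc (value_at (psi w) (c_ F n) - value_at (psi z) (c_ F n)) <= e / 3.
  have := hd2 w w2; rewrite -!fE // subrr subr0.
  set v := value_at _ _; set v' := value_at _ _.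
  have -> : v * w ^+ k * z ^+ k - v' * z ^+ k * w ^+ k = (v - v') * (z ^+ k * w ^+ k) by ring.
  rewrite ncM ncM => h; have wl := wlow w w1; rewrite -ncX in wl.
  have q0 : 0 < nc (z ^+ k) * mz by rewrite mulr_gt0.
  rewrite -(ler_pM2r q0); apply: le_trans h; apply: ler_wpM2l; first exact: nc_ge0.
  by rewrite ler_pM2l.
have l3 := logplus_nc (value_at (psi w) (c_ F n)) (value_at (psi z) (c_ F n)).
set A := (3 ^+ n)^-1 * _ in hw; set B := (3 ^+ n)^-1 * _ in hz.
have AB : `|A - B| <= e / 3.
  rewrite /A /B -mulrBr normrM gtr0_norm //; apply: le_trans (_ : 1 * (e / 3) <= _); last by rewrite mul1r.
  by apply: ler_pM; [exact: ltW|exact: normr_ge0|exact: p1|exact: le_trans l3 near].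
move: hw hz AB; rewrite !ler_distl; lra.
Qed.

(** Built on the analytic z^k c_n instead of c_n, so that it makes sense at the pole and polynomials
    approximate it. *)
Let F_ n z : R := (3 ^+ n)^-1 * logplus (nc (f n z)).

Let p0 n : 0 < (3 ^+ n)^-1 :> R. Proof. by rewrite invr_gt0 pow3_gt0. Qed.
Let p1 n : (3 ^+ n)^-1 <= 1 :> R.
Proof. by rewrite invf_le1 ?pow3_gt0 // exprn_ege1 // ler1n. Qed.

(** As |z| <= 1, the factor z^k only lowers the modulus, so off the pole the escape bounds apply
    with a constant free of z. The pole itself is reached by continuity of [f n] and the limit 0 of
    [Gext], at the cost of e. *)
Lemma model_upper n z e : nc z < r1 -> 0 < e ->
  F_ n z <= H z + (3 ^+ n)^-1 * (1 + ln (4 * c)) + e.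
Proof.
have c4 : 1 <= 4 * c by move: c1; lra.
have lc : 0 <= ln (4 * c) by exact: ln_ge0.
have main w : w ^+ k != 0 -> nc w < r1 -> F_ n w <= H w + (3 ^+ n)^-1 * (1 + ln (4 * c)).
  move=> wk wr; have [M1 g0 _ up _] := model_bounds hC lm wk wr; rewrite HE // /F_ -fE // ncM ncX.
  have w0 : 0 < nc w ^+ k by rewrite -ncX nc_gt0.
  have w1 : nc w ^+ k <= 1 by apply: exprn_ile1; [exact: nc_ge0|exact: ltW (lt_le_trans wr r11)].
  have x0 := nc_ge0 (value_at (psi w) (c_ F n)).
  have [xM|xM] := ltP (4 * M w) (X n w).
    have l1 : logplus (X n w * nc w ^+ k) <= ln (X n w).
      apply: le_trans (logplus_le _ (_ : _ <= X n w)) _; rewrite ?mulr_ge0 ?(ltW w0) //.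
        by rewrite ler_piMr.
      by rewrite /logplus max_r // ln_ge0 //; lra.
    have := up n xM; have := p0 n; have : (3 ^+ n)^-1 * logplus (X n w * nc w ^+ k) <= (3 ^+ n)^-1 * ln (X n w).
      by rewrite ler_pM2l.
    have : 0 <= (3 ^+ n)^-1 * ln (4 * c) by rewrite mulr_ge0 // ltW.
    set P := (3 ^+ n)^-1; lra.
  have l1 : logplus (X n w * nc w ^+ k) <= ln (4 * c).
    apply: le_trans (logplus_le _ (_ : _ <= 4 * c)) _; rewrite ?mulr_ge0 ?(ltW w0) //.
      by rewrite -ler_pdivlMr // -mulrA.
    by rewrite /logplus max_r.
  have : (3 ^+ n)^-1 * logplus (X n w * nc w ^+ k) <= (3 ^+ n)^-1 * ln (4 * c) by rewrite ler_pM2l.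
  have := p0 n; set P := (3 ^+ n)^-1; move: g0; lra.
move=> zr e0; have [zk|zk] := eqVneq (z ^+ k) 0; last by have := main z zk zr; lra.
have [zE _ H0 k0] := model_centre zk; have e2 : 0 < e / 2 by rewrite divr_gt0.
have [d /andP[d0 dr] hd] := model_limit e2 k0.
have [d' [d'0 _ hd']] := holo_cont (hf n) zr e2.
pose w : R[i] := (Num.min (d / 2) d')%:C%C.
have m0 : 0 < Num.min (d / 2) d' by rewrite lt_min d'0 divr_gt0.
have wE : nc w = Num.min (d / 2) d' by rewrite nc_real gtr0_norm.
have wd : nc w < d by rewrite wE gt_min ltr_pdivrMr // ltr_pMr // ltr1n.
have wk : w ^+ k != 0 by rewrite expf_neq0 // -nc_gt0 wE.
have := main w wk (lt_le_trans wd dr); have /andP[_] := hd w wd.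
have dw : nc (f n w - f n z) <= e / 2 by apply: hd'; rewrite zE subr0 wE ge_min lexx orbT.
have := logplus_nc (f n w) (f n z); rewrite ler_distl => /andP[_ l1].
have : F_ n z <= F_ n w + e / 2.
  have : (3 ^+ n)^-1 * logplus (nc (f n z)) <= (3 ^+ n)^-1 * (logplus (nc (f n w)) + e / 2).
    rewrite ler_pM2l //; have := logplus_nc (f n w) (f n z); rewrite ler_distl => /andP[h _]; lra.
  rewrite mulrDr /F_; have : (3 ^+ n)^-1 * (e / 2) <= e / 2 by rewrite ler_piMl // ltW.
  lra.
rewrite H0; lra.
Qed.

(** Restoring the factor z^k costs 3^-n log+ (|z|^-k), which is not uniform in z; the sub-mean
    criterion asks for this side only at the centre of the circle. *)
Lemma model_lower z : nc z < r1 -> exists B, forall n, H z <= F_ n z + (3 ^+ n)^-1 * B.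
Proof.
move=> zr; have [zk|zk] := eqVneq (z ^+ k) 0.
  by have [_ _ -> _] := model_centre zk; exists 0 => n; rewrite mulr0 addr0 mulr_ge0 ?logplus_ge0 // ltW.
have z0 : 0 < nc z ^+ k by rewrite -ncX nc_gt0.
exists (logplus (nc z ^+ k)^-1 + (ln (4 * M z) + 1)) => n; rewrite HE //.
have [_ _ _ _ /(_ n)] := model_bounds hC lm zk zr; rewrite ler_distl => /andP[_ h].
have l1 : logplus (X n z) <= logplus (nc (f n z)) + logplus (nc z ^+ k)^-1.
  have {1}-> : X n z = nc (f n z) * (nc z ^+ k)^-1 by rewrite -fE // ncM ncX mulfK // gt_eqF.
  by apply: logplusM; rewrite ?invr_ge0 ?nc_ge0 // ltW.
have := ler_wpM2l (ltW (p0 n)) l1; rewrite /F_; move: h; set P := (3 ^+ n)^-1; lra.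
Qed.

Lemma model_subharmonic : planar_subharmonic (disc r1) (Gext \o (psi \o @toC R)).
Proof.
apply: (@planar_subharmonic_of R (disc r1) (fun z => H z)) => [p pr e e0|z rho rho0 sub e e0].
  have {}pr := disc_nc r10 pr; have [d d0 hd] := model_continuous pr e0.
  apply: (@near_plane R p _ (Num.min d (r1 - nc (toC p)))); first by rewrite lt_min d0 subr_gt0.
  move=> q; rewrite lt_min => /andP[q1 q2]; apply: hd; last exact: ltW.
  by have := nc_dist_le (toC q) (toC p); lra.
have inside w : nc (w - z) <= rho -> nc w < r1.
  by move=> /sub /(disc_nc r10); rewrite toC_ReIm.
have zr : nc z < r1 by apply: inside; rewrite subrr nc0 ltW.
have [B hB] := model_lower zr; have e4 : 0 < e / 4 by rewrite divr_gt0.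
have [N1 h1] := pow3V_small B e4; have [N2 h2] := pow3V_small (1 + ln (4 * c)) e4.
pose n := (N1 + N2)%N; have {}h1 := h1 n (leq_addr _ _); have {}h2 := h2 n (leq_addl _ _).
have [q hq] := hf n e4.
have lq w : nc w <= r1 -> `|F_ n w - (3 ^+ n)^-1 * logplus (nc q.[w])| <= e / 4.
  move=> wr; rewrite /F_ -mulrBr normrM (gtr0_norm (p0 n)).
  apply: le_trans (_ : 1 * (e / 4) <= _); last by rewrite mul1r.
  apply: ler_pM; [exact: ltW (p0 n)|exact: normr_ge0|exact: p1|].
  exact: le_trans (logplus_nc _ _) (hq w wr).
exists (3 ^+ n)^-1, q; split.
- exact: ltW (p0 n).
- have := lq z (ltW zr); rewrite ler_distl => /andP[_]; have := hB n; lra.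
move=> x; set w := z + _; have wr : nc w < r1.
  by apply: inside; rewrite /w addrAC subrr add0r ncM nc_cis mulr1 nc_real gtr0_norm.
have := lq w (ltW wr); rewrite ler_distl => /andP[+ _]; have := model_upper n wr e4; lra.
Qed.

Lemma model_avoids (p : R * R) : disc r1 p -> ~ S0plus (psi (toC p)).
Proof.
move=> /(disc_nc r10) pr; have [zk|zk] := eqVneq (toC p ^+ k) 0.
  by have [-> _ _ _] := model_centre zk; rewrite (psi0 par).
by move=> /(S0plus_Splus hC); exact: not_Splus_model.
Qed.

Lemma model_continuous_at : {for t, continuous Gext}.
Proof.
move=> A /nbhs_ballP[e /= e0 hA]; have z0 : nc (0 : R[i]) < r1 by rewrite nc0.
have e2 : 0 < e / 2 by rewrite divr_gt0.
have [d d0 hd] := model_continuous z0 e2.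
pose rho := Num.min d r1; have rho0 : 0 < rho by rewrite lt_min d0.
have rr1 : rho <= r1 by rewrite ge_min lexx orbT.
case: par => _ co _ _; have [_ tE _ _ oU] := co rho rho0 (le_trans rr1 r1r).
change (nbhs t (Gext @^-1` A)); rewrite nbhsE; exists ((psi \o @toC R) @` disc rho).
  by split=> //; exists (0, 0); [rewrite /disc /= expr0n addr0 exprn_gt0|exact: (psi0 par)].
move=> _ [p /(disc_nc rho0) + <-]; rewrite lt_min => /andP[pd pr]; apply: hA.
have := hd (toC p) pr; rewrite subr0 distrC /= (psi0 par) => /(_ (ltW pd)) h.
by rewrite /ball /=; apply: le_lt_trans h _; rewrite ltr_pdivrMr // ltr_pMr // ltr1n.
Qed.

End Model.

Lemma Gext_local : {for t, continuous Gext} /\ exists r1 psi',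
  [/\ coordinate_disc t u r1 psi', psi' @` disc r1 `<=` ~` S0plus (F := F) &
      planar_subharmonic (disc r1) (Gext \o psi')].
Proof.
have [k [kp kz ak bk ck]] := bounded_poles hC nS.
have [r1 [c [f [lm [ma mb]]]]] := local_model_exists hC par tu ak bk ck.
split; first exact: (model_continuous_at lm kp kz ck ma mb).
exists r1, (psi \o @toC R); split.
- by case: par => _ co _ _; case: (lm) => /andP[r10 r1r] _ _ _ _; exact: co.
- by move=> _ [p pr <-]; exact: (model_avoids lm kz).
- exact: (model_subharmonic lm kp kz ck ma mb).
Qed.

End Extension.

(** * The harmonic extension at infinity *)

Section EscapeCoordinates.
Context (R : realType).
Implicit Types (T : R[i] * R[i] * R[i]) (z a b c : R[i]) (j n : nat).

(* [T] stands for [(a / c, b / c^3, 1 / c)]; then [cubic a b c = c^3 (1 + defect T)]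
   and [step T] is the triple of the next iterate. *)
Definition defect T : R[i] := T.1.2 - 3%:R * T.1.1 ^+ 2.

Definition step T : R[i] * R[i] * R[i] :=
  (T.1.1 * T.2 ^+ 2 / (1 + defect T), T.1.2 * T.2 ^+ 6 / (1 + defect T) ^+ 3,
   T.2 ^+ 3 / (1 + defect T)).

(** These bounds give |defect| <= 1/16 + 3/16, below 1/2, and are kept by [step]: the powers of the
    last coordinate, at most 1/2, outweigh the division by 1 + defect, of modulus at least 1/2. *)
Definition small T : Prop := [/\ nc T.1.1 <= 4^-1, nc T.1.2 <= 16^-1 & nc T.2 <= 2^-1].

Lemma small_defect T : small T -> nc (defect T) <= 2^-1.
Proof.
move=> [hA hB _]; apply: le_trans (ncB _ _) _; rewrite ncM nc_nat ncX.
have : nc T.1.1 ^+ 2 <= 4^-1 ^+ 2 by rewrite lerXn2r ?nnegrE ?nc_ge0 ?invr_ge0.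
have -> : (4^-1 : R) ^+ 2 = 16^-1 by field.
lra.
Qed.

Lemma defect_low T : small T -> 2^-1 <= nc (1 + defect T).
Proof.
move=> /small_defect h; have := nc_dist_le 1 (- defect T); rewrite nc1 ncN opprK; lra.
Qed.

Lemma small_step T : small T -> small (step T).
Proof.
move=> hT; have d := defect_low hT; have [hA hB hI] := hT.
have d0 : 0 < nc (1 + defect T) by apply: lt_le_trans d.
have I0 := nc_ge0 T.2; have A0 := nc_ge0 T.1.1; have B0 := nc_ge0 T.1.2.
have pw m : nc T.2 ^+ m <= 2^-1 ^+ m by rewrite lerXn2r ?nnegrE ?invr_ge0.
have dw m : 2^-1 ^+ m <= nc (1 + defect T) ^+ m by rewrite lerXn2r ?nnegrE ?invr_ge0 ?nc_ge0.
split; rewrite /step /=.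
- rewrite ncM ncV (ncM T.1.1) (ncX T.2) ler_pdivrMr //.
  apply: le_trans (ler_pM A0 (exprn_ge0 2 I0) hA (pw 2%N)) _.
  by rewrite ler_pM2l ?invr_gt0 //; apply: le_trans d; lra.
- rewrite ncM ncV (ncM T.1.2) (ncX T.2) (ncX (1 + _)) ler_pdivrMr ?exprn_gt0 //.
  apply: le_trans (ler_pM B0 (exprn_ge0 6 I0) hB (pw 6%N)) _.
  by rewrite ler_pM2l ?invr_gt0 //; apply: le_trans (dw 3%N); lra.
- rewrite ncM ncV (ncX T.2) ler_pdivrMr //; apply: le_trans (pw 3%N) _.
  have q : (2^-1 : R) ^+ 3 <= 2^-1 * 2^-1 by lra.
  by apply: le_trans q _; rewrite ler_pM2l ?invr_gt0.
Qed.

Lemma small_iter T j : small T -> small (iter j step T).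
Proof. by move=> h; elim: j => //= j; exact: small_step. Qed.

(** From c^3 (1 + defect) by telescoping: ln |c_(n+j)| = 3^j (ln |c_n| + log_sum j). On small
    triples the terms are at most 3^-(j+1), so convergence is uniform. *)
Definition log_sum n T : R := \sum_(j < n) (3 ^+ j.+1)^-1 * ln (nc (1 + defect (iter j step T))).

Definition log_tail T : R := limn (log_sum^~ T).

Lemma ln_defect T : small T -> `|ln (nc (1 + defect T))| <= 1.
Proof.
move=> hT; have d := defect_low hT; have e := small_defect hT.
have d0 : 0 < nc (1 + defect T) by apply: lt_le_trans d.
have u := ncD 1 (defect T); rewrite nc1 in u.
have l2 : ln (2 : R) <= 1 by apply: (@le_ln1Dx R 1); lra.
have h1 : ln (nc (1 + defect T)) <= ln 2 by rewrite ler_ln ?posrE //; lra.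
have h2 : - ln 2 <= ln (nc (1 + defect T)) by rewrite -lnV ?posrE // ler_ln ?posrE ?invr_gt0.
rewrite ler_norml; lra.
Qed.

Lemma log_tail_approx T n : small T -> `|log_sum n T - log_tail T| <= 2 / 2 ^+ n.
Proof.
move=> hT; have [|l hl] := @geometric_cvg R (log_sum^~ T) 1.
  move=> m; rewrite /log_sum big_ord_recr /= addrAC subrr add0r normrM.
  have p0 : 0 < (3 ^+ m.+1)^-1 :> R by rewrite invr_gt0 pow3_gt0.
  rewrite gtr0_norm // mul1r; apply: le_trans (_ : (3 ^+ m.+1)^-1 * 1 <= _).
    by rewrite ler_pM2l // ln_defect //; exact: small_iter.
  rewrite mulr1 lef_pV2 ?posrE ?exprn_gt0 //; apply: (@le_trans _ _ (3 ^+ m)).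
    by rewrite lerXn2r ?nnegrE // ler_nat.
  by rewrite exprS ler_peMl ?exprn_ge0 // ler1n.
suff -> : log_tail T = l by have := hl n; rewrite mulr1.
apply/cvg_lim => //; apply/cvgrPdist_le => e e0; have [N hN] := @exp2_small R 2 e e0.
exists N => // m /= Nm; rewrite distrC; apply: le_trans (hl m) _; rewrite mulr1.
apply: le_trans hN; rewrite ler_pM2l // lef_pV2 ?posrE ?exprn_gt0 //.
by rewrite ler_weXn2l // ler1n.
Qed.

Lemma harm_log_tail r (A B I : R[i] -> R[i]) : holo r A -> holo r B -> holo r I ->
  (forall z, nc z <= r -> small (A z, B z, I z)) ->
  harm r (fun z => log_tail (A z, B z, I z)).
Proof.
move=> hA hB hI sm; pose T z := (A z, B z, I z).
have hT j : [/\ holo r (fun z => (iter j step (T z)).1.1), holo r (fun z => (iter j step (T z)).1.2)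
    & holo r (fun z => (iter j step (T z)).2)].
  elim: j => [|j [h1 h2 h3]] //.
  have hd : holo r (fun z => defect (iter j step (T z))).
    by apply: holo_subr => //; apply: holo_mul; [exact: holo_cst|exact: holo_exp].
  have hi : holo r (fun z => (1 + defect (iter j step (T z)))^-1).
    by apply: holo_inv1 => // z zr; apply: small_defect; apply: small_iter; exact: sm.
  split; rewrite /=.
  - by apply: holo_mul hi; apply: holo_mul => //; exact: holo_exp.
  - have E z : nc z <= r -> (iter j step (T z)).1.2 * (iter j step (T z)).2 ^+ 6 *
        (1 + defect (iter j step (T z)))^-1 ^+ 3 = (step (iter j step (T z))).1.2.
      by move=> _; rewrite /step /= exprVn.
    apply: holo_ext E _; apply: holo_mul; last exact: holo_exp.
    by apply: holo_mul => //; exact: holo_exp.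
  - by apply: holo_mul hi; exact: holo_exp.
have hd j : holo r (fun z => defect (iter j step (T z))).
  have [h1 h2 _] := hT j.
  by apply: holo_subr => //; apply: holo_mul; [exact: holo_cst|exact: holo_exp].
apply: harm_lim => e e0; have [n hn] := @exp2_small R 2 e e0.
exists (fun z => log_sum n (T z)); last first.
  by move=> z zr; rewrite distrC; apply: le_trans (log_tail_approx n (sm z zr)) hn.
apply: (@harm_sum R r n (fun j z => (3 ^+ j.+1)^-1 * ln (nc (1 + defect (iter j step (T z)))))) => j.
apply: harm_scale; apply: harm_ln1 => // z zr.
by apply: small_defect; apply: small_iter; exact: sm.
Qed.

(** The telescoped formula is inserted in [escape_approx] at index n + j, for M = 1 + |a| + |b|.
    There log+ is ln, because |c_(n+j)| >= 2 along a small orbit. *)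
Lemma escape_tail a b n : let c := orbit a b n in c != 0 -> small (a / c, b / c ^+ 3, c^-1) ->
  escape a b = (3 ^+ n)^-1 * (ln (nc c) + log_tail (a / c, b / c ^+ 3, c^-1)).
Proof.
move=> c c0 sm; set T := (a / c, _, _) in sm *.
have key j : [/\ orbit a b (n + j) != 0, iter j step T =
      (a / orbit a b (n + j), b / orbit a b (n + j) ^+ 3, (orbit a b (n + j))^-1) &
    ln (nc (orbit a b (n + j))) = 3 ^+ j * (ln (nc c) + log_sum j T)].
  elim: j => [|j [x0 TE lE]]; first by rewrite addn0 /log_sum big_ord0 addr0 expr0 mul1r.
  rewrite addnS; set x := orbit a b (n + j) in x0 TE lE *.
  have xE : orbit a b (n + j).+1 = x ^+ 3 * (1 + defect (iter j step T)).
    by rewrite /orbit iterS -/(orbit a b (n + j)) -/x TE /defect /cubic /=; field.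
  have sj := small_iter j sm; have dl := defect_low sj.
  have d0 : 1 + defect (iter j step T) != 0 by rewrite -nc_gt0; apply: lt_le_trans dl.
  rewrite xE; split.
  - by rewrite mulf_neq0 // expf_neq0.
  - rewrite iterS {1}/step; set d := 1 + defect _ in d0 *; rewrite TE /=.
    by congr (_, _, _); field; rewrite ?x0 ?d0.
  have x1 : 0 < nc x by rewrite nc_gt0.
  have d1 : 0 < nc (1 + defect (iter j step T)) by rewrite nc_gt0.
  rewrite ncM ncX lnM ?posrE ?exprn_gt0 // lnXn // lE /log_sum big_ord_recr /=.
  have p3 : 3 ^+ j.+1 != 0 :> R by rewrite gt_eqF // pow3_gt0.
  rewrite [in RHS]addrA [in RHS]mulrDr mulVKf //; congr (_ + _).
  by rewrite exprS -[LHS]mulr_natl; ring.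
have M1 : 1 <= 1 + nc a + nc b by have := nc_ge0 a; have := nc_ge0 b; lra.
have aM : nc a <= 1 + nc a + nc b by have := nc_ge0 b; lra.
have bM : nc b <= (1 + nc a + nc b) ^+ 3.
  apply: (@le_trans _ _ (1 + nc a + nc b)); first by have := nc_ge0 a; lra.
  by rewrite exprS ler_peMr ?exprn_ege1 //; lra.
have ap := escape_approx M1 aM bM; set Q := ln (4 * _) + 1 in ap.
apply/eqP; rewrite -subr_eq0 -normr_le0; apply/ler_addgt0Pl => e e0; rewrite addr0.
have e2 : 0 < e / 2 by rewrite divr_gt0.
have [N hN] := pow3V_small Q e2; have [N' hN'] := @exp2_small R 2 _ e2.
pose j := (N + N')%N; have [x0 TE lE] := key j.
have xl : logplus (nc (orbit a b (n + j))) = ln (nc (orbit a b (n + j))).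
  rewrite /logplus max_r //; apply: ln_ge0.
  have [_ _] := small_iter j sm; rewrite TE /= ncV => h.
  have x1 : 0 < nc (orbit a b (n + j)) by rewrite nc_gt0.
  by rewrite -(@lef_pV2 R) ?posrE // invr1; lra.
have n1 : (N <= n + j)%N by rewrite /j addnCA leq_addr.
have := ap (n + j)%N; rewrite xl lE exprD invfM -!mulrA mulKf ?gt_eqF ?pow3_gt0 // mulrA -invfM -exprD => h1.
have h2 := hN _ n1; have h3 := log_tail_approx j sm.
have h4 : `|log_sum j T - log_tail T| <= e / 2.
  apply: le_trans h3 _; apply: le_trans hN'; rewrite ler_pM2l // lef_pV2 ?posrE ?exprn_gt0 //.
  by rewrite ler_weXn2l ?ler1n // leq_addl.
have h5 : (3 ^+ n)^-1 * `|log_sum j T - log_tail T| <= e / 2.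
  apply: le_trans h4; rewrite ler_piMl // invf_le1 ?pow3_gt0 //.
  by rewrite exprn_ege1 // ler1n.
have h6 : `|(3 ^+ n)^-1 * (ln (nc c) + log_sum j T) - (3 ^+ n)^-1 * (ln (nc c) + log_tail T)| <= e / 2.
  rewrite -mulrBr normrM gtr0_norm ?invr_gt0 ?pow3_gt0 //.
  by have -> : ln (nc c) + log_sum j T - (ln (nc c) + log_tail T) = log_sum j T - log_tail T by ring.
have := le_trans h1 h2; move: h6; rewrite !ler_distl; lra.
Qed.

End EscapeCoordinates.

(** * Harmonicity at the points of S_0^+ *)

Section PartTwo.
Context (R : realType) (C : set (R[i] * R[i])) (F : functionField C)
  (hC : irreducible_curve C).
Implicit Types (s t : place F) (g u v w : F) (z : R[i]) (n k : nat).
Local Notation a := (ff_a F).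
Local Notation b := (ff_b F).

Definition values (A B I : F) s := (value_at s A, value_at s B, value_at s I).

(** Harmonicity has to be checked in a coordinate disc around every s of U, for every uniformizer;
    hence hypotheses at each point of U. There w is a unit, so ln |w| is harmonic, and the other
    values are analytic and small. *)
Lemma harmonic_escape (U : set (place F)) (A B I w : F) (x : R) : open U ->
  (forall s, U s -> [/\ vge s 0 A, vge s 0 B, vge s 0 I, vge s 0 w & small (values A B I s)]) ->
  (forall s, U s -> value_at s w != 0) ->
  harmonic_on U (fun s => x * (ln (nc (value_at s w)) + log_tail (values A B I s))).
Proof.
move=> oU reg w0 s Us v sv; have [r [psi par]] := local_parameter hC sv.
have [r1 /andP[r10 r1r] inU] := psi_open par oU Us.
have [sA sB sI sw _] := reg s Us; have ps := psi0 par.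
case: (par) => r0 co _ rg.
have [rA [fA [rA0 _ hA EA]]] := rg A sA; have [rB [fB [rB0 _ hB EB]]] := rg B sB.
have [rI [fI [rI0 _ hI EI]]] := rg I sI; have [rw [fw [rw0 _ hw Ew]]] := rg w sw.
have fw0 : fw 0 != 0.
  have l0 : nc (0 : R[i]) < rw by rewrite nc0.
  by have [_ <-] := Ew 0 l0; rewrite ps; exact: w0.
have [rv [rv0 rvw _ hv]] := holo_inv rw0 hw fw0.
pose m := Num.min r1 (Num.min (Num.min rA rB) (Num.min rI rv)).
have m0 : 0 < m by rewrite !lt_min r10 rA0 rB0 rI0 rv0.
have lt_m z : nc z <= m / 2 -> [/\ nc z < r1, nc z < rA, nc z < rB, nc z < rI & nc z < rv].
  move=> h; have : nc z < m by apply: le_lt_trans h _; rewrite ltr_pdivrMr // ltr_pMr // ltr1n.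
  by rewrite !lt_min => /and3P[h1 /andP[h2 h3] /andP[h4 h5]].
have m20 : 0 < m / 2 by rewrite divr_gt0.
have m2r1 : m / 2 <= r1.
  by have [h _ _ _ _] := lt_m ((m / 2)%:C%C) (eqRle (etrans (nc_real _) (gtr0_norm m20)));
    move: h; rewrite nc_real gtr0_norm // => /ltW.
have mle y : m <= y -> m / 2 <= y.
  by move=> h; apply: le_trans h; rewrite ler_pdivrMr // ler_pMr // ler1n.
have mA : m / 2 <= rA by apply: mle; rewrite !ge_min lexx !orbT.
have mB : m / 2 <= rB by apply: mle; rewrite !ge_min lexx !orbT.
have mI : m / 2 <= rI by apply: mle; rewrite !ge_min lexx !orbT.
have mv : m / 2 <= rv by apply: mle; rewrite !ge_min lexx !orbT.
exists (m / 2), (psi \o @toC R); split.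
- by apply: co => //; exact: le_trans r1r.
- move=> _ [p /(disc_nc m20) /ltW pr <-]; apply: inU; by have [] := lt_m _ pr.
apply: (@harm_planar R _ (fun z => x * (ln (nc (fw z)) + log_tail (fA z, fB z, fI z)))) => //.
  apply: harm_scale; apply: harm_add.
    apply: harm_ln => //; first by apply: holo_sub hw; exact: le_trans rvw.
    by move=> z zr; have [_] := hv z (le_trans zr mv).
  apply: harm_log_tail; [exact: holo_sub hA|exact: holo_sub hB|exact: holo_sub hI|].
  move=> z zr; have [h1 h2 h3 h4 h5] := lt_m z zr; have [_ <-] := EA z h2.
  have [_ <-] := EB z h3; have [_ <-] := EI z h4; by have [] := reg _ (inU z h1).
move=> p /(disc_nc m20) /ltW pr; have [h1 h2 h3 h4 h5] := lt_m _ pr.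
rewrite /= /values; have [_ ->] := EA _ h2; have [_ ->] := EB _ h3; have [_ ->] := EI _ h4.
by have [_ ->] := Ew _ (lt_le_trans h5 rvw).
Qed.

Lemma harmonic_at_infinity t u : S0plus t -> uniformizer t u ->
  exists N : nat, forall n : nat, (N <= n)%N ->
  exists (U : set (place F)) (h : place F -> R),
    [/\ open U, U t, harmonic_on U h &
        forall s, U s -> s <> t ->
          [/\ ~ Splus s, ord s u = 0%E &
              h s = Gplus s + (fine (gamma n t))%:~R / 3 ^+ n * ln (nc (value_at s u))]].
Proof.
move=> St tu.
have low g : exists p : int, vge t p g.
  by have [->|[m gm]] := ord_cases t g; [exists 0; exact: vge0|exists m; exact: vge_ord].
have [pa ha] := low a; have [pb hb] := low b.
(* With this lower bound on gamma_n the functions a / c_n, b / c_n^3 and 1 / c_n vanish at t. *)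
have [N hN] := St (1 + `|pa| + `|pb|); exists N => n Nn.
have := hN n Nn; rewrite /gamma; have [->|[m cm]] := ord_cases t (c_ F n); first by rewrite ord0.
rewrite cm -EFinN lee_fin => gm.
have [k kE] : exists k : nat, m = - k%:Z by exists `|m|%N; lia.
rewrite kE opprK in cm gm *.
have c0 : c_ F n != 0 := ord_inj_fin cm.
(* With k = gamma_n, the function w = u^k c_n is a unit at t, and ln |w| is ln |c_n| with its
   singularity removed by k ln |u|. *)
pose A := a / c_ F n; pose B := b / c_ F n ^+ 3; pose I := (c_ F n)^-1; pose w := u ^+ k * c_ F n.
have A1 : vge t 1 A by have := vge_div cm ha; apply: vge_le; lia.
have B1 : vge t 1 B by have := vge_div (ordX 3 cm) hb; apply: vge_le; lia.
have I1 : vge t 1 I by rewrite /vge (ordV cm) lee_fin; lia.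
have w0 : ord t w = 0%E by rewrite ordM (ordX k tu) cm -EFinD mul1r subrr.
have [r [psi par]] := local_parameter hC tu; case: (par) => r0 co pu rg.
have ps := psi0 par; have n0 : nc (0 : R[i]) = 0 := @nc0 R.
have shrink g (e : R) : 0 < e -> vge t 1 g -> exists2 r1, 0 < r1 <= r & forall z, nc z < r1 ->
    vge (psi z) 0 g /\ nc (value_at (psi z) g) <= e.
  move=> e0 g1; have g0 : vge t 0 g := vge_le ler01 g1.
  have [r1 [f [r10 r1r hf fE]]] := rg g g0; have l0 : nc (0 : R[i]) < r1 by rewrite n0.
  have f0 : f 0 = 0 by have [_ <-] := fE 0 l0; rewrite ps; apply/(value_eq0 hC g0).
  have [d [d0 dr hd]] := holo_cont hf l0 e0; rewrite n0 subr0 in dr.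
  exists d; first by rewrite d0 (le_trans dr).
  move=> z zd; have [v0 ->] := fE z (lt_le_trans zd dr); split=> //.
  by have := hd z; rewrite f0 !subr0; apply; exact: ltW.
have [rA /andP[rA0 rAr] hA] := shrink A (4^-1) (ltac:(by rewrite invr_gt0)) A1.
have [rB /andP[rB0 rBr] hB] := shrink B (16^-1) (ltac:(by rewrite invr_gt0)) B1.
have [rI /andP[rI0 rIr] hI] := shrink I (2^-1) (ltac:(by rewrite invr_gt0)) I1.
have wr : vge t 0 w := vge_ord w0.
have [rw' [fw [rw'0 rw'r hw Ew]]] := rg w wr.
have fw0 : fw 0 != 0.
  have l0 : nc (0 : R[i]) < rw' by rewrite n0.
  by have [_ <-] := Ew 0 l0; rewrite ps; apply/(value_neq0 hC wr).
have [rw [rw0 rww _ hv]] := holo_inv rw'0 hw fw0.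
have [ra [ra0 rar ma]] := mero_exists hC par tu a; have [rb [rb0 rbr mb]] := mero_exists hC par tu b.
pose r1 := Num.min (Num.min ra rb) (Num.min (Num.min rA rB) (Num.min rI rw)).
have r10 : 0 < r1 by rewrite !lt_min ra0 rb0 rA0 rB0 rI0 rw0.
have r1r : r1 <= r by rewrite ge_min (_ : Num.min ra rb <= r) // ge_min rar.
have lt_r z : nc z < r1 -> [/\ nc z < ra, nc z < rb, nc z < rA, nc z < rB & nc z < rI /\ nc z < rw].
  by rewrite !lt_min => /andP[/andP[h1 h2] /andP[/andP[h3 h4] /andP[h5 h6]]].
pose U := (psi \o @toC R) @` disc r1.
have [_ _ _ _ oU] := co r1 r10 r1r.
have UP s : U s -> exists2 z, nc z < r1 & psi z = s.
  by move=> [p /(disc_nc r10) pr <-]; exists (toC p).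
have reg s : U s -> [/\ vge s 0 A, vge s 0 B, vge s 0 I, vge s 0 w & small (values A B I s)].
  move=> /UP[z /lt_r[h1 h2 h3 h4 [h5 h6]] <-].
  have [a1 a2] := hA z h3; have [b1 b2] := hB z h4; have [i1 i2] := hI z h5.
  by have [w1 _] := Ew z (lt_le_trans h6 rww).
have wn s : U s -> value_at s w != 0.
  move=> /UP[z /lt_r[_ _ _ _ [_ h6]] <-]; have [_ ->] := Ew z (lt_le_trans h6 rww).
  by have [] := hv z (ltW h6).
exists U, (fun s => (3 ^+ n)^-1 * (ln (nc (value_at s w)) + log_tail (values A B I s))); split=> //.
- by exists (0, 0); [rewrite /disc /= !expr0n addr0 exprn_gt0|exact: ps].
- exact: harmonic_escape.
move=> s Us st; have [_ _ _ ws sm] := reg s Us; have wns := wn s Us.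
have [z zr zs] := UP s Us; have [h1 h2 _ _ _] := lt_r z zr.
have z0 : z != 0 by apply: contra_notN st => /eqP zE; rewrite -zs zE.
(* Off the centre the meromorphic a and b are regular, so s is not in [Splus] and the escape formula
   applies to their values. *)
have [ka [fa [_ /(_ z z0 h1)[as0 _]]]] := ma; have [kb [fb [_ /(_ z z0 h2)[bs0 _]]]] := mb.
have [us uz] := pu z (lt_le_trans zr r1r); rewrite zs in as0 bs0 us uz.
have [cs cE] := regular_orbit hC n as0 bs0.
have ous : ord s u = 0%E by apply/(value_neq0 hC us); rewrite uz.
have vw : value_at s w = z ^+ k * value_at s (c_ F n).
  have uks : vge s 0 (u ^+ k) by have := vgeX k us; rewrite mul0r.
  by rewrite (value_mul hC uks cs) (value_exp hC k us) uz.
have vc0 : value_at s (c_ F n) != 0 by apply: contraNneq wns => E; rewrite vw E mulr0.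
have oc : ord s (c_ F n) = 0%E by apply/(value_neq0 hC cs).
have [Is IE] := value_inv hC oc.
have oc3 := ordX 3 oc; rewrite mul0r in oc3.
have [I3s I3E] := value_inv hC oc3.
have VE : values A B I s = (value_at s a / value_at s (c_ F n),
    value_at s b / value_at s (c_ F n) ^+ 3, (value_at s (c_ F n))^-1).
  by rewrite /values (value_mul hC as0 Is) (value_mul hC bs0 I3s) IE I3E (value_exp hC 3 cs).
split=> //; first by move=> /SplusP; apply.
have GE : Gplus s = escape (value_at s a) (value_at s b) by [].
rewrite VE in sm *; rewrite GE (@escape_tail R _ _ n) -cE // vw uz ncM ncX lnM ?posrE ?exprn_gt0 ?nc_gt0 //.
rewrite lnXn ?nc_gt0 // -[ln (nc z) *+ k]mulr_natl /= -pmulrn.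
set P := (3 ^+ n)^-1; ring.
Qed.

End PartTwo.

Theorem theorem3p1 (R : realType) (C : set (R[i] * R[i]))
    (hC : irreducible_curve C) (F : functionField C) :
  (exists g : place F -> R,
    [/\ forall t, ~ Splus t -> g t = Gplus t,
        {within ~` S0plus (F := F), continuous g},
        subharmonic_on (~` S0plus (F := F)) g &
        forall t, Splus t -> ~ S0plus t -> g t = 0]) /\
  (forall t0 : place F, S0plus t0 -> forall u : F, uniformizer t0 u ->
    exists N : nat, forall n : nat, (N <= n)%N ->
    exists (U : set (place F)) (h : place F -> R),
      [/\ open U, U t0, harmonic_on U h &
          forall t, U t -> t <> t0 ->
            [/\ ~ Splus t, ord t u = 0%E &
                h t = Gplus t + (fine (gamma n t0))%:~R / 3 ^+ n *
                                ln (Normc.normc (value_at t u))]]).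
Proof.
split; last by move=> t0 St u tu; exact: harmonic_at_infinity.
exists (@Gext R C F); split.
- exact: Gext_regular.
(* [Gext] is continuous as a function on the whole curve at each point outside [S0plus]. *)
- apply: continuous_in_subspaceT => t; rewrite inE => nSt.
  have [u tu] := ord_uniformizer t; have [r [psi par]] := local_parameter hC tu.
  by have [] := Gext_local hC par tu nSt.
- move=> t nSt u tu; have [r [psi par]] := local_parameter hC tu.
  have [_ [r1 [psi' [h1 h2 h3]]]] := Gext_local hC par tu nSt.
  by exists r1, psi'.
- by move=> t St _; exact: Gext_pole.
Qed.
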